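(* Let $\varphi$ be an odd Schwartz function on $\mathbb{R}$, and let $\psi=\widehat{\varphi}$ be the Fourier transform of $\varphi$. For each odd integer $k\geq 3$ we have $$\varphi'(0)+\sum_{n=1}^{\infty}\frac{r_k(n)}{\sqrt{n}}\,\varphi(\sqrt{n}) = i\,\alpha_k\,\psi^{(k-2)}(0)+i\sum_{n=1}^{\infty}\frac{r_k(n)}{n^{(k-2)/2}}\Big[\sum_{j=0}^{(k-3)/2}\beta_{j,k}\,n^{j/2}\,\psi^{(j)}(\sqrt{n})\Big],$$ where $$\alpha_k=\frac{(-1)^{(k-3)/2}}{(k-2)!!}\Big(\frac{1}{2\pi}\Big)^{(k-3)/2},\qquad \beta_{j,k}=\frac{(-1)^j\,(k-j-3)!}{j!\,(k-2j-3)!!}\Big(\frac{1}{2\pi}\Big)^{(k-3)/2}\quad (0\leq j\leq (k-3)/2).$$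
   Context: The Fourier transform on $\mathbb{R}$ is normalized as $\widehat{f}(t)=\int_{\mathbb{R}} f(x)e^{-2\pi i t x}\,dx$. Here $r_k(n)=\#\{m\in\mathbb{Z}^k: |m|^2=n\}$ is the number of representations of $n$ as a sum of $k$ squares of integers (order and signs counted), $|\cdot|$ being the Euclidean norm. The double factorial is $n!!=n(n-2)(n-4)\cdots$ (ending in $1$ or $2$), with $0!!=1$. Schwartz functions are complex-valued. *)

(* Defs.v *)
From HB Require Import structures.
From mathcomp Require Import all_boot all_order all_algebra.
From mathcomp Require Import finmap.
From mathcomp Require Import complex.
From mathcomp Require Import all_classical all_reals all_analysis.

Set Implicit Arguments.
Unset Strict Implicit.
Unset Printing Implicit Defensive.

Import Order.TTheory GRing.Theory Num.Theory.
Import numFieldNormedType.Exports.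

Local Open Scope classical_set_scope.
Local Open Scope ring_scope.
Local Open Scope complex_scope.

Definition squares_reps (k n : nat) : set 'rV[int]_k :=
  [set m | \sum_(i < k) m 0 i ^+ 2 = n%:Z].

Arguments squares_reps : clear implicits.

Lemma finite_squares_reps k n : finite_set (squares_reps k n).
Proof.
pose F (g : {ffun 'I_k -> 'I_(n + n).+1}) : 'rV[int]_k :=
  \row_i ((g i : nat)%:Z - n%:Z).
apply: (@sub_finite_set _ _ (F @` setT)); last first.
  by apply: finite_image; exact: finite_finset.
move=> m /= hm.
have hle i : (m 0 i ^+ 2 <= n%:Z)%R.
  rewrite -hm (bigD1 i) //= lerDl; apply: sumr_ge0 => j _; exact: sqr_ge0.
have hb i : (`|m 0 i| <= n%:Z)%R.
  case: (leP `|m 0 i| n%:Z) => // hlt.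
  have := hle i; rewrite -real_normK ?num_real // leNgt => /negP []; rewrite expr2.
  have h1 : (1 <= `|m 0 i|)%R by rewrite -gtz0_ge1; apply: le_lt_trans hlt.
  by apply: (lt_le_trans hlt); rewrite ler_peMr.
exists [ffun i => inord `|(m 0 i + n%:Z)%R|%N] => //.
apply/rowP => i; rewrite !mxE ffunE inordK.
  by rewrite gez0_abs ?addrK //; have := hb i; rewrite ler_norml -lerBlDr sub0r => /andP[].
have := hb i; rewrite ler_norml => /andP[h1 h2].
rewrite ltnS -lez_nat gez0_abs; first by rewrite PoszD lerD2r.
by rewrite -lerBlDr sub0r.
Qed.

(* [fset_set A] is the finite set with the elements of [A] only when [A] is
   finite, which is [finite_squares_reps]. *)
Definition nb_squares_reps (k n : nat) : nat := #|` fset_set (squares_reps k n)|.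

Fixpoint dfact (n : nat) : nat :=
  if n is n'.+2 then (n * dfact n')%N else 1%N.

Section ComplexValued.
Context {R : realType}.
Implicit Type f : R -> R[i].

Definition cexp (z : R[i]) : R[i] :=
  (expR (complex.Re z))%:C * (cos (complex.Im z) +i* sin (complex.Im z)).

(* The library has no normed-module structure over [R] on [R[i]], hence
   derivatives and integrals of complex-valued functions of a real variable are
   taken on real and imaginary parts. *)
Definition cderiven (n : nat) f (x : R) : R[i] :=
  derive1n n (fun y => complex.Re (f y)) x +i*
  derive1n n (fun y => complex.Im (f y)) x.

Definition csmooth f : Prop :=
  forall (n : nat) (x : R),
    derivable (derive1n n (fun y => complex.Re (f y))) x 1 /\
    derivable (derive1n n (fun y => complex.Im (f y))) x 1.

Definition schwartz f : Prop :=
  csmooth f /\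
  forall m n : nat, exists C : R, forall x : R,
    `|x%:C ^+ m * cderiven n f x| <= C%:C.

Definition cintegral f : R[i] :=
  (\int[lebesgue_measure]_(x in setT) complex.Re (f x)) +i*
  (\int[lebesgue_measure]_(x in setT) complex.Im (f x)).

Definition fourier f (t : R) : R[i] :=
  cintegral (fun x => f x * cexp (- ((2 * pi * t * x)%:C * 'i%C))).

End ComplexValued.

Section Coefficients.
Context (R : realType).

Definition alpha (k : nat) : R :=
  (-1) ^+ (k - 3)./2 / (dfact (k - 2))%:R * (1 / (2 * pi)) ^+ (k - 3)./2.

Definition beta (j k : nat) : R :=
  (-1) ^+ j * ((k - j - 3)`!)%:R / ((j`!)%:R * (dfact (k - 2 * j - 3))%:R)
  * (1 / (2 * pi)) ^+ (k - 3)./2.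

End Coefficients.

(* Main.v *)
Require Import Defs.
From HB Require Import structures.
From mathcomp Require Import all_boot all_order all_algebra.
From mathcomp Require Import finmap.
From mathcomp Require Import complex.
From mathcomp Require Import all_classical all_reals all_analysis.
From mathcomp Require Import measurable_realfun.
From mathcomp Require Import zify ring lra.

(** Why the formula holds.  Put [k = 2 K + 3].  For an odd real [phi] the function
[x |-> phi x / x] is even, hence gives a radial function
[f v = phi |v| / |v|] on [R ^ k], with [f 0 = phi' 0].  Its Fourier transform is again
radial; in terms of the sine transform [S] of [phi] it is a combination of
[xi ^ - (2 K + 1 - j) * S^(j) xi] for [j <= K], because going from dimension [d] to
[d + 2] applies [- (2 pi xi)^-1 * d / d xi] to the radial profile, starting from
[S xi / xi].  Unrolling this recursion gives the coefficients [beta], and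
[alpha] is what is left at the origin.  So the statement is Poisson summation
for [f] on [Z ^ k], with the points of [Z ^ k] collected by their norm.
Since [i * psi] has [S] for its value when [phi] is real, the complex case
follows by applying the real one to both parts of [phi].

The proof needs no integration on [R ^ k].  On the odd Gaussians
[y * exp (- pi t y ^ 2)] both sides are explicit ([radial_ogauss],
[radial0_ogauss]) and the formula is the functional equation of the [k]-th power
of [theta t = sum_m exp (- pi t m ^ 2)].  That equation is proved on the line
([theta_functional_equation]) by testing a Gaussian against Fejer kernels, and
[theta_power] turns [theta ^ k] into the generating function of the numbers of
representations.

To pass from odd Gaussians to [phi] one needs a topology in which they are
dense and in which both sides are continuous.  Weighted supremum norms
[sup (1 + |y|) ^ A * |phi y|] make the density easy: up to a small error
[phi y = y * w * p w] with [w = exp (- pi y ^ 2)] and [p] a polynomial, by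
Weierstrass ([odd_gauss_approx]).  They do not control the dual side, whose
convergence uses derivatives of [phi].  Therefore the formula is first
regularised: [phi] is replaced by its mollification at scale [s],
which multiplies the dual side by the convergence factor [exp (- pi s ^ 2 n)].
For fixed [s] both sides are then continuous for the weighted norms
([defect_le]), and the regularised formula holds for every rapidly decreasing
odd [phi] ([defect_sum]).  Finally, for [phi] in the Schwartz class every term
of the regularised formula is within [s * D / (n + 1) ^ 2] of its limit
([defect_rate]), so that [s] may tend to [0] ([limit_defect_sum]). *)

Set Implicit Arguments.
Unset Strict Implicit.
Unset Printing Implicit Defensive.

Import Order.TTheory GRing.Theory Num.Theory.
Import numFieldNormedType.Exports.

Local Open Scope classical_set_scope.
Local Open Scope ring_scope.

(** * Integrals of functions of quadratic decay *)

Section Integrals.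
Context {R : realType}.
Implicit Types (f g h : R -> R) (x y C : R).
Notation mu := (@lebesgue_measure R).

Definition weight y : R := 1 + `|y|.

Lemma weight_ge1 y : 1 <= weight y.
Proof. by rewrite /weight lerDl. Qed.

Lemma weight_gt0 y : 0 < weight y.
Proof. exact: lt_le_trans (weight_ge1 y). Qed.

Lemma weight_continuous : continuous weight.
Proof. by move=> y; apply: cvgD; [exact: cvg_cst|exact: norm_continuous]. Qed.

Lemma continuous_measurable_EFin f : continuous f ->
  measurable_fun setT (EFin \o f).
Proof. by move=> cf; apply/measurable_EFinP; apply: continuous_measurable_fun. Qed.

Lemma integrable_oneDsqrV :
  mu.-integrable setT (EFin \o (fun y : R => (oneDsqr y)^-1)).
Proof.
apply/integrableP; split.
  by apply: continuous_measurable_EFin; exact: continuous_oneDsqrV.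
under eq_integral => x _ /=.
  rewrite ger0_norm; last by rewrite invr_ge0 (le_trans _ (oneDsqr_ge1 x)).
over.
rewrite ge0_symfun_integralT.
- rewrite -set_itvcy (integral0y_oneDsqr).
  by rewrite ltry.
- by move=> x; rewrite invr_ge0 (le_trans _ (oneDsqr_ge1 x)).
- exact: continuous_oneDsqrV.
- by move=> x /=; rewrite /oneDsqr sqrrN.
Qed.

Definition lorentz_mass : R := \int[mu]_(y in setT) (oneDsqr y)^-1.

Lemma lorentz_mass_ge0 : 0 <= lorentz_mass.
Proof.
apply: Rintegral_ge0 => x _.
by rewrite invr_ge0 (le_trans _ (oneDsqr_ge1 x)).
Qed.

(** The integrable majorant [1 / (1 + y ^ 2)] has a known integral, and is below
    a multiple of any quadratic decay rate. *)
Lemma decay_lorentz f C : (forall y, weight y ^+ 2 * `|f y| <= C) ->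
  forall y, `|f y| <= C * (oneDsqr y)^-1.
Proof.
move=> fC y; rewrite ler_pdivlMr; last exact: lt_le_trans (oneDsqr_ge1 y).
apply: le_trans (fC y); rewrite mulrC ler_wpM2r//.
rewrite /oneDsqr /weight -(@real_normK _ y) ?num_real// sqrrD expr1n mul1r.
by rewrite lerD2r lerDl mulrn_wge0.
Qed.

Lemma decay_integrable f C : continuous f ->
  (forall y, weight y ^+ 2 * `|f y| <= C) -> mu.-integrable setT (EFin \o f).
Proof.
move=> cf fC.
have := integrableZl measurableT C integrable_oneDsqrV.
apply: le_integrable => //.
  exact: continuous_measurable_EFin.
move=> x _ /=; rewrite lee_fin.
apply: (le_trans (decay_lorentz fC x)).
exact: ler_norm.
Qed.

Lemma decay_Rintegral_le f C : continuous f ->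
  (forall y, weight y ^+ 2 * `|f y| <= C) ->
  `|\int[mu]_(y in setT) f y| <= C * lorentz_mass.
Proof.
move=> cf fC.
have fi := decay_integrable cf fC.
apply: le_trans; first exact: (le_normr_Rintegral measurableT fi).
rewrite /lorentz_mass -RintegralZl//; last exact: integrable_oneDsqrV.
apply: le_Rintegral => //.
- exact: (integrable_norm fi).
- exact: (integrableZl measurableT _ integrable_oneDsqrV).
- by move=> x _; exact: (decay_lorentz fC x).
Qed.

(** Dominated convergence; this gives access to the whole-line integral through
    the fundamental theorem of calculus and through sums over unit cells. *)
Lemma cvg_Rintegral_itv f C (c : R) : continuous f ->
  (forall y, weight y ^+ 2 * `|f y| <= C) ->
  \int[mu]_(y in `[- (n%:R + c), n%:R + c]) f y @[n --> \oo]
     --> \int[mu]_(y in setT) f y.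
Proof.
move=> cf fC.
have fi := decay_integrable cf fC.
pose I (n : nat) := [set` `[- (n%:R + c), n%:R + c]] : set R.
have mf n : measurable_fun setT (EFin \o (f \_ (I n))).
  apply/measurable_EFinP; apply/(measurable_restrictT _ _).1 => //.
  - exact: measurable_itv.
  - by apply: measurable_funTS; exact: continuous_measurable_fun.
have cvgf : {ae mu, forall x : R, setT x ->
    (EFin \o (f \_ (I n))) x @[n --> \oo] --> (EFin \o f) x}.
  apply: aeW => x _; apply: cvg_near_cst.
  exists (Num.truncn (`|x| + `|c|)).+1 => // n /= nx; rewrite patchE mem_set//=.
  rewrite /I /= in_itv /= -ler_norml.
  have : `|x| + `|c| < n%:R.
    apply: lt_le_trans (truncnS_gt _) _; by rewrite ler_nat.
  by have := ler_norm (- c); rewrite normrN; lra.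
have dom : {ae mu, forall (x : R) n, setT x ->
    (`|(EFin \o (f \_ (I n))) x| <= (`|f x|%R)%:E)%E}.
  apply: aeW => x n _ /=; rewrite lee_fin patchE; case: ifP => //.
  by rewrite normr0.
have [fi' _ cv] := @dominated_convergence _ _ R mu setT measurableT
  (fun n => EFin \o (f \_ (I n))) _ (fun x => (`|f x|%R)%:E) mf
  (continuous_measurable_EFin cf) cvgf (integrable_norm fi) dom.
have -> : (fun n : nat => \int[mu]_(y in I n) f y) =
          fine \o (fun n => \int[mu]_x (EFin \o (f \_ (I n))) x)%E.
  by apply/funext => n /=; rewrite Rintegral_mkcond.
apply: fine_cvg; rewrite fineK//.
  exact: integrable_fin_num.
Qed.

End Integrals.

(** * Rapidly decreasing functions and their sine transforms *)

Section Trig.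
Context {R : realType}.
Implicit Types (f g h : R -> R) (x y C : R).
Notation mu := (@lebesgue_measure R).

Lemma weight_expr_le (A B : nat) y : (A <= B)%N -> weight y ^+ A <= weight y ^+ B :> R.
Proof. by move=> AB; rewrite ler_weXn2l// weight_ge1. Qed.

(** The source of every integration by parts below: the boundary terms at
    [- (n + 1)] and [n + 1] tend to zero. *)
Lemma Rintegral_derivative h h' C C' :
  (forall x, is_derive x 1 h (h' x)) -> continuous h' ->
  (forall y, weight y ^+ 2 * `|h' y| <= C) ->
  (forall y, weight y * `|h y| <= C') ->
  \int[mu]_(y in setT) h' y = 0.
Proof.
move=> dh ch' h'C hC.
have cv := cvg_Rintegral_itv 1 ch' h'C.
apply/esym.
apply: (cvg_unique _ _ cv) => //.
have -> : (fun n : nat => \int[mu]_(y in `[(- (n%:R + 1)), (n%:R + 1)]) h' y) =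
    (fun n => h (n%:R + 1) - h (- (n%:R + 1))).
  apply/funext => n; rewrite /Rintegral (@continuous_FTC2 _ h' h).
  - by rewrite -EFinB.
  - have : (0 <= n%:R :> R) by [].
    by lra.
  - exact: continuous_subspaceT.
  - have ch x : {for x, continuous h}.
      apply: differentiable_continuous; apply/derivable1_diffP.
      by have [] := dh x.
    split.
    + by move=> x _; have [] := dh x.
    + by apply: cvg_at_right_filter; exact: ch.
    + by apply: cvg_at_left_filter; exact: ch.
  - by move=> x _; rewrite derive1E; apply: derive_val.
apply/cvgr0Pnorm_le => e e0; near=> n.
have bd y : `|y| = n%:R + 1 -> `|h y| <= e / 2.
  move=> yn.
  have := hC y; rewrite /weight yn => hy.
  have n0 : (0 < 1 + (n%:R + 1) :> R) by rewrite addr_gt0// addr_gt0// ltr0n; near: n; exists 1%N.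
  rewrite -(ler_pM2l n0); apply: (le_trans hy).
  rewrite -ler_pdivrMr; last by rewrite divr_gt0.
  have : C' / (e / 2) <= n%:R by near: n; exact: nbhs_infty_ger.
  by lra.
apply: (le_trans (ler_normB _ _)).
have b1 := bd (n%:R + 1) (ger0_norm _).
have b2 := bd (- (n%:R + 1)).
have n1 : `|n%:R + 1| = n%:R + 1 :> R by rewrite ger0_norm.
move: b2; rewrite normrN n1 => /(_ erefl) b2.
have b1' := b1 _.
have : `|h (n%:R + 1)| <= e / 2 by apply: bd.
by lra.
Unshelve. all: by end_near.
Qed.

(** The [j]-th derivative of [sin], so that differentiating under the integral
    sign shifts an index instead of alternating between [sin] and [cos]. *)
Fixpoint dsin (j : nat) (z : R) : R :=
  match j with 0 => sin z | 1 => cos z | j'.+2 => - dsin j' z end.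

Lemma dsinSS j z : dsin j.+2 z = - dsin j z.
Proof. by []. Qed.

Lemma is_derive_dsin j z : is_derive z (1 : R) (dsin j) (dsin j.+1 z).
Proof.
suff : is_derive z (1 : R) (dsin j) (dsin j.+1 z) /\
       is_derive z (1 : R) (dsin j.+1) (dsin j.+2 z) by case.
elim: j => [|j [IH1 IH2]].
  by split; [exact: is_derive_sin|exact: is_derive_cos].
split => //.
exact: is_deriveN.
Qed.

Lemma normr_dsin j z : `|dsin j z| <= 1.
Proof.
suff : `|dsin j z| <= 1 /\ `|dsin j.+1 z| <= 1 by case.
elim: j => [|j [IH1 IH2]]; last by split => //; rewrite dsinSS normrN.
by split; rewrite ler_norml ?sin_geN1 ?sin_le1 ?cos_geN1 ?cos_le1.
Qed.

Lemma is_derive_continuous h (h' : R -> R) : (forall x, is_derive x 1 h (h' x)) -> continuous h.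
Proof.
move=> dh x; apply: differentiable_continuous; apply/derivable1_diffP.
by have [] := dh x.
Qed.

Lemma is_derive_mull (c y : R) : is_derive y (1 : R) (fun y : R => c * y) c.
Proof.
have := @is_deriveZ _ _ _ (@id R) c y 1 1 (is_derive_id _ _).
by rewrite /GRing.scale /= mulr1.
Qed.

Lemma is_derive_dsin_scale j (w y : R) :
  is_derive y 1 (fun y => dsin j (w * y)) (w * dsin j.+1 (w * y)).
Proof.
have d1 := is_derive_mull w y.
have := @is_derive1_comp _ (dsin j) (fun y => w * y) y _ _ (is_derive_dsin j (w * y)) d1.
by rewrite mulrC.
Qed.

Lemma is_derive_exp n y : is_derive y 1 (fun y : R => y ^+ n.+1) (n.+1%:R * y ^+ n).
Proof.
have -> : (fun y : R => y ^+ n.+1) = (@id R) ^+ n.+1.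
  by apply/funext => z; rewrite exprfctE.
have H := @is_deriveX _ _ (@id R) n y 1 1 (is_derive_id _ _).
by apply: is_derive_eq; rewrite /GRing.scale /= mulr1.
Qed.

Lemma is_derive_sqr c y : is_derive y 1 (fun y : R => c * y ^+ 2) (c * (2 * y)).
Proof.
have H := @is_deriveZ _ _ _ (fun y : R => y ^+ 2) c y 1 _ (is_derive_exp 1 y).
by apply: is_derive_eq; rewrite /GRing.scale /= expr1.
Qed.

(** Functions of polynomial growth: the multipliers of the class [rapid]. *)
Definition slow g := continuous g /\ exists (B : nat) C, forall y, `|g y| <= C * weight y ^+ B.
(** The class on which the regularised formula is proved; continuity and decay
    are all that the approximation by odd Gaussians requires. *)
Definition rapid f := continuous f /\ forall A : nat, exists C, forall y, weight y ^+ A * `|f y| <= C.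

Lemma slow_bounded g C : continuous g -> (forall y, `|g y| <= C) -> slow g.
Proof. by move=> cg gC; split => //; exists 0%N, C => y; rewrite expr0 mulr1. Qed.

Lemma slow_cst c : slow (fun=> c).
Proof. by apply: (slow_bounded (C := `|c|)) => //; exact: cst_continuous. Qed.

Lemma slow_id : slow id.
Proof.
split; first by move=> x; exact: cvg_id.
by exists 1%N, 1 => y; rewrite mul1r expr1 /weight lerDr.
Qed.

Lemma slow_expr_bounded g : slow g -> exists (B : nat) C,
  0 <= C /\ forall y, `|g y| <= C * weight y ^+ B.
Proof.
move=> [_ [B [C gC]]]; exists B, `|C|; split => // y.
by apply: (le_trans (gC y)); rewrite ler_wpM2r ?ler_norm// exprn_ge0// ltW// weight_gt0.
Qed.

Lemma slowD f g : slow f -> slow g -> slow (fun y => f y + g y).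
Proof.
move=> sf sg; split.
  by move=> x; apply: cvgD; [exact: sf.1|exact: sg.1].
have [B [C [C0 fC]]] := slow_expr_bounded sf.
have [B' [C' [C'0 gC]]] := slow_expr_bounded sg.
exists (B + B')%N, (C + C') => y; apply: (le_trans (ler_normD _ _)).
rewrite mulrDl lerD//.
  by apply: (le_trans (fC y)); rewrite ler_wpM2l// weight_expr_le// leq_addr.
by apply: (le_trans (gC y)); rewrite ler_wpM2l// weight_expr_le// leq_addl.
Qed.

Lemma slowM f g : slow f -> slow g -> slow (fun y => f y * g y).
Proof.
move=> [cf [B [C fC]]] [cg [B' [C' gC]]]; split.
  by move=> x; apply: cvgM; [exact: cf|exact: cg].
exists (B + B')%N, (C * C') => y; rewrite normrM exprD mulrACA ler_pM//.
Qed.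

Lemma slowB f g : slow f -> slow g -> slow (fun y => f y - g y).
Proof.
move=> sf sg; apply: slowD => //.
by under eq_fun do rewrite -mulN1r; apply: slowM => //; exact: slow_cst.
Qed.

Lemma slowX f n : slow f -> slow (fun y => f y ^+ n).
Proof.
move=> sf; elim: n => [|n IH].
  by under eq_fun do rewrite expr0; exact: slow_cst.
by under eq_fun do rewrite exprS; exact: slowM.
Qed.

Lemma slow_dsin j w : slow (fun y => dsin j (w * y)).
Proof.
apply: (slow_bounded (C := 1)); last by move=> y; exact: normr_dsin.
exact: is_derive_continuous (is_derive_dsin_scale j w).
Qed.

Lemma rapid_gt0 f (A : nat) : rapid f ->
  exists2 C, 0 < C & forall y, weight y ^+ A * `|f y| <= C.
Proof.
move=> [_ /(_ A)[C fC]]; exists (`|C| + 1); first by rewrite ltr_wpDl.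
by move=> y; apply: (le_trans (fC y)); have := ler_norm C; lra.
Qed.

Lemma rapidM f g : rapid f -> slow g -> rapid (fun y => f y * g y).
Proof.
move=> rf [cg [B [C gC]]]; split.
  by move=> x; apply: cvgM; [exact: rf.1|exact: cg].
move=> A; have [D D0 fD] := rapid_gt0 (A + B) rf.
exists (D * C) => y; rewrite normrM mulrA.
have w0 : 0 < weight y ^+ B by rewrite exprn_gt0// weight_gt0.
have := fD y; rewrite exprD => fDy.
have gCy := gC y.
have -> : weight y ^+ A * `|f y| * `|g y| =
  (weight y ^+ A * weight y ^+ B * `|f y|) * (`|g y| / weight y ^+ B).
  by field; rewrite gt_eqF// weight_gt0.
rewrite ler_pM// ?mulr_ge0 ?invr_ge0 ?exprn_ge0 ?(ltW (weight_gt0 _))//.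
by rewrite ler_pdivrMr.
Qed.

Lemma rapidMl f g : slow f -> rapid g -> rapid (fun y => f y * g y).
Proof. by move=> sf rg; under eq_fun do rewrite mulrC; exact: rapidM. Qed.

Lemma rapidD f g : rapid f -> rapid g -> rapid (fun y => f y + g y).
Proof.
move=> [cf rf] [cg rg]; split.
  by move=> x; apply: cvgD; [exact: cf|exact: cg].
move=> A; have [C fC] := rf A; have [D gD] := rg A; exists (C + D) => y.
apply: le_trans (lerD (fC y) (gD y)).
by rewrite -mulrDr ler_wpM2l ?exprn_ge0 ?(ltW (weight_gt0 _))// ler_normD.
Qed.

Lemma rapidZ c f : rapid f -> rapid (fun y => c * f y).
Proof. by apply: rapidMl; exact: slow_cst. Qed.

Lemma rapidN f : rapid f -> rapid (fun y => - f y).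
Proof. by move=> rf; under eq_fun do rewrite -mulN1r; exact: rapidZ. Qed.

Lemma rapidB f g : rapid f -> rapid g -> rapid (fun y => f y - g y).
Proof. by move=> rf rg; apply: rapidD => //; exact: rapidN. Qed.

Lemma rapid_cst0 : rapid (fun=> 0).
Proof. by split; [exact: cst_continuous|move=> A; exists 0 => y; rewrite normr0 mulr0]. Qed.

Lemma rapid_sum n (F : nat -> R -> R) : (forall i, rapid (F i)) ->
  rapid (fun y => \sum_(i < n) F i y).
Proof.
move=> rF; elim: n => [|n IH].
  by under eq_fun do rewrite big_ord0; exact: rapid_cst0.
by under eq_fun do rewrite big_ord_recr/=; exact: rapidD.
Qed.

Lemma rapid_integrable f : rapid f -> mu.-integrable setT (EFin \o f).
Proof. by move=> [cf /(_ 2%N)[C fC]]; exact: decay_integrable fC. Qed.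

Lemma rapid_Rintegral_derivative h h' :
  (forall x, is_derive x 1 h (h' x)) -> rapid h -> rapid h' ->
  \int[mu]_(y in setT) h' y = 0.
Proof.
move=> dh [_ /(_ 1%N)[C hC]] [ch' /(_ 2%N)[C' hC']].
apply: (Rintegral_derivative dh ch' hC' (C' := C)).
by move=> y; rewrite -[weight y]expr1.
Qed.

(** Bounds a transform by a weighted supremum norm of [f]; two powers of the
    weight pay for integrability and [A] of them for the growth of [g]. *)
Lemma Rintegral_weight_le (A : nat) f g C D : rapid f -> slow g ->
  (forall y, weight y ^+ (A + 2) * `|f y| <= C) ->
  (forall y, `|g y| <= D * weight y ^+ A) ->
  `|\int[mu]_(y in setT) (f y * g y)| <= C * D * lorentz_mass.
Proof.
move=> rf sg fC gD; apply: decay_Rintegral_le; first by have [] := rapidM rf sg.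
move=> y; rewrite normrM.
have w0 : 0 < weight y ^+ A by rewrite exprn_gt0// weight_gt0.
have -> : weight y ^+ 2 * (`|f y| * `|g y|) =
  (weight y ^+ (A + 2) * `|f y|) * (`|g y| / weight y ^+ A).
  by rewrite exprD; field; rewrite gt_eqF// weight_gt0.
rewrite ler_pM// ?mulr_ge0 ?invr_ge0 ?exprn_ge0 ?(ltW (weight_gt0 _))//.
by rewrite ler_pdivrMr.
Qed.

(** The sine transform for [j = 0] and the cosine transform for [j = 1]. *)
Definition sintr g (j : nat) (xi : R) : R :=
  \int[mu]_(y in setT) (g y * dsin j (2 * pi * xi * y)).

(** Differentiation under the integral sign, dominated by
    [|g y * (2 pi y)|]. *)
Lemma is_derive_sintr g j (xi : R) : rapid g ->
  is_derive xi (1 : R) (sintr g j : R -> R) (sintr (fun y => g y * (2 * pi * y)) j.+1 xi).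
Proof.
move=> rg.
have rG : rapid (fun y => g y * (2 * pi * y)).
  by apply: rapidM => //; apply: slowM; [exact: slow_cst|exact: slow_id].
have dG (x y : R) : is_derive x 1 (fun xi => g y * dsin j (2 * pi * xi * y))
     (g y * (2 * pi * y) * dsin j.+1 (2 * pi * x * y)).
  have := is_derive_dsin_scale j (2 * pi * y) x.
  move/(@is_deriveZ _ _ _ _ (g y)) => d1.
  under eq_fun do rewrite mulrAC.
  apply: is_derive_eq.
  by rewrite (mulrAC (2 * pi) x y) -[LHS]/(g y * (_ * _)) mulrA.
have D1 x y : partial1of2 (fun xi y => g y * dsin j (2 * pi * xi * y)) x y =
   g y * (2 * pi * y) * dsin j.+1 (2 * pi * x * y).
  by rewrite partial1of2E; apply: derive_val.
(* The neighbourhood of [xi] is arbitrary, the domination being global. *)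
have h1 : (`]xi - 1, xi + 1[%classic : set R) xi by rewrite /= in_itv /=; apply/andP; split; lra.
pose F (x y : R) := g y * dsin j (2 * pi * x * y).
have h2 x : (`]xi - 1, xi + 1[%classic : set R) x -> mu.-integrable setT (EFin \o F x).
  by move=> _; apply: rapid_integrable; apply: rapidM => //; exact: slow_dsin.
have h3 x y : (`]xi - 1, xi + 1[%classic : set R) x -> setT y -> derivable (F ^~ y) x 1.
  by move=> _ _; have [] := dG x y.
have h4 y : 0 <= `|g y * (2 * pi * y)| by [].
have h5 := integrable_norm (rapid_integrable rG).
have h6 x y : (`]xi - 1, xi + 1[%classic : set R) x -> setT y ->
    `|partial1of2 F x y| <= `|g y * (2 * pi * y)|.
  by move=> _ _; rewrite D1 normrM ler_piMr// normr_dsin.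
apply: DeriveDef.
  exact: (derivable_under_integral measurableT h1 h2 h3 h4 h5 h6).
rewrite -derive1E (differentiation_under_integral measurableT h1 h2 h3 h4 h5 h6).
by apply: eq_Rintegral => y _; rewrite D1.
Qed.

Lemma sintr_by_parts g g' j xi : rapid g -> rapid g' ->
  (forall x, is_derive x 1 g (g' x)) ->
  2 * pi * xi * sintr g j xi = sintr g' j.+1 xi.
Proof.
move=> rg rg' dg.
set w := 2 * pi * xi.
have r1 : rapid (fun y => g' y * dsin j.+1 (w * y)) by apply: rapidM => //; exact: slow_dsin.
have r2 : rapid (fun y => g y * dsin j (w * y)) by apply: rapidM => //; exact: slow_dsin.
have r3 : rapid (fun y => w * (g y * dsin j (w * y))) by exact: rapidZ.
have := @rapid_Rintegral_derivative (fun y => g y * dsin j.+1 (w * y))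
  (fun y => g' y * dsin j.+1 (w * y) - w * (g y * dsin j (w * y))).
rewrite RintegralB//; [|exact: rapid_integrable..].
rewrite RintegralZl//; [|exact: rapid_integrable..].
rewrite -/(sintr g j xi) -/(sintr g' j.+1 xi) => H.
apply/esym/eqP; rewrite -subr_eq0; apply/eqP; apply: H.
- move=> x; have d1 := is_derive_dsin_scale j.+1 w x.
  have d2 := dg x.
  apply: is_derive_eq; rewrite /GRing.scale /=; ring.
- by apply: rapidM => //; exact: slow_dsin.
- exact: rapidB.
Qed.

End Trig.

(** * Gaussians *)

Section Gauss.
Context {R : realType}.
Implicit Types (f g h : R -> R) (a x y xi C : R).
Notation mu := (@lebesgue_measure R).

Definition gauss a y : R := expR (- (pi * a) * y ^+ 2).

Lemma gauss_ge0 a y : 0 <= gauss a y. Proof. exact: expR_ge0. Qed.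

Lemma gauss_le1 a y : 0 <= a -> gauss a y <= 1.
Proof.
move=> a0; rewrite /gauss -[leRHS]expR0 ler_expR mulNr oppr_le0.
by rewrite mulr_ge0 ?sqr_ge0// mulr_ge0// pi_ge0.
Qed.

Lemma gauss0 a : gauss a 0 = 1.
Proof. by rewrite /gauss expr0n mulr0 expR0. Qed.

Lemma gaussN a y : gauss a (- y) = gauss a y.
Proof. by rewrite /gauss sqrrN. Qed.

Lemma is_derive_gauss a y :
  is_derive y 1 (gauss a) (- (2 * pi * a) * (y * gauss a y)).
Proof.
have d1 := is_derive_sqr (- (pi * a)) y.
have := @is_derive1_comp _ expR _ y _ _ (is_derive_expR _) d1.
by move=> H; apply: is_derive_eq; rewrite /gauss; ring.
Qed.

Lemma weight_le_expR y : weight y <= expR `|y|.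
Proof. exact: expR_ge1Dx. Qed.

Lemma rapid_gauss a : 0 < a -> rapid (gauss a).
Proof.
move=> a0; split; first exact: is_derive_continuous (is_derive_gauss a).
move=> A; pose b := pi * a; have b0 : 0 < b by rewrite mulr_gt0 ?pi_gt0.
exists (expR (A%:R ^+ 2 / (4 * b))) => y.
rewrite (ger0_norm (gauss_ge0 _ _)).
have : weight y ^+ A <= expR (A%:R * `|y|).
  rewrite expRM_natl.
  by rewrite lerXn2r ?nnegrE ?expR_ge0 ?(ltW (weight_gt0 _)) ?weight_le_expR.
move=> wA; apply: (le_trans (ler_wpM2r (gauss_ge0 a y) wA)).
rewrite /gauss -expRD ler_expR -/b -(@real_normK _ y) ?num_real//.
set z := `|y|; rewrite ler_pdivlMr; last by lra.
have := sqr_ge0 (2 * b * z - A%:R); lra.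
Qed.

(** Read off from the normal distribution of variance [1 / (2 pi a)]. *)
Lemma Rintegral_gauss_shift a c : 0 < a ->
  \int[mu]_(y in setT) gauss a (y - c) = (Num.sqrt a)^-1.
Proof.
move=> a0.
have pi0 : 0 < pi :> R := pi_gt0 R.
pose s := (Num.sqrt (2 * pi * a))^-1.
have q0 : 0 < 2 * pi * a by rewrite !mulr_gt0.
have s0 : s != 0 by rewrite invr_eq0 sqrtr_eq0 -ltNge.
have s2 : s ^+ 2 = (2 * pi * a)^-1 by rewrite exprVn sqr_sqrtr// ltW.
have E y : gauss a (y - c) = (Num.sqrt a)^-1 * normal_pdf c s y.
  rewrite normal_pdfE// /normal_peak s2 /normal_fun mulrA -invfM -sqrtrM ?(ltW a0)//.
  have -> : a * ((2 * pi * a)^-1 * pi *+ 2) = 1.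
    rewrite -mulr_natr; move: (pi : R) pi0 => p p0; field.
    by rewrite (gt_eqF a0) (gt_eqF p0).
  rewrite sqrtr1 invr1 mul1r /gauss; congr expR.
  rewrite s2 -mulr_natr; move: (pi : R) pi0 => p p0; field.
  by rewrite (gt_eqF a0) (gt_eqF p0).
under eq_Rintegral do rewrite E.
rewrite RintegralZl//; last exact: integrable_normal_pdf.
by rewrite /Rintegral integral_normal_pdf /= mulr1.
Qed.

Lemma Rintegral_gauss a : 0 < a -> \int[mu]_(y in setT) gauss a y = (Num.sqrt a)^-1.
Proof.
move=> a0; rewrite -(Rintegral_gauss_shift 0 a0).
by apply: eq_Rintegral => y _; rewrite subr0.
Qed.

Definition ogauss a y : R := y * gauss a y.

Lemma slow_exp n : slow (fun y : R => y ^+ n).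
Proof. by apply: slowX; exact: slow_id. Qed.

Lemma rapid_ogauss a : 0 < a -> rapid (ogauss a).
Proof. by move=> a0; apply: rapidMl; [exact: slow_id|exact: rapid_gauss]. Qed.

(** The derivative of the Gaussian is a multiple of the odd Gaussian, so that
    integration by parts trades one for the other. *)
Lemma sintr_ogauss_gauss a xi : 0 < a ->
  a * sintr (ogauss a) 0 xi = xi * sintr (gauss a) 1 xi.
Proof.
move=> a0; have pi0 : 0 < pi :> R := pi_gt0 R.
have r1 := rapid_gauss a0; have r2 := rapid_ogauss a0.
have := @sintr_by_parts _ (gauss a) (fun y => - (2 * pi * a) * ogauss a y) 1 xi r1
  (rapidZ (- (2 * pi * a)) r2) (is_derive_gauss a).
have -> : sintr (fun y => - (2 * pi * a) * ogauss a y) 2 xi =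
          2 * pi * a * sintr (ogauss a) 0 xi.
  rewrite /sintr.
  under eq_Rintegral do rewrite dsinSS mulNr mulrNN -mulrA.
  rewrite RintegralZl//.
  by apply: rapid_integrable; apply: rapidM => //; exact: slow_dsin.
move=> E.
have p2 : 2 * pi != 0 :> R by rewrite mulf_neq0 ?gt_eqF.
by apply: (mulfI p2); rewrite !mulrA -E; ring.
Qed.

(** By [is_derive_sintr] and [sintr_ogauss_gauss] the transform [F] satisfies
    [F' xi = - 2 pi / a * xi * F xi], the differential equation of
    [gauss a^-1]. *)
Lemma sintr_gauss a xi : 0 < a ->
  sintr (gauss a) 1 xi = (Num.sqrt a)^-1 * gauss a^-1 xi.
Proof.
move=> a0; have an0 : a != 0 by rewrite gt_eqF.
have r1 := rapid_gauss a0; have r2 := rapid_ogauss a0.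
pose F x := sintr (gauss a) 1 x * expR (pi * a^-1 * x ^+ 2).
have dF x : is_derive x 1 F 0.
  have d1 := @is_derive_sintr _ (gauss a) 1 x r1.
  have E : sintr (fun y => gauss a y * (2 * pi * y)) 2 x =
       - (2 * pi) * (x * a^-1 * sintr (gauss a) 1 x).
    have -> : x * a^-1 * sintr (gauss a) 1 x = sintr (ogauss a) 0 x.
      by apply: (mulfI an0); rewrite sintr_ogauss_gauss//; field.
    rewrite /sintr -RintegralZl//.
      by apply: eq_Rintegral => y _; rewrite dsinSS /ogauss; ring.
    by apply: rapid_integrable; apply: rapidM => //; exact: slow_dsin.
  rewrite E in d1.
  have d2 := is_derive_sqr (pi * a^-1) x.
  have d3 := @is_derive1_comp _ expR _ x _ _ (is_derive_expR _) d2.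
  have d4 := is_deriveM d1 d3.
  by apply: is_derive_eq; rewrite /GRing.scale /=; ring.
(* [F] is constant, with value at [0] the mass of the Gaussian. *)
have := is_derive_0_is_cst xi 0 dF.
rewrite /F expr0n mulr0 expR0 mulr1.
have -> : sintr (gauss a) 1 0 = (Num.sqrt a)^-1.
  rewrite -Rintegral_gauss//; apply: eq_Rintegral => y _.
  by rewrite mulr0 mul0r /= cos0 mulr1.
move=> <-; rewrite -[RHS]mulrA /gauss -expRD mulNr subrr expR0 mulr1//.
Qed.

Lemma sintr_ogauss a xi : 0 < a ->
  sintr (ogauss a) 0 xi = (a * Num.sqrt a)^-1 * (xi * gauss a^-1 xi).
Proof.
move=> a0; have an0 : a != 0 by rewrite gt_eqF.
apply: (mulfI an0); rewrite sintr_ogauss_gauss// sintr_gauss//.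
by field; rewrite an0 sqrtr_eq0 -ltNge a0.
Qed.

Lemma Rintegral_gauss_moment a (n : nat) : 0 < a ->
  2 * pi * a * \int[mu]_(y in setT) (y ^+ n.+2 * gauss a y) =
  n.+1%:R * \int[mu]_(y in setT) (y ^+ n * gauss a y).
Proof.
move=> a0.
have rm m : rapid (fun y => y ^+ m * gauss a y).
  by apply: rapidMl; [exact: slow_exp|exact: rapid_gauss].
rewrite -!RintegralZl//; [|exact: rapid_integrable..].
apply/esym/eqP; rewrite -subr_eq0 -RintegralB//; [|by apply: rapid_integrable; exact: rapidZ..].
apply/eqP; apply: (@rapid_Rintegral_derivative _ (fun y => y ^+ n.+1 * gauss a y)) => //.
- move=> x.
  have d1 := is_derive_exp n x.
  have d2 := is_deriveM d1 (is_derive_gauss a x).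
  apply: is_derive_eq; rewrite /GRing.scale /= -mulr_natl exprS /= (exprS x n.+1) (exprS x n); ring.
- by apply: rapidB; exact: rapidZ.
Qed.

(** The integrand is the derivative of a multiple of [gauss a (y - c)]. *)
Lemma Rintegral_gauss_center a c : 0 < a ->
  \int[mu]_(y in setT) ((y - c) * gauss a (y - c)) = 0.
Proof.
move=> a0; have pi0 : 0 < pi :> R := pi_gt0 R.
have w0 : - (2 * pi * a) != 0 by rewrite oppr_eq0 !mulf_neq0 ?gt_eqF.
have dG x : is_derive x 1 (fun y => gauss a (y - c)) (- (2 * pi * a) * ((x - c) * gauss a (x - c))).
  have d1 : is_derive x 1 (fun y => y - c) 1.
    by apply: is_derive_eq; rewrite subr0.
  have := @is_derive1_comp _ (gauss a) _ x _ _ (is_derive_gauss a (x - c)) d1.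
  by rewrite mulr1.
have [cG rG] := rapid_gauss a0.
have shift f : rapid f -> rapid (fun y => f (y - c)).
  move=> [cf rf]; split.
    move=> x; apply: (@continuous_comp _ _ _ (fun y => y - c) f); last exact: cf.
    by apply: cvgB; [exact: cvg_id|exact: cvg_cst].
  move=> A; have [C fC] := rf A; exists (weight c ^+ A * C) => y.
  have h : weight y <= weight c * weight (y - c).
    have : `|y| <= `|y - c| + `|c| by rewrite -[y in leLHS](subrK c) ler_normD.
    have : 0 <= `|c| * `|y - c| by rewrite mulr_ge0.
    by rewrite /weight; lra.
  have w_ge0 z : 0 <= weight z := ltW (weight_gt0 z).
  apply: (@le_trans _ _ (weight c ^+ A * (weight (y - c) ^+ A * `|f (y - c)|))).
    rewrite mulrA ler_wpM2r// -exprMn lerXn2r// nnegrE ?mulr_ge0 ?w_ge0//.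
  by rewrite ler_wpM2l// exprn_ge0// w_ge0.
have r1 := shift _ (rapid_gauss a0); have r2 := shift _ (rapid_ogauss a0).
have := rapid_Rintegral_derivative dG r1 (rapidZ (- (2 * pi * a)) r2).
rewrite RintegralZl//; last exact: rapid_integrable.
by move/eqP; rewrite mulf_eq0 (negPf w0) => /eqP.
Qed.

End Gauss.

(** * Radial Fourier transforms in odd dimension *)

Section Bessel.
Context {R : realType}.
Implicit Types (f g h phi : R -> R) (a c t x y xi C : R).
Notation mu := (@lebesgue_measure R).

(** The [j]-th derivative of the sine transform of [phi]. *)
Definition dsintr phi (j : nat) : R -> R :=
  sintr (fun y => phi y * (2 * pi * y) ^+ j) j.

Lemma slow_2piX j : slow (fun y : R => (2 * pi * y) ^+ j).
Proof. by apply: slowX; apply: slowM; [exact: slow_cst|exact: slow_id]. Qed.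

Lemma slow_2piX_dsin j (xi : R) :
  slow (fun y : R => (2 * pi * y) ^+ j * dsin j (2 * pi * xi * y)).
Proof. by apply: slowM; [exact: slow_2piX|exact: slow_dsin]. Qed.

Lemma dsintrE phi j xi : dsintr phi j xi =
  \int[mu]_(y in setT) (phi y * ((2 * pi * y) ^+ j * dsin j (2 * pi * xi * y))).
Proof. by apply: eq_Rintegral => y _; rewrite mulrA. Qed.

Lemma is_derive_dsintr phi j (xi : R) : rapid phi ->
  is_derive xi (1 : R) (dsintr phi j) (dsintr phi j.+1 xi).
Proof.
move=> rphi.
have := @is_derive_sintr _ (fun y => phi y * (2 * pi * y) ^+ j) j xi
  (rapidM rphi (slow_2piX j)).
by rewrite /dsintr; under [in X in is_derive _ _ _ X]eq_fun do rewrite -mulrA -exprSr.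
Qed.

Lemma dsintr_lin f g c j xi : rapid f -> rapid g ->
  dsintr (fun y => f y + c * g y) j xi = dsintr f j xi + c * dsintr g j xi.
Proof.
move=> rf rg; rewrite !dsintrE.
have rf' := rapid_integrable (rapidM rf (slow_2piX_dsin j xi)).
have rg' := rapidM rg (slow_2piX_dsin j xi).
rewrite -RintegralZl//; last exact: rapid_integrable.
rewrite -RintegralD//; last exact: rapid_integrable (rapidZ c rg').
by apply: eq_Rintegral => y _; rewrite mulrDl -[c * g y * _]mulrA.
Qed.

(** No derivative of [phi] is involved, only its size: derivatives of the
    transform cost powers of the weight. *)
Lemma normr_dsintr_le phi j C xi : rapid phi ->
  (forall y, weight y ^+ (j + 2) * `|phi y| <= C) ->
  `|dsintr phi j xi| <= C * (2 * pi) ^+ j * lorentz_mass.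
Proof.
move=> rphi hC; rewrite dsintrE.
apply: (Rintegral_weight_le (A := j)) => //; first exact: slow_2piX_dsin.
move=> y; rewrite normrM -[leRHS]mulr1 ler_pM ?normr_dsin//.
have pi0 : 0 <= pi :> R := pi_ge0 R.
rewrite exprMn normrM normrX (ger0_norm (mulr_ge0 _ pi0))//.
rewrite ler_wpM2l ?exprn_ge0 ?mulr_ge0// normrX lerXn2r ?nnegrE//.
  exact: ltW (weight_gt0 _).
by rewrite /weight lerDr.
Qed.

(** The coefficients produced by applying [i] times the operator
    [- xi^-1 * d / d xi] to [S xi / xi]: a term [xi ^ - (2 i + 1 - j) * S^(j) xi]
    contributes to the index [j] through the power and to [j + 1] through
    [S]. *)
Fixpoint bcoef (i j : nat) : R :=
  if i is i'.+1 then
    ((2 * i' + 1)%:R - j%:R) * bcoef i' j - (if j is j'.+1 then bcoef i' j' else 0)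
  else (j == 0)%:R.

Lemma bcoefS i j : bcoef i.+1 j =
  ((2 * i + 1)%:R - j%:R) * bcoef i j - (if j is j'.+1 then bcoef i j' else 0).
Proof. by []. Qed.

Lemma bcoef_gt i j : (i < j)%N -> bcoef i j = 0.
Proof.
elim: i j => [|i IH] [|j]//= ij.
by rewrite !IH// ?mulr0 ?subr0// ltnW.
Qed.

Lemma dfact_double n : dfact n.*2 = (2 ^ n * n`!)%N.
Proof.
elim: n => //= n ->; rewrite expnS factS; lia.
Qed.

(** The closed form satisfies the same recursion; since [2 i - 2 j] is even, its
    double factorial is [2 ^ (i - j) * (i - j)`!]. *)
Lemma bcoefE i j : (j <= i)%N ->
  bcoef i j = (-1) ^+ j * ((2 * i - j)`!)%:R / ((j`!)%:R * (dfact (2 * i - 2 * j))%:R).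
Proof.
have dE n m : (dfact (2 * n - 2 * m))%:R = 2 ^+ (n - m) * ((n - m)`!)%:R :> R.
  by rewrite -mulnBr mul2n dfact_double natrM natrX.
have f0 n : n`!%:R != 0 :> R by rewrite pnatr_eq0 -lt0n fact_gt0.
have p0 n : 2 ^+ n != 0 :> R by rewrite expf_neq0// pnatr_eq0.
elim: i j => [|i IH] [|j] //.
- by move=> _; rewrite !muln0 subn0 /= fact0 !mulr1 divr1.
- move=> _; rewrite bcoefS !subr0 IH// !dE !subn0 fact0 expr0.
  have -> : (2 * i.+1 = (2 * i).+2)%N by lia.
  rewrite !factS !natrM.
  have -> : ((2 * i).+2)%:R = 2 * i%:R + 2 :> R by rewrite -addn2 natrD natrM.
  have -> : ((2 * i).+1)%:R = 2 * i%:R + 1 :> R by rewrite -addn1 natrD natrM.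
  have -> : (2 * i + 1)%:R = 2 * i%:R + 1 :> R by rewrite natrD natrM.
  have e : i.+1%:R = i%:R + 1 :> R by rewrite -natr1.
  have i1 : i%:R + 1 != 0 :> R by rewrite -e pnatr_eq0.
  rewrite e exprS; field.
  by rewrite i1 f0 p0.
- rewrite ltnS leq_eqVlt bcoefS => /predU1P[->|ji].
    rewrite bcoef_gt// mulr0 sub0r IH// !dE !subnn fact0 expr0 !mulr1.
    have -> : (2 * i - i = i)%N by lia.
    have -> : (2 * i.+1 - i.+1 = i.+1)%N by lia.
    by rewrite !mulfK// exprS mulN1r.
  rewrite !IH// ?dE; last exact: ltnW.
  have [m im] : exists m, i = (j + m.+1)%N by exists (i - j.+1)%N; lia.
  have -> : (2 * i - j.+1 = j + (2 * m).+1)%N by lia.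
  have -> : (2 * i - j = (j + (2 * m).+1).+1)%N by lia.
  have -> : (2 * i.+1 - j.+1 = (j + (2 * m).+1).+2)%N by lia.
  have -> : (i - j.+1 = m)%N by lia.
  have -> : (i.+1 - j.+1 = m.+1)%N by lia.
  have -> : (i - j = m.+1)%N by lia.
  rewrite im !factS !natrM !exprS.
  set F := ((j + (2 * m).+1)`!)%:R.
  have -> : j.+1%:R = j%:R + 1 :> R by rewrite -natr1.
  have -> : m.+1%:R = m%:R + 1 :> R by rewrite -natr1.
  have -> : ((j + (2 * m).+1).+1)%:R = j%:R + 2 * m%:R + 2 :> R.
    by rewrite -(natr1 (_ + _)) natrD -natr1 natrM; ring.
  have -> : ((j + (2 * m).+1).+2)%:R = j%:R + 2 * m%:R + 3 :> R.
    by rewrite -(natr1 (_.+1)) -(natr1 (_ + _)) natrD -natr1 natrM; ring.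
  have -> : (2 * (j + m.+1) + 1)%:R = 2 * j%:R + 2 * m%:R + 3 :> R.
    by rewrite natrD natrM natrD -natr1; ring.
  have j1 : j%:R + 1 != 0 :> R by rewrite natr1 pnatr_eq0.
  have m1 : m%:R + 1 != 0 :> R by rewrite natr1 pnatr_eq0.
  by field; rewrite j1 m1 !f0 p0.
Qed.

(** The Fourier transform on [R ^ (2 i + 3)] of [v |-> phi |v| / |v|], on the
    sphere of radius [xi]. *)
Definition radial (i : nat) phi (xi : R) : R :=
  (2 * pi) ^- i * \sum_(j < i.+1) bcoef i j * (xi^-1) ^+ (2 * i + 1 - j) * dsintr phi j xi.

Lemma radial_lin i f g c xi : rapid f -> rapid g ->
  radial i (fun y => f y + c * g y) xi = radial i f xi + c * radial i g xi.
Proof.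
move=> rf rg; rewrite /radial [X in _ = _ + X]mulrCA -mulrDr; congr (_ * _).
rewrite mulr_sumr -big_split /=.
by apply: eq_bigr => j _; rewrite dsintr_lin// mulrDr mulrCA.
Qed.

(** Away from the origin the powers of [xi^-1] are bounded, so a weighted norm
    of [phi] controls its radial transform. *)
Lemma normr_radial_le i : exists2 D, 0 <= D & forall phi C xi, rapid phi ->
  (forall y, weight y ^+ (i + 2) * `|phi y| <= C) -> 1 <= xi -> `|radial i phi xi| <= D * C.
Proof.
have pi0 : 0 < pi :> R := pi_gt0 R.
have p0 : 0 <= (2 * pi : R) by rewrite mulr_ge0// ltW.
exists ((2 * pi) ^- i * \sum_(j < i.+1) `|bcoef i j| * ((2 * pi) ^+ j * lorentz_mass)).
  rewrite mulr_ge0 ?invr_ge0 ?exprn_ge0// sumr_ge0// => j _.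
  by rewrite !mulr_ge0 ?exprn_ge0// lorentz_mass_ge0.
move=> phi C xi rphi hC xi1.
rewrite /radial normrM ger0_norm ?invr_ge0 ?exprn_ge0// -mulrA.
rewrite ler_wpM2l ?invr_ge0 ?exprn_ge0// mulr_suml.
apply: (le_trans (ler_norm_sum _ _ _)); apply: ler_sum => j _.
rewrite !normrM -!mulrA ler_wpM2l//.
have h1 : `|xi^-1 ^+ (2 * i + 1 - j)| <= 1.
  have xi0 : 0 < xi by rewrite (lt_le_trans ltr01).
  by rewrite ger0_norm ?exprn_ge0 ?invr_ge0 ?(ltW xi0)// exprn_ile1 ?invr_ge0 ?(ltW xi0)// invf_le1.
have h2 : `|dsintr phi j xi| <= C * (2 * pi) ^+ j * lorentz_mass.
  apply: normr_dsintr_le => // y; apply: le_trans (hC y).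
  by rewrite ler_wpM2r// weight_expr_le// leq_add2r -ltnS.
apply: (@le_trans _ _ (1 * (C * (2 * pi) ^+ j * lorentz_mass))).
  by rewrite ler_pM.
by rewrite mul1r le_eqVlt; apply/orP; left; apply/eqP; ring.
Qed.

Lemma is_derive_expV n (x : R) : x != 0 ->
  is_derive x (1 : R) (fun y : R => y^-1 ^+ n) (- n%:R * x^-1 ^+ n.+1).
Proof.
move=> x0.
have dV : is_derive x (1 : R) (fun y : R => y^-1) (- x^-1 ^+ 2).
  have H := @is_deriveV _ (@id R) x 1 1 x0 (is_derive_id _ _).
  by apply: is_derive_eq; rewrite /GRing.scale /= mulr1 exprVn.
elim: n => [|n IH].
  under eq_fun do rewrite expr0.
  by have H := is_derive_cst (1 : R) x (1 : R); apply: is_derive_eq; rewrite oppr0 mul0r.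
under eq_fun do rewrite exprS.
have H := is_deriveM dV IH.
by apply: is_derive_eq; rewrite /GRing.scale /= -(natr1 n) !exprS; ring.
Qed.

(** The classical relation [F_(d + 2) = - (2 pi xi)^-1 * F_d'] between radial
    Fourier transforms in dimensions [d] and [d + 2]; it holds by the recursion
    defining [bcoef], term by term. *)
Lemma is_derive_radial i phi (xi : R) : rapid phi -> 0 < xi ->
  is_derive xi (1 : R) (radial i phi) (- (2 * pi * xi) * radial i.+1 phi xi).
Proof.
move=> rphi xi0; have xin0 : xi != 0 by rewrite gt_eqF.
have pi0 : 2 * pi != 0 :> R by rewrite mulf_neq0// gt_eqF// pi_gt0.
pose q := xi^-1.
pose h (j : 'I_i.+1) x := bcoef i j * (x^-1) ^+ (2 * i + 1 - j) * dsintr phi j x.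
pose dh (j : 'I_i.+1) := bcoef i j * ((- (2 * i + 1 - j)%:R * q ^+ (2 * i + 1 - j).+1) * dsintr phi j xi
   + q ^+ (2 * i + 1 - j) * dsintr phi j.+1 xi).
have dhj j : is_derive xi (1 : R) (h j) (dh j).
  have H1 := is_derive_expV (2 * i + 1 - j) xin0.
  have H2 := is_derive_dsintr j xi rphi.
  have H3 := is_deriveZ (bcoef i j) (is_deriveM H1 H2).
  rewrite /h; under eq_fun do rewrite -mulrA.
  by apply: is_derive_eq; rewrite /dh /GRing.scale /= /q; ring.
have dsum := @is_derive_sum _ _ _ i.+1 h xi 1 dh dhj.
have dsum2 := is_deriveZ ((2 * pi) ^- i) dsum.
have -> : radial i phi = (2 * pi) ^- i \*: \sum_(j < i.+1) h j.
  by apply/funext => x; rewrite /radial /= fct_sumE.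
apply: is_derive_eq; rewrite /GRing.scale /=.
rewrite /radial exprS invfM.
have -> : - (2 * pi * xi) * ((2 * pi)^-1 * (2 * pi) ^- i *
    \sum_(j < i.+2) bcoef i.+1 j * xi^-1 ^+ (2 * i.+1 + 1 - j) * dsintr phi j xi)
   = (2 * pi) ^- i * (- xi * \sum_(j < i.+2) bcoef i.+1 j * xi^-1 ^+ (2 * i.+1 + 1 - j) * dsintr phi j xi).
  by move: (2 * pi : R) pi0 => P P0; field; rewrite P0 expf_neq0.
congr (_ * _).
have -> : - xi * \sum_(j < i.+2) bcoef i.+1 j * xi^-1 ^+ (2 * i.+1 + 1 - j) * dsintr phi j xi
 = - (\sum_(j < i.+2) bcoef i.+1 j * q ^+ (2 * i + 2 - j) * dsintr phi j xi).
  rewrite mulr_sumr -sumrN; apply: eq_bigr => j _.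
  have -> : (2 * i.+1 + 1 - j = (2 * i + 2 - j).+1)%N by have := ltn_ord j; lia.
  by rewrite exprS /q; field.
under eq_bigr => j _ do rewrite /dh mulrDr.
rewrite big_split /=.
(* The two terms of the recursion for [bcoef]. *)
have split2 : \sum_(j < i.+2) bcoef i.+1 j * q ^+ (2 * i + 2 - j) * dsintr phi j xi =
  \sum_(j < i.+2) ((2 * i + 1)%:R - j%:R) * bcoef i j * q ^+ (2 * i + 2 - j) * dsintr phi j xi
  - \sum_(j < i.+2) (if nat_of_ord j is j'.+1 then bcoef i j' else 0) * q ^+ (2 * i + 2 - j) * dsintr phi j xi.
  by rewrite -sumrB; apply: eq_bigr => j _ /=; rewrite -!mulrBl.
rewrite split2 opprB addrC; congr (_ + _); last first.
  rewrite -sumrN [in RHS]big_ord_recr /= bcoef_gt// mulr0 !mul0r oppr0 addr0.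
  apply: eq_bigr => j _.
  have ji := ltn_ord j.
  have -> : (2 * i + 2 - j = (2 * i + 1 - j).+1)%N by lia.
  rewrite natrB; last by lia.
  by ring.
rewrite [in RHS]big_ord_recl /= mul0r mul0r add0r; apply: eq_bigr => j _ /=.
have -> : (2 * i + 2 - bump 0 j = 2 * i + 1 - j)%N by rewrite /bump /=; lia.
by rewrite /bump /= add1n mulrA.
Qed.

(** Induction on the dimension by [is_derive_radial]: each step multiplies the
    Gaussian [gauss t^-1] by [t^-1]. *)
Lemma radial_ogauss i t (xi : R) : 0 < t -> 0 < xi ->
  radial i (ogauss t) xi = (t * Num.sqrt t * t ^+ i)^-1 * gauss t^-1 xi.
Proof.
move=> t0; have tn0 : t != 0 by rewrite gt_eqF.
have st0 : Num.sqrt t != 0 by rewrite sqrtr_eq0 -ltNge.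
have pi0 : 2 * pi != 0 :> R by rewrite mulf_neq0// gt_eqF// pi_gt0.
elim: i xi => [|i IH] xi xi0; have xin0 : xi != 0 by rewrite gt_eqF.
  rewrite /radial big_ord1 /= !expr0 !mulr1 invr1 !mul1r muln0 add0n subn0 expr1.
  have -> : dsintr (ogauss t) 0 xi = sintr (ogauss t) 0 xi.
    by apply: eq_Rintegral => y _; rewrite expr0 mulr1.
  by rewrite sintr_ogauss//; field; rewrite tn0 st0.
have d1 := is_derive_radial i (rapid_ogauss t0) xi0.
have d2 := is_deriveZ ((t * Num.sqrt t * t ^+ i)^-1) (is_derive_gauss t^-1 xi).
have nearE : {near xi, radial i (ogauss t) =1 (t * Num.sqrt t * t ^+ i)^-1 \*: gauss t^-1}.
  near=> x; rewrite IH//; near: x.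
  exact: lt_nbhsr.
have d3 := near_eq_is_derive nearE d1.
have := @derive_val _ _ _ _ _ _ _ d3.
rewrite (@derive_val _ _ _ _ _ _ _ d2) /GRing.scale /= => E.
have w0 : - (2 * pi * xi) != 0 by rewrite oppr_eq0 mulf_neq0.
apply: (mulfI w0); rewrite -E exprS; field.
by rewrite tn0 st0 expf_neq0.
Unshelve. all: by end_near.
Qed.

(** The value of [radial i phi] at the origin, where the singular terms cancel
    and the first surviving Taylor coefficient of the sine transform is that
    of order [2 i + 1]. *)
Definition radial0 (i : nat) phi : R :=
  (-1) ^+ i / (dfact (2 * i + 1))%:R * (2 * pi) ^- i * dsintr phi (2 * i + 1) 0.

Lemma radial0_lin i f g c : rapid f -> rapid g ->
  radial0 i (fun y => f y + c * g y) = radial0 i f + c * radial0 i g.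
Proof. by move=> rf rg; rewrite /radial0 dsintr_lin// mulrDr mulrCA. Qed.

Lemma normr_radial0_le i : exists2 D, 0 <= D & forall phi C, rapid phi ->
  (forall y, weight y ^+ (2 * i + 3) * `|phi y| <= C) -> `|radial0 i phi| <= D * C.
Proof.
have p0 : 0 <= (2 * pi : R) by rewrite mulr_ge0// pi_ge0.
exists (`|(-1) ^+ i / (dfact (2 * i + 1))%:R * (2 * pi) ^- i| *
        ((2 * pi) ^+ (2 * i + 1) * lorentz_mass)).
  by rewrite !mulr_ge0 ?exprn_ge0// lorentz_mass_ge0.
move=> phi C rphi hC; rewrite /radial0 normrM -[leRHS]mulrA ler_wpM2l//.
have := @normr_dsintr_le phi (2 * i + 1) C 0 rphi.
have -> : (2 * i + 1 + 2 = 2 * i + 3)%N by lia.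
by move=> /(_ hC); rewrite -mulrA mulrC.
Qed.

Lemma dsin_odd0 i : dsin (2 * i + 1) 0 = (-1) ^+ i :> R.
Proof.
elim: i => [|i IH]; first by rewrite /= cos0 expr0.
have -> : (2 * i.+1 + 1 = (2 * i + 1).+2)%N by lia.
by rewrite dsinSS IH exprS mulN1r.
Qed.

Lemma dfact_gt0 n : (0 < dfact n)%N.
Proof.
suff: (0 < dfact n)%N /\ (0 < dfact n.+1)%N by case.
elim: n => [//|n [IH1 IH2]]; split => //.
by rewrite -[dfact n.+2]/(n.+2 * dfact n)%N muln_gt0.
Qed.

Lemma Rintegral_gauss_even_moment i t : 0 < t ->
  \int[mu]_(y in setT) (y ^+ (2 * i + 2) * gauss t y) =
  (dfact (2 * i + 1))%:R / ((2 * pi * t) ^+ i.+1 * Num.sqrt t).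
Proof.
move=> t0; have tn0 : t != 0 by rewrite gt_eqF.
have st0 : Num.sqrt t != 0 by rewrite sqrtr_eq0 -ltNge.
have w0 : 2 * pi * t != 0 :> R by rewrite !mulf_neq0// gt_eqF// pi_gt0.
elim: i => [|i IH].
  apply: (mulfI w0); rewrite Rintegral_gauss_moment//.
  under eq_Rintegral do rewrite expr0 mul1r.
  rewrite Rintegral_gauss//= expr1.
  by move: (2 * pi * t) w0 => W W0; field; rewrite st0 W0.
apply: (mulfI w0).
have -> : (2 * i.+1 + 2 = (2 * i + 2).+2)%N by lia.
rewrite Rintegral_gauss_moment// IH.
have -> : (2 * i.+1 + 1 = (2 * i + 1).+2)%N by lia.
rewrite [dfact _.+2]/= natrM.
have -> : ((2 * i + 1).+2 = (2 * i + 2).+1)%N by lia.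
rewrite (exprS _ i.+1).
set W := 2 * pi * t; field.
by rewrite st0 w0 expf_neq0.
Qed.

Lemma radial0_ogauss i t : 0 < t ->
  radial0 i (ogauss t) = (t * Num.sqrt t * t ^+ i)^-1.
Proof.
move=> t0; have tn0 : t != 0 by rewrite gt_eqF.
have st0 : Num.sqrt t != 0 by rewrite sqrtr_eq0 -ltNge.
have pi0 : pi != 0 :> R by rewrite gt_eqF// pi_gt0.
have d0 : (dfact (2 * i + 1))%:R != 0 :> R by rewrite pnatr_eq0 -lt0n dfact_gt0.
have s1 : (-1) ^+ i * (-1) ^+ i = 1 :> R by rewrite -expr2 sqrr_sign.
rewrite /radial0 dsintrE.
have -> : \int[mu]_y (ogauss t y * ((2 * pi * y) ^+ (2 * i + 1) * dsin (2 * i + 1) (2 * pi * 0 * y)))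
  = (-1) ^+ i * (2 * pi) ^+ (2 * i + 1) * \int[mu]_(y in setT) (y ^+ (2 * i + 2) * gauss t y).
  rewrite -RintegralZl//.
    apply: eq_Rintegral => y _; rewrite mulr0 mul0r dsin_odd0 /ogauss exprMn.
    by rewrite (_ : (2 * i + 2 = (2 * i + 1).+1)%N) ?exprS; [ring|lia].
  by apply: rapid_integrable; apply: rapidMl; [exact: slow_exp|exact: rapid_gauss].
rewrite Rintegral_gauss_even_moment// !exprMn.
have -> : (2 * i + 1 = i + i.+1)%N by lia.
rewrite !exprD !exprS.
transitivity (((-1) ^+ i * (-1) ^+ i) * (t * Num.sqrt t * t ^+ i)^-1); last by rewrite s1 mul1r.
rewrite (_ : (i + i.+1 = 2 * i + 1)%N) in d0 *; last lia.
by move: (pi : R) pi0 => p p0; field; rewrite d0 p0 tn0 st0 !expf_neq0.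
Qed.

End Bessel.

(** * Mollification by a Gaussian *)

Section Mollify.
Context {R : realType}.
Implicit Types (f g h phi : R -> R) (a c t s x y xi C : R).
Notation mu := (@lebesgue_measure R).

Lemma weight_ge0 y : 0 <= weight y. Proof. exact: ltW (weight_gt0 y). Qed.

(** Submultiplicativity of the weight, which lets weighted norms pass through a
    convolution at scale [s <= 1]. *)
Lemma weight_sub s x y : 0 <= s <= 1 -> weight x <= weight (x - s * y) * weight y.
Proof.
move=> /andP[s0 s1]; rewrite /weight.
have h1 : `|x| <= `|x - s * y| + `|s * y| by rewrite -[x in leLHS](subrK (s * y)) ler_normD.
have h2 : `|s * y| <= `|y| by rewrite normrM ger0_norm// ler_piMl.
have h3 : 0 <= `|x - s * y| * `|y| by rewrite mulr_ge0.
lra.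
Qed.

Definition gauss_moment (A : nat) : R := \int[mu]_(z in setT) (weight z ^+ A * gauss 1 z).

Lemma slow_weight A : slow (fun y : R => weight y ^+ A).
Proof.
apply: slowX; split; first exact: weight_continuous.
by exists 1%N, 1 => y; rewrite mul1r expr1 ger0_norm// weight_ge0.
Qed.

Lemma rapid_weight_gauss A : rapid (fun z : R => weight z ^+ A * gauss 1 z).
Proof. by apply: rapidMl; [exact: slow_weight|exact: rapid_gauss]. Qed.

Lemma gauss_moment_ge0 A : 0 <= gauss_moment A.
Proof.
by apply: Rintegral_ge0 => z _; rewrite mulr_ge0 ?exprn_ge0 ?weight_ge0 ?gauss_ge0.
Qed.

(** A moment of the Gaussian absorbs the polynomial growth of [g]. *)
Lemma Rintegral_gauss_le (A : nat) g C : slow g -> (forall z, `|g z| <= C * weight z ^+ A) ->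
  `|\int[mu]_(z in setT) (g z * gauss 1 z)| <= C * gauss_moment A.
Proof.
move=> sg gC.
have r1 : rapid (fun z => g z * gauss 1 z) by apply: rapidMl => //; exact: rapid_gauss.
have r2 := rapid_weight_gauss A.
apply: (le_trans (le_normr_Rintegral measurableT (rapid_integrable r1))).
rewrite /gauss_moment -RintegralZl//; last exact: rapid_integrable.
apply: le_Rintegral => //.
- exact: (integrable_norm (rapid_integrable r1)).
- exact: rapid_integrable (rapidZ C r2).
- move=> z _; rewrite normrM (ger0_norm (gauss_ge0 _ _)) mulrA.
  by rewrite ler_wpM2r ?gauss_ge0.
Qed.

Lemma slow_comp_affine f s x : rapid f -> slow (fun z => f (x - s * z)).
Proof.
move=> [cf /(_ 0%N)[C fC]]; apply: (slow_bounded (C := C)).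
  move=> z; apply: (@continuous_comp _ _ _ (fun z => x - s * z) f); last exact: cf.
  by apply: cvgB; [exact: cvg_cst|apply: cvgM; [exact: cvg_cst|exact: cvg_id]].
by move=> z; have := fC (x - s * z); rewrite expr0 mul1r.
Qed.

Definition mollify s phi x : R := \int[mu]_(z in setT) (phi (x - s * z) * gauss 1 z).

Lemma mollify_lin s f g c x : rapid f -> rapid g ->
  mollify s (fun y => f y + c * g y) x = mollify s f x + c * mollify s g x.
Proof.
move=> rf rg; rewrite /mollify.
have h u : rapid u -> rapid (fun z => u (x - s * z) * gauss 1 z).
  by move=> ru; apply: rapidMl; [exact: slow_comp_affine|exact: rapid_gauss].
rewrite -RintegralZl//; last exact: rapid_integrable (h _ rg).
rewrite -RintegralD//.
- by apply: eq_Rintegral => y _; rewrite mulrDl mulrA.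
- exact: rapid_integrable (h _ rf).
- exact: rapid_integrable (rapidZ c (h _ rg)).
Qed.

Lemma mollify_le (A : nat) s phi C x : 0 <= s <= 1 -> rapid phi ->
  (forall y, weight y ^+ A * `|phi y| <= C) ->
  weight x ^+ A * `|mollify s phi x| <= C * gauss_moment A.
Proof.
move=> s01 rphi hC.
have w0 : 0 < weight x ^+ A by rewrite exprn_gt0// weight_gt0.
rewrite mulrC -ler_pdivlMr// mulrAC.
apply: Rintegral_gauss_le; first exact: slow_comp_affine.
move=> z; rewrite mulrAC ler_pdivlMr//.
apply: (@le_trans _ _ (`|phi (x - s * z)| * (weight (x - s * z) * weight z) ^+ A)).
  by rewrite ler_wpM2l// lerXn2r ?nnegrE ?mulr_ge0 ?weight_ge0// weight_sub.
by rewrite exprMn mulrA ler_wpM2r ?exprn_ge0 ?weight_ge0// mulrC.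
Qed.

Lemma mean_value_le f f' (u v : R) B : (forall x, is_derive x 1 f (f' x)) ->
  (forall x, `|x - u| <= `|v - u| -> `|f' x| <= B) -> `|f v - f u| <= B * `|v - u|.
Proof.
move=> df hB.
have cf : continuous f := is_derive_continuous df.
have [uv|vu|->] := ltgtP u v; last by rewrite !subrr normr0 mulr0.
- have [c cuv ->] := @MVT _ f f' u v uv (fun x _ => df x) (continuous_subspaceT cf).
  rewrite normrM ler_wpM2r//; apply: hB.
  by move: cuv; rewrite in_itv/= => /andP[uc cv]; rewrite !ger0_norm; lra.
- have [c cuv] := @MVT _ f f' v u vu (fun x _ => df x) (continuous_subspaceT cf).
  rewrite distrC => ->; rewrite normrM distrC ler_wpM2r//; apply: hB.
  by move: cuv; rewrite in_itv/= => /andP[uc cv]; rewrite !ler0_norm; lra.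
Qed.

Lemma Rintegral_gauss1 : \int[mu]_(z in setT) gauss (1 : R) z = 1.
Proof. by rewrite Rintegral_gauss// sqrtr1 invr1. Qed.

(** The mean value inequality on [[x - s z, x]], with the weight transported by
    submultiplicativity; the extra power in the moment is the factor [|z|] of the
    step. *)
Lemma mollify_rate (A : nat) s phi phi' C x : 0 <= s <= 1 -> rapid phi ->
  (forall x, is_derive x 1 phi (phi' x)) ->
  (forall y, weight y ^+ A * `|phi' y| <= C) ->
  weight x ^+ A * `|mollify s phi x - phi x| <= s * C * gauss_moment A.+1.
Proof.
move=> s01 rphi dphi hC.
have /andP[s0 s1] := s01.
have w0 : 0 < weight x ^+ A by rewrite exprn_gt0// weight_gt0.
have -> : mollify s phi x - phi x = \int[mu]_(z in setT) ((phi (x - s * z) - phi x) * gauss 1 z).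
  have {1}-> : phi x = \int[mu]_(z in setT) (phi x * gauss 1 z).
    by rewrite RintegralZl// ?Rintegral_gauss1 ?mulr1//; exact/rapid_integrable/rapid_gauss.
  rewrite /mollify -RintegralB//.
  - by apply: eq_Rintegral => z _; rewrite mulrBl.
  - by apply: rapid_integrable; apply: rapidMl; [exact: slow_comp_affine|exact: rapid_gauss].
  - by apply: rapid_integrable; apply: rapidZ; exact: rapid_gauss.
rewrite mulrC -ler_pdivlMr// mulrAC.
apply: Rintegral_gauss_le.
  by apply: slowB; [exact: slow_comp_affine|exact: slow_cst].
move=> z.
have -> : s * C / weight x ^+ A * weight z ^+ A.+1 =
   (C * weight z ^+ A / weight x ^+ A) * (s * weight z) by rewrite exprS; ring.
have B0 : 0 <= C * weight z ^+ A / weight x ^+ A.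
  rewrite divr_ge0 ?exprn_ge0 ?weight_ge0// mulr_ge0 ?exprn_ge0 ?weight_ge0//.
  by apply: le_trans (hC 0); rewrite mulr_ge0 ?exprn_ge0 ?weight_ge0.
apply: (@le_trans _ _ (C * weight z ^+ A / weight x ^+ A * `|(x - s * z) - x|)).
  apply: (mean_value_le dphi) => y yx.
  rewrite ler_pdivlMr//.
  have wy : weight x <= weight y * weight z.
    have h1 : `|x| <= `|y| + `|y - x| by rewrite -[x in leLHS](subKr y) ler_normB.
    have h2 : `|y - x| <= `|z|.
      apply: (le_trans yx); rewrite addrAC subrr add0r normrN normrM ger0_norm//.
      by rewrite ler_piMl.
    have h3 : 0 <= `|y| * `|z| by rewrite mulr_ge0.
    by rewrite /weight; lra.
  apply: (@le_trans _ _ (`|phi' y| * (weight y * weight z) ^+ A)).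
    by rewrite ler_wpM2l// lerXn2r ?nnegrE ?mulr_ge0 ?weight_ge0.
  by rewrite exprMn mulrA ler_wpM2r ?exprn_ge0 ?weight_ge0// mulrC.
rewrite ler_wpM2l// addrAC subrr add0r normrN normrM ger0_norm//.
by rewrite ler_wpM2l// /weight lerDr.
Qed.

(** The derivative of [mollify s phi] at the origin, hence the value there of
    [mollify s phi x / x] when [phi] is odd; the derivative has been moved onto
    the Gaussian. *)
Definition mollify0 s phi : R :=
  \int[mu]_(z in setT) (phi (s * z) / s * (2 * pi * z) * gauss 1 z).

Lemma slow_comp_scale f s : rapid f -> slow (fun z => f (s * z)).
Proof.
move=> rf; have := slow_comp_affine (- s) 0 rf.
by under eq_fun do rewrite add0r mulNr opprK.
Qed.

Lemma slow_mollify0 f s : rapid f -> slow (fun z => f (s * z) / s * (2 * pi * z)).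
Proof.
move=> rf; apply: slowM; last by apply: slowM; [exact: slow_cst|exact: slow_id].
by apply: slowM; [exact: slow_comp_scale|exact: slow_cst].
Qed.

Lemma mollify0_lin s f g c : rapid f -> rapid g ->
  mollify0 s (fun y => f y + c * g y) = mollify0 s f + c * mollify0 s g.
Proof.
move=> rf rg; rewrite /mollify0.
have h u : rapid u -> rapid (fun z => u (s * z) / s * (2 * pi * z) * gauss 1 z).
  by move=> ru; apply: rapidMl; [exact: slow_mollify0|exact: rapid_gauss].
rewrite -RintegralZl//; last exact: rapid_integrable (h _ rg).
rewrite -RintegralD//.
- by apply: eq_Rintegral => y _; rewrite !mulrDl !mulrA.
- exact: rapid_integrable (h _ rf).
- exact: rapid_integrable (rapidZ c (h _ rg)).
Qed.

Lemma mollify0_le s phi C : 0 < s -> rapid phi -> (forall y, `|phi y| <= C) ->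
  `|mollify0 s phi| <= C * (s^-1 * (2 * pi) * gauss_moment 1).
Proof.
move=> s0 rphi hC.
have p0 : 0 <= 2 * pi :> R by rewrite mulr_ge0// pi_ge0.
have -> : C * (s^-1 * (2 * pi) * gauss_moment 1) = (C / s * (2 * pi)) * gauss_moment 1 by ring.
apply: Rintegral_gauss_le; first exact: slow_mollify0.
move=> z; rewrite normrM normf_div (gtr0_norm s0) normrM (ger0_norm p0) expr1.
rewrite -[leRHS]mulrA ler_pM ?mulr_ge0 ?divr_ge0// ?(ltW s0)//.
- by rewrite invr_ge0 ltW.
- exact: pi_ge0.
- by rewrite ler_wpM2r// invr_ge0 ltW.
by rewrite ler_wpM2l// /weight lerDr.
Qed.

(** As [2 pi z ^ 2] has mean [1] for the Gaussian, the difference is the mean of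
    the Taylor remainder of order two of [phi] at [0]. *)
Lemma mollify0_rate s phi phi' phi'' C : 0 < s <= 1 -> rapid phi -> phi 0 = 0 ->
  (forall x, is_derive x 1 phi (phi' x)) -> (forall x, is_derive x 1 phi' (phi'' x)) ->
  (forall y, `|phi'' y| <= C) ->
  `|mollify0 s phi - phi' 0| <= s * (C * (2 * pi) * gauss_moment 3).
Proof.
move=> /andP[s0 s1] rphi phi0 d1 d2 hC.
have p0 : 0 <= 2 * pi :> R by rewrite mulr_ge0// pi_ge0.
have E : \int[mu]_(z in setT) (2 * pi * z * z * gauss 1 z) = 1.
  have r2 : rapid (fun z : R => z ^+ 2 * gauss 1 z).
    by apply: rapidMl; [exact: slow_exp|exact: rapid_gauss].
  under eq_Rintegral do rewrite -(mulrA (2 * pi)) -expr2 -mulrA.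
  rewrite RintegralZl//; last exact: rapid_integrable.
  have := @Rintegral_gauss_moment R 1 0 ltr01; rewrite mulr1 => ->.
  by under eq_Rintegral do rewrite expr0 mul1r; rewrite Rintegral_gauss1 mulr1.
have r3 : rapid (fun z : R => 2 * pi * z * z * gauss 1 z).
  apply: rapidMl; last exact: rapid_gauss.
  by apply: slowM; [apply: slowM; [exact: slow_cst|exact: slow_id]|exact: slow_id].
have r4 : rapid (fun z => phi (s * z) / s * (2 * pi * z) * gauss 1 z).
  by apply: rapidMl; [exact: slow_mollify0|exact: rapid_gauss].
have -> : mollify0 s phi - phi' 0 = \int[mu]_(z in setT)
    ((phi (s * z) / s * (2 * pi * z) - phi' 0 * (2 * pi * z * z)) * gauss 1 z).
  have {1}-> : phi' 0 = \int[mu]_(z in setT) (phi' 0 * (2 * pi * z * z * gauss 1 z)).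
    by rewrite RintegralZl// ?E ?mulr1//; exact: rapid_integrable.
  rewrite /mollify0 -RintegralB//.
  - by apply: eq_Rintegral => z _; move: (2 * pi : R) => P; ring.
  - exact: rapid_integrable.
  - exact: rapid_integrable (rapidZ (phi' 0) r3).
rewrite mulrA; apply: Rintegral_gauss_le.
  apply: slowB; first exact: slow_mollify0.
  apply: slowM; first exact: slow_cst.
  by apply: slowM; [apply: slowM; [exact: slow_cst|exact: slow_id]|exact: slow_id].
move=> z.
have C0 : 0 <= C by apply: le_trans (hC 0).
(* Taylor at order two, through the mean value inequality applied twice. *)
have quad u : `|phi u - phi' 0 * u| <= C * `|u| * `|u|.
  pose g u := phi u - phi' 0 * u.
  have dg x : is_derive x 1 g (phi' x - phi' 0).
    have h1 := @is_deriveZ _ _ _ (@id R) (phi' 0) x 1 1 (is_derive_id _ _).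
    have h2 := d1 x.
    by apply: is_derive_eq; rewrite /GRing.scale /= mulr1.
  have := @mean_value_le g _ 0 u (C * `|u|) dg.
  rewrite /g phi0 mulr0 !subr0; apply => x; rewrite subr0 => xu.
  apply: (@le_trans _ _ (C * `|x - 0|)); last by rewrite subr0 ler_wpM2l.
  by apply: (mean_value_le d2) => y _; exact: hC.
have -> : phi (s * z) / s * (2 * pi * z) - phi' 0 * (2 * pi * z * z) =
  (phi (s * z) - phi' 0 * (s * z)) * (2 * pi * z / s).
  by move: (2 * pi : R) => P; field; rewrite gt_eqF.
rewrite normrM; apply: (le_trans (ler_wpM2r _ (quad _))) => //.
rewrite normf_div (normrM s z) (normrM (2 * pi) z) (gtr0_norm s0) (ger0_norm p0).
have -> : C * (s * `|z|) * (s * `|z|) * (2 * pi * `|z| / s) = s * (C * (2 * pi)) * `|z| ^+ 3.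
  by move: (2 * pi : R) => P; field; rewrite gt_eqF.
rewrite ler_wpM2l ?mulr_ge0 ?pi_ge0 ?(ltW s0)// lerXn2r ?nnegrE ?weight_ge0//.
by rewrite /weight lerDr.
Qed.

(** Completing the square in [z]: the product of the two Gaussians is a Gaussian
    in [x] times one centred at [c = t s x / a] in [z]. *)
Lemma mollify_ogauss s t x : 0 < t ->
  mollify s (ogauss t) x =
  ((1 + t * s ^+ 2) * Num.sqrt (1 + t * s ^+ 2))^-1 * ogauss (t / (1 + t * s ^+ 2)) x.
Proof.
move=> t0; set a := 1 + t * s ^+ 2.
have a0 : 0 < a by rewrite ltr_wpDr// mulr_ge0 ?sqr_ge0// ltW.
have an0 : a != 0 by rewrite gt_eqF.
have san0 : Num.sqrt a != 0 by rewrite sqrtr_eq0 -ltNge.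
pose c := t * s * x / a.
have sh f : rapid f -> mu.-integrable setT (EFin \o (fun z => f (z - c))).
  move=> rf; apply: rapid_integrable.
  split.
    move=> z; apply: (@continuous_comp _ _ _ (fun z => z - c) f); last exact: rf.1.
    by apply: cvgB; [exact: cvg_id|exact: cvg_cst].
  move=> A; have [C fC] := rf.2 A; exists (C * weight c ^+ A) => z.
  have h : weight z <= weight (z - c) * weight c.
    by have := @weight_sub 1 z c; rewrite !mul1r ler01 lexx; apply.
  apply: (@le_trans _ _ ((weight (z - c) * weight c) ^+ A * `|f (z - c)|)).
    by rewrite ler_wpM2r// lerXn2r ?nnegrE ?mulr_ge0 ?weight_ge0.
  by rewrite exprMn mulrAC ler_wpM2r ?exprn_ge0 ?weight_ge0.
have E z : ogauss t (x - s * z) * gauss 1 z =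
   x / a * gauss (t / a) x * gauss a (z - c) - s * gauss (t / a) x * ogauss a (z - c).
  rewrite /ogauss.
  have -> : x / a * gauss (t / a) x * gauss a (z - c) - s * gauss (t / a) x * ((z - c) * gauss a (z - c))
     = (x - s * z) * (gauss (t / a) x * gauss a (z - c)).
    have -> : x - s * z = x / a - s * (z - c).
      by rewrite /c; rewrite /a in an0 *; field.
    by ring.
  rewrite -mulrA; congr (_ * _); rewrite /gauss -!expRD; congr expR.
  rewrite /c; move: (pi : R) => p; rewrite /a in an0 *; field.
  by [].
rewrite /mollify; under eq_Rintegral do rewrite E.
rewrite RintegralB//; last 2 first.
- exact: (integrableZl measurableT _ (sh _ (rapid_gauss a0))).
- exact: (integrableZl measurableT _ (sh _ (rapid_ogauss a0))).
rewrite RintegralZl; [|by []|exact: (sh _ (rapid_gauss a0))].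
rewrite RintegralZl; [|by []|exact: (sh _ (rapid_ogauss a0))].
rewrite Rintegral_gauss_shift// Rintegral_gauss_center// mulr0 subr0 /ogauss.
by field; rewrite an0 san0.
Qed.

Lemma mollify0_ogauss s t : 0 < s -> 0 < t ->
  mollify0 s (ogauss t) = ((1 + t * s ^+ 2) * Num.sqrt (1 + t * s ^+ 2))^-1.
Proof.
move=> s0 t0; set a := 1 + t * s ^+ 2.
have a0 : 0 < a by rewrite ltr_wpDr// mulr_ge0 ?sqr_ge0// ltW.
have an0 : a != 0 by rewrite gt_eqF.
have san0 : Num.sqrt a != 0 by rewrite sqrtr_eq0 -ltNge.
have E z : ogauss t (s * z) / s * (2 * pi * z) * gauss 1 z = 2 * pi * (z ^+ 2 * gauss a z).
  have -> : gauss a z = gauss t (s * z) * gauss 1 z.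
    by rewrite /gauss -expRD; congr expR; rewrite /a; ring.
  by rewrite /ogauss; move: (2 * pi : R) => P; field; rewrite gt_eqF.
rewrite /mollify0; under eq_Rintegral do rewrite E.
rewrite RintegralZl//; last first.
  by apply: rapid_integrable; apply: rapidMl; [exact: slow_exp|exact: rapid_gauss].
have := Rintegral_gauss_even_moment 0 a0; rewrite muln0 add0n expr1 => ->.
have p0 : 2 * pi != 0 :> R by rewrite mulf_neq0// gt_eqF// pi_gt0.
by rewrite /=; move: (2 * pi : R) p0 => P P0; field; rewrite P0 an0 san0.
Qed.

End Mollify.

(** * Density of the odd Gaussians *)

Section Weierstrass.
Context {R : realType}.
Implicit Types (f phi : R -> R) (g h : nat -> R) (a t s x y xi C : R).

(** The Bernstein polynomial of [g] of degree [n], through the one-step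
    recursion of the binomial walk: its value at [x] is the expectation of [g]
    after [n] steps, each going up with probability [x]. *)
Fixpoint bernstein (n : nat) (g : nat -> R) : {poly R} :=
  if n is n'.+1 then
    'X * bernstein n' (fun i => g i.+1) + (1 - 'X) * bernstein n' g
  else (g 0)%:P.

Lemma bernsteinS n g x : (bernstein n.+1 g).[x] =
  x * (bernstein n (fun i => g i.+1)).[x] + (1 - x) * (bernstein n g).[x].
Proof. by rewrite /= !hornerE. Qed.

Lemma bernstein_le n g h x : 0 <= x <= 1 ->
  (forall i, (i <= n)%N -> g i <= h i) -> (bernstein n g).[x] <= (bernstein n h).[x].
Proof.
move=> /andP[x0 x1]; elim: n g h => [|n IH] g h gh.
  by rewrite /= !hornerC; exact: gh.
rewrite !bernsteinS lerD// ler_wpM2l// ?subr_ge0//; apply: IH => i ni; apply: gh => //.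
exact: leqW.
Qed.

Lemma bernsteinB n g h x :
  (bernstein n (fun i => g i - h i)).[x] = (bernstein n g).[x] - (bernstein n h).[x].
Proof.
elim: n g h => [|n IH] g h; first by rewrite /= !hornerC.
by rewrite !bernsteinS !IH; ring.
Qed.

Lemma bernstein_cst n c x : (bernstein n (fun=> c)).[x] = c.
Proof.
elim: n => [|n IH]; first by rewrite /= hornerC.
by rewrite bernsteinS IH; ring.
Qed.

(** The second moment of the binomial walk about [c]. *)
Lemma bernstein_affine_sqr n u v c x :
  (bernstein n (fun i => u + v * (i%:R - c) ^+ 2)).[x] =
  u + v * ((n%:R * x - c) ^+ 2 + n%:R * x * (1 - x)).
Proof.
elim: n c => [|n IH] c; first by rewrite /= hornerC; ring.
rewrite bernsteinS IH.
have -> : (fun i => u + v * (i.+1%:R - c) ^+ 2) = (fun i => u + v * (i%:R - (c - 1)) ^+ 2).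
  by apply/funext => i; rewrite -natr1; ring.
by rewrite IH -natr1; ring.
Qed.

(** A modulus of continuity in the form that Bernstein polynomials use, since
    the variance is what they control.  If it failed for every [K], a
    subsequence of counterexamples would converge to a point of
    discontinuity. *)
Lemma unif_continuous_quad f (e : R) : continuous f -> 0 < e ->
  exists2 K, 0 <= K & forall x y, 0 <= x <= 1 -> 0 <= y <= 1 ->
    `|f x - f y| <= e + K * (x - y) ^+ 2.
Proof.
move=> cf e0.
have cW : {within `[(0 : R), 1], continuous f} by exact: continuous_subspaceT.
have [xM xM01 fM] := EVT_max ler01 cW.
have [xm xm01 fm] := EVT_min ler01 cW.
have osc x y : 0 <= x <= 1 -> 0 <= y <= 1 -> `|f x - f y| <= f xM - f xm.
  move=> hx hy; rewrite ler_norml.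
  have := fM x; have := fm x; have := fM y; have := fm y.
  rewrite !in_itv /= => /(_ hy) h1 /(_ hy) h2 /(_ hx) h3 /(_ hx) h4.
  by apply/andP; split; lra.
apply: contrapT => nK.
have : forall n : nat, exists xy : R * R, [/\ 0 <= xy.1 <= 1, 0 <= xy.2 <= 1 &
   e + n%:R * (xy.1 - xy.2) ^+ 2 < `|f xy.1 - f xy.2| ].
  move=> n; apply: contrapT => nn; apply: nK; exists n%:R => // x y hx hy.
  by rewrite leNgt; apply/negP => hlt; apply: nn; exists (x, y).
move=> /choice[u hu].
have bu n : `|(u n).1| <= 1.
  by have [/andP[h1 h2] _ _] := hu n; rewrite ger0_norm.
have bnd : bounded_fun (fun n => (u n).1).
  exists 1; split; first exact: real1.
  by move=> M M1 n _; exact: le_trans (bu n) (ltW M1).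
have [k ki /cvg_ex[l kl]] := bolzano_weierstrass bnd.
have kn n : (n <= k n)%N.
  elim: n => // n IH; apply: (leq_ltn_trans IH).
  by have := ki n.+1 n; rewrite ltnn leEnat ltnNge => ->.
have e20 : 0 < e / 2 by rewrite divr_gt0.
have /cvgrPdist_lt /(_ _ e20) /nbhs_ballP[eta /= eta0 fl] := cf l.
have eta20 : 0 < eta / 2 by rewrite divr_gt0.
have /cvgrPdist_lt /(_ _ eta20) [N _ hN] := kl.
pose n := maxn N (Num.truncn ((f xM - f xm) / (eta / 2) ^+ 2)).+1.
have hx : `|l - (u (k n)).1| < eta / 2 by apply: hN => /=; exact: leq_maxl.
have [u1 u2 u3] := hu (k n).
have kn0 : (f xM - f xm) / (eta / 2) ^+ 2 < (k n)%:R.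
  apply: (lt_le_trans (truncnS_gt _)); rewrite ler_nat (leq_trans _ (kn n))//.
  exact: leq_maxr.
have hd : `|(u (k n)).1 - (u (k n)).2| < eta / 2.
  rewrite -(@ltr_pXn2r _ 2%N)// ?nnegrE ?(ltW eta20)// real_normK ?num_real//.
  rewrite ltNge; apply/negP => hle.
  have k0 : 0 <= (k n)%:R :> R by [].
  have := ler_wpM2l k0 hle; move: kn0; rewrite ltr_pdivrMr ?exprn_gt0// => h1 h2.
  have := osc _ _ u1 u2; lra.
have fx : `|f l - f (u (k n)).1| < e / 2 by apply: fl; rewrite /ball/=; lra.
have fy : `|f l - f (u (k n)).2| < e / 2.
  apply: fl; rewrite /ball/=.
  have := ler_distD (u (k n)).1 l (u (k n)).2; lra.
have h0 : 0 <= (k n)%:R * ((u (k n)).1 - (u (k n)).2) ^+ 2 by rewrite mulr_ge0 ?sqr_ge0.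
have := ler_distD (f l) (f (u (k n)).1) (f (u (k n)).2).
rewrite (distrC (f (u (k n)).1) (f l)); lra.
Qed.

(** Bernstein's proof: the expectation of [f] after [n] steps differs from [f x]
    by at most [e / 2] plus [K] times the variance [x (1 - x) / n]. *)
Lemma weierstrass_approx f (e : R) : continuous f -> 0 < e ->
  exists p : {poly R}, forall x, 0 <= x <= 1 -> `|f x - p.[x]| <= e.
Proof.
move=> cf e0; have e20 : 0 < e / 2 by rewrite divr_gt0.
have [K K0 fK] := unif_continuous_quad cf e20.
pose n := (Num.truncn (K / (e / 2))).+1.
have n0 : 0 < n%:R :> R by rewrite ltr0n.
have Kn : K / n%:R <= e / 2.
  rewrite ler_pdivrMr// mulrC -ler_pdivrMr//; apply: ltW; exact: truncnS_gt.
exists (bernstein n (fun i => f (i%:R / n%:R))) => x x01.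
pose q i := K / n%:R ^+ 2 * (i%:R - n%:R * x) ^+ 2.
have fi i : (i <= n)%N -> `|f x - f (i%:R / n%:R)| <= e / 2 + q i.
  move=> ni; apply: le_trans (fK _ _ x01 _) _.
    by rewrite divr_ge0//= ler_pdivrMr// mul1r ler_nat.
  by rewrite lerD2l /q le_eqVlt; apply/orP; left; apply/eqP; field; rewrite gt_eqF.
have Q s : (bernstein n (fun i => s + K / n%:R ^+ 2 * (i%:R - n%:R * x) ^+ 2)).[x] <= s + e / 2.
  rewrite bernstein_affine_sqr lerD2l subrr expr0n add0r.
  have -> : K / n%:R ^+ 2 * (n%:R * x * (1 - x)) = K / n%:R * (x * (1 - x)).
    by field; rewrite gt_eqF.
  apply: le_trans Kn; rewrite ler_piMr ?divr_ge0 ?(ltW n0)//.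
  by move/andP: x01 => [x0 x1]; rewrite mulr_ile1 ?subr_ge0// gerBl.
rewrite ler_norml; apply/andP; split.
- have h : (bernstein n (fun i => f (i%:R / n%:R))).[x] <= (bernstein n (fun i => (f x + e / 2) + K / n%:R ^+ 2 * (i%:R - n%:R * x) ^+ 2)).[x].
    apply: bernstein_le => // i ni; have := fi i ni; rewrite ler_norml /q => /andP[h1 _]; lra.
  have := Q (f x + e / 2); lra.
- have h : (bernstein n (fun i => (f x - e / 2) - K / n%:R ^+ 2 * (i%:R - n%:R * x) ^+ 2)).[x] <= (bernstein n (fun i => f (i%:R / n%:R))).[x].
    apply: bernstein_le => // i ni; have := fi i ni; rewrite ler_norml /q => /andP[_ h1]; lra.
  move: h; rewrite bernsteinB bernstein_cst.
  have := Q 0; rewrite add0r.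
  under eq_fun do rewrite add0r.
  lra.
Qed.

(** Soft thresholding replaces [phi] by a nearby function that vanishes near
    the origin and near infinity; divided by [y * gauss 1 y] it becomes a
    continuous function [H] of [w = gauss 1 y] on the whole segment from [0] to
    [1], to which Weierstrass applies.  The powers of [w] in the approximant
    turn it into a combination of odd Gaussians. *)
Lemma odd_gauss_approx phi (A : nat) (e : R) :
  rapid phi -> (forall y, phi (- y) = - phi y) -> 0 < e ->
  exists p : {poly R}, forall y,
    weight y ^+ A * `|phi y - y * gauss 1 y * p.[gauss 1 y]| <= e.
Proof.
move=> rphi ophi e0; set d := e / 2; have d0 : 0 < d by rewrite divr_gt0.
have pi0 : 0 < pi :> R := pi_gt0 R.
have W0 y : 0 < weight y ^+ A :> R by rewrite exprn_gt0// weight_gt0.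
pose v y := weight y ^+ A * phi y.
have cv : continuous v.
  move=> y; apply: cvgM; last exact: rphi.1.
  by have [c _] := @slow_weight R A; exact: c.
(* [soft] moves [z] towards [0] by [d], stopping at [0]. *)
pose soft (z : R) := z + (`|z - d| - `|z + d|) / 2.
have soft0 z : `|z| <= d -> soft z = 0.
  rewrite ler_norml => /andP[z1 z2]; rewrite /soft ler0_norm; last lra.
  by rewrite ger0_norm; lra.
have softd z : `|z - soft z| <= d.
  rewrite /soft opprD addrA subrr add0r normrN.
  have h1 := ler_normD (z - d) (d + d); have h2 := ler_normB (z + d) (d + d).
  move: h1 h2; rewrite addrA subrK (ger0_norm (_ : 0 <= d + d)); last lra.
  rewrite (_ : z + d - (d + d) = z - d); last by ring.
  by move=> h1 h2; rewrite ler_norml; apply/andP; split; lra.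
have csoft : continuous soft.
  move=> z; apply: cvgD; first exact: cvg_id.
  apply: cvgM; last exact: cvg_cst.
  apply: cvgB; apply: cvg_norm.
    by apply: cvgB; [exact: cvg_id|exact: cvg_cst].
  by apply: cvgD; [exact: cvg_id|exact: cvg_cst].
pose phid y := soft (v y) / weight y ^+ A.
have cphid : continuous phid.
  move=> y; apply: cvgM.
    by apply: (@continuous_comp _ _ _ v soft); [exact: cv|exact: csoft].
  apply: cvgV; first by rewrite gt_eqF.
  by have [c _] := @slow_weight R A; exact: c.
have phid_err y : weight y ^+ A * `|phi y - phid y| <= d.
  have -> : weight y ^+ A * `|phi y - phid y| = `|v y - soft (v y)|.
    rewrite -[weight y ^+ A in LHS]gtr0_norm// -normrM mulrBr /phid.
    by congr (`|_ - _|); rewrite mulrC divfK// gt_eqF.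
  exact: softd.
have phi0 : phi 0 = 0.
  have := ophi 0; rewrite oppr0 => /eqP; rewrite -addr_eq0 -mulr2n mulrn_eq0/= => /eqP.
  by [].
have [eta eta0 hEta] : exists2 eta : R, 0 < eta & forall y, `|y| < eta -> phid y = 0.
  have /cvgrPdist_lt /(_ _ d0) /nbhs_ballP[eta /= eta0 he] := cv 0.
  exists eta => // y ye; rewrite /phid soft0 ?mul0r//.
  have := he y; rewrite /ball /= sub0r normrN => /(_ ye).
  by rewrite /v phi0 mulr0 sub0r normrN => /ltW.
have [M M0 hM] : exists2 M : R, 0 < M & forall y, M < `|y| -> phid y = 0.
  have [C C0 hC] := rapid_gt0 A.+1 rphi.
  exists (C / d) => [|y My]; first by rewrite divr_gt0.
  rewrite /phid soft0 ?mul0r// /v normrM (gtr0_norm (W0 y)).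
  have w0 : 0 < weight y by exact: weight_gt0.
  rewrite -(ler_pM2l w0) mulrA -exprS; apply: (le_trans (hC y)).
  rewrite -ler_pdivrMr//; apply: (le_trans (ltW My)).
  by rewrite /weight lerDr.
(* The inverse of [gauss 1] on the nonnegative half-line. *)
pose Y (w : R) := Num.sqrt (- ln w / pi).
have YK y : 0 <= y -> Y (gauss 1 y) = y.
  move=> y0; rewrite /Y /gauss expRK mulr1 !mulNr opprK mulrAC divff ?gt_eqF// mul1r.
  by rewrite sqrtr_sqr ger0_norm.
have Y0 w : 0 <= Y w by exact: sqrtr_ge0.
have gaussY w : 0 < w <= 1 -> gauss 1 (Y w) = w.
  move=> /andP[w0 w1]; rewrite /gauss /Y sqr_sqrtr.
    by rewrite mulr1 mulNr mulrC divfK ?gt_eqF// opprK lnK.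
  by rewrite divr_ge0 ?(ltW pi0)// oppr_ge0 ln_le0.
have gmono y z : 0 <= y -> y < z -> gauss 1 z < gauss 1 y :> R.
  move=> y0 yz; rewrite /gauss ltr_expR mulr1 !mulNr ltrN2 ltr_pM2l//.
  by rewrite ltrXn2r ?nnegrE//; lra.
pose H (w : R) := phid (Y w) / (Y w * w).
pose w0 : R := gauss 1 (M + eta).
pose w1 : R := gauss 1 (eta / 2).
have phid0 : phid 0 = 0 by apply: hEta; rewrite normr0.
(* If [0 < w < w0] then [Y w > M + eta], where [phid] vanishes; if [w <= 0] the
   default value of [ln] makes [Y w] zero. *)
have Hsmall w : w < w0 -> H w = 0.
  move=> ww0; rewrite /H; suff -> : phid (Y w) = 0 by rewrite mul0r.
  have [wn|wp] := leP w 0; first by rewrite /Y ln0// oppr0 mul0r sqrtr0.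
  apply: hM; rewrite ger0_norm// ltNge; apply/negP => YM.
  have ww : gauss 1 (Y w) = w.
    apply: gaussY; rewrite wp/=; apply: (le_trans (ltW ww0)).
    exact: gauss_le1.
  have : w0 < gauss 1 (Y w) by apply: gmono => //; lra.
  by rewrite ww; lra.
(* If [w1 < w <= 1] then [Y w < eta / 2]; if [w > 1] the root of a negative
   number makes [Y w] zero. *)
have Hlarge w : w1 < w -> H w = 0.
  move=> ww1; rewrite /H; suff -> : phid (Y w) = 0 by rewrite mul0r.
  apply: hEta; rewrite ger0_norm//.
  have wp : 0 < w by apply: lt_trans ww1; exact: expR_gt0.
  have [w1'|w1'] := leP w 1.
    have ww : gauss 1 (Y w) = w by apply: gaussY; rewrite wp.
    rewrite ltNge; apply/negP => eY.
    have : gauss 1 (Y w) < w1 by apply: gmono => //; lra.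
    by rewrite ww; lra.
  rewrite /Y ler0_sqrtr//; apply: mulr_le0_ge0.
    by rewrite oppr_le0 ln_ge0// ltW.
  by rewrite invr_ge0 ltW.
have cH : continuous H.
  move=> w.
  have [lw|lw] := ltP w w0.
    have Hw := Hsmall w lw.
    rewrite /continuous_at Hw; apply: cvg_near_cst; near=> z; apply: Hsmall.
    by near: z; exact: lt_nbhsl.
  have [gw|gw] := ltP w1 w.
    have Hw := Hlarge w gw.
    rewrite /continuous_at Hw; apply: cvg_near_cst; near=> z; apply: Hlarge.
    by near: z; exact: lt_nbhsr.
  have wp : 0 < w by apply: lt_le_trans lw; exact: expR_gt0.
  have wl1 : w < 1.
    apply: (le_lt_trans gw); rewrite -(gauss0 1); apply: gmono; lra.
  have cY : {for w, continuous Y}.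
    apply: (@continuous_comp _ _ _ (fun w => - ln w / pi) Num.sqrt); last exact: sqrt_continuous.
    apply: cvgM; last exact: cvg_cst.
    by apply: cvgN; exact: continuous_ln.
  apply: cvgM.
    by apply: (@continuous_comp _ _ _ Y phid); [exact: cY|exact: cphid].
  apply: cvgV.
    rewrite mulf_neq0 ?gt_eqF// /Y sqrtr_gt0 divr_gt0// oppr_gt0 ln_lt0// wp//.
  by apply: cvgM; [exact: cY|exact: cvg_id].
have [D D0 hD] := rapid_gt0 A (rapid_ogauss (ltr01 : 0 < 1 :> R)).
have dD0 : 0 < d / D by rewrite divr_gt0.
have [p hp] := weierstrass_approx cH dD0.
exists p.
suff main y : 0 <= y -> weight y ^+ A * `|phi y - y * gauss 1 y * p.[gauss 1 y]| <= e.
  move=> y; have [|y0] := leP 0 y; first exact: main.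
  have := main (- y); rewrite oppr_ge0 => /(_ (ltW y0)).
  rewrite gaussN ophi /weight normrN !mulNr -opprD normrN.
  by [].
move=> y0.
have E : phid y = y * gauss 1 y * H (gauss 1 y).
  rewrite /H YK//; have [->|yn0] := eqVneq y 0; first by rewrite phid0 !mul0r.
  by rewrite mulrC divfK// mulf_neq0// gt_eqF// expR_gt0.
have g01 : 0 <= gauss 1 y <= (1 : R).
  by rewrite gauss_ge0 gauss_le1.
have h1 := phid_err y.
have h2 : weight y ^+ A * `|phid y - y * gauss 1 y * p.[gauss 1 y]| <= d.
  rewrite E -mulrBr normrM mulrA.
  have := ler_pM _ _ (hD y) (hp _ g01).
  rewrite [D * _]mulrC divfK ?gt_eqF//; apply.
    by rewrite mulr_ge0 ?(ltW (W0 _)).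
  by [].
have -> : phi y - y * gauss 1 y * p.[gauss 1 y] =
   (phi y - phid y) + (phid y - y * gauss 1 y * p.[gauss 1 y]) by ring.
have := ler_wpM2l (ltW (W0 y)) (ler_normD (phi y - phid y) (phid y - y * gauss 1 y * p.[gauss 1 y])).
by rewrite mulrDr /d in h1 h2 *; lra.
Unshelve. all: by end_near.
Qed.

End Weierstrass.

(** * The functional equation of theta *)

Section Fejer.
Context {R : realType}.
Implicit Types (f g h phi : R -> R) (a c t s x y xi C : R).
Notation mu := (@lebesgue_measure R).

Definition dirichlet (k : nat) x : R := 1 + 2 * \sum_(n < k) cos (2 * pi * n.+1%:R * x).
(** [N] times the usual Fejer kernel, which is the mean of the Dirichlet
    kernels. *)
Definition fejer (N : nat) x : R := \sum_(k < N) dirichlet k x.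

Lemma dirichletS k x : dirichlet k.+1 x = dirichlet k x + 2 * cos (2 * pi * k.+1%:R * x).
Proof. by rewrite /dirichlet big_ord_recr /= mulrDr addrA. Qed.

Lemma dirichlet_cos k x : (1 - cos (2 * pi * x)) * dirichlet k x =
  cos (2 * pi * k%:R * x) - cos (2 * pi * k.+1%:R * x).
Proof.
elim: k => [|k IH].
  by rewrite /dirichlet big_ord0 !mulr0 !addr0 mulr1 mul0r cos0 mulr1.
rewrite dirichletS mulrDr IH.
have -> : 2 * pi * k.+2%:R * x = 2 * pi * k.+1%:R * x + 2 * pi * x.
  by rewrite -(natr1 k.+1); move: (2 * pi : R) => P; ring.
have -> : 2 * pi * k%:R * x = 2 * pi * k.+1%:R * x - 2 * pi * x.
  by rewrite -(natr1 k); move: (2 * pi : R) => P; ring.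
rewrite cosB cosD; move: (cos _) (cos _) (sin _) (sin _) => *; ring.
Qed.

Lemma dirichlet_sin k x : sin (2 * pi * x) * dirichlet k x =
  sin (2 * pi * k%:R * x) + sin (2 * pi * k.+1%:R * x).
Proof.
elim: k => [|k IH].
  by rewrite /dirichlet big_ord0 !mulr0 !addr0 !mulr1 mul0r sin0 add0r.
rewrite dirichletS mulrDr IH.
have -> : 2 * pi * k.+2%:R * x = 2 * pi * k.+1%:R * x + 2 * pi * x.
  by rewrite -(natr1 k.+1); move: (2 * pi : R) => P; ring.
have -> : 2 * pi * k%:R * x = 2 * pi * k.+1%:R * x - 2 * pi * x.
  by rewrite -(natr1 k); move: (2 * pi : R) => P; ring.
rewrite sinB sinD; move: (cos _) (cos _) (sin _) (sin _) => *; ring.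
Qed.

Lemma fejer_cos N x : (1 - cos (2 * pi * x)) * fejer N x = 1 - cos (2 * pi * N%:R * x).
Proof.
elim: N => [|N IH]; first by rewrite /fejer big_ord0 !mulr0 mul0r cos0 subrr.
by rewrite /fejer big_ord_recr /= mulrDr IH dirichlet_cos; ring.
Qed.

Lemma normr_fejer_le N x : `|(1 - cos (2 * pi * x)) * fejer N x| <= 2.
Proof.
rewrite fejer_cos; have := cos_le1 (2 * pi * N%:R * x); have := cos_geN1 (2 * pi * N%:R * x).
by move=> *; rewrite ler_norml; apply/andP; split; lra.
Qed.

Lemma cos_period (k : nat) x : cos (x + 2 * pi * k%:R) = cos x.
Proof.
rewrite -[RHS](periodicn (@cosD2pi R) k x); congr cos; congr (_ + _).
by rewrite -[RHS]mulr_natr -(mulr_natr pi) (mulrC pi).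
Qed.

Lemma sin_period (k : nat) x : sin (x + 2 * pi * k%:R) = sin x.
Proof.
rewrite -[RHS](periodicn (@sinD2pi R) k x); congr sin; congr (_ + _).
by rewrite -[RHS]mulr_natr -(mulr_natr pi) (mulrC pi).
Qed.

(** By parity take [u >= 0]; with [z = pi u / 2 <= pi / 4] the right side is [2 sin (2 z) ^ 2],
    and [sin (2 z) = 2 sin z cos z] is large enough because [cos] is at least
    [1 / sqrt 2 >= 7 / 10] there. *)
Lemma sqr_le_1Bcos (u : R) : `|u| <= 1 / 2 -> u ^+ 2 <= 1 - cos (2 * pi * u).
Proof.
wlog u0 : u / 0 <= u.
  move=> W; have [|u0] := leP 0 u; first exact: W.
  by move=> hu; have := W (- u); rewrite normrN sqrrN mulrN cosN; apply; lra.
rewrite ger0_norm// => u1.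
have pi2 : 2 <= pi :> R by exact: pi_ge2.
pose z := pi * u / 2.
have z0 : 0 <= z by rewrite divr_ge0// mulr_ge0//; lra.
have cos7 w : 0 <= w <= z -> 7 / 10 <= cos w.
  move=> /andP[w0 wz].
  have zpi : z <= pi / 4.
    rewrite /z; have -> : pi * u / 2 = pi / 4 * (2 * u) by field.
    by rewrite ler_piMr; lra.
  have c0 : 0 <= cos w by apply: cos_ge0_pihalf; apply/andP; split; lra.
  have c2 : 0 <= cos (w + w) by apply: cos_ge0_pihalf; apply/andP; split; lra.
  rewrite cosD in c2; have := cos2Dsin2 w; rewrite !expr2 => h.
  rewrite leNgt; apply/negP => lt7; nra.
have sz : 7 / 10 * z <= sin z.
  have [zp|] := ltP 0 z; last by move=> hz; have -> : z = 0 by [lra]; rewrite sin0 mulr0.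
  have [c cz] := @MVT _ sin cos 0 z zp (fun x _ => is_derive_sin x)
    (continuous_subspaceT (@continuous_sin R)).
  rewrite sin0 !subr0 => ->; rewrite ler_wpM2r// cos7//.
  by move: cz; rewrite in_itv/= => /andP[? ?]; apply/andP; split; lra.
have -> : 2 * pi * u = z + z + (z + z) by rewrite /z; field.
have hc : 7 / 10 <= cos z by apply: cos7; rewrite z0 lexx.
have zu : u <= z by rewrite /z; nra.
have hs2 : 98 / 100 * z <= sin (z + z).
  rewrite sinD; nra.
rewrite cosD; have := cos2Dsin2 (z + z); rewrite !expr2 => h; nra.
Qed.

Lemma Rintegral_itv_split g (a b c : R) : continuous g -> a <= b -> b <= c ->
  \int[mu]_(x in `[a, c]) g x = \int[mu]_(x in `[a, b]) g x + \int[mu]_(x in `[b, c]) g x.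
Proof.
move=> cg ab bc.
have gi (p q : R) : mu.-integrable `[p, q] (EFin \o g).
  apply: continuous_compact_integrable; first exact: segment_compact.
  exact: continuous_subspaceT.
have := @Rintegral_itvB R g (BLeft a) (BRight c) b (gi a c).
rewrite !bnd_simp => /(_ ab bc) H.
have gi' : mu.-integrable `]b, c] (EFin \o g).
  by apply: integrableS (gi b c) => //; exact: subset_itv_oc_cc.
by rewrite -(Rintegral_itv_obnd_cbnd gi') -H addrC subrK.
Qed.

Lemma is_derive_cos_prim (k : nat) x :
  is_derive x (1 : R) (fun x => - (2 * pi * k%:R)^-1 * cos (2 * pi * k%:R * x)) (sin (2 * pi * k%:R * x)).
Proof.
have H := is_derive_dsin_scale 1 (2 * pi * k%:R) x.
have H2 := is_deriveZ (- (2 * pi * k%:R)^-1) H.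
apply: is_derive_eq; rewrite /GRing.scale /=.
case: k {H H2} => [|k]; first by rewrite !mulr0 !mul0r sin0 mulr0.
by rewrite mulNr !mulrN opprK mulKf// !mulf_neq0// ?gt_eqF ?pi_gt0// ltr0n.
Qed.

Lemma is_derive_sin_prim (k : nat) x : (0 < k)%N ->
  is_derive x (1 : R) (fun x => (2 * pi * k%:R)^-1 * sin (2 * pi * k%:R * x)) (cos (2 * pi * k%:R * x)).
Proof.
move=> k0; have H := is_derive_dsin_scale 0 (2 * pi * k%:R) x.
have H2 := is_deriveZ ((2 * pi * k%:R)^-1) H.
apply: is_derive_eq; rewrite /GRing.scale /=.
by rewrite mulKf// !mulf_neq0// ?gt_eqF ?pi_gt0// ltr0n.
Qed.

Lemma continuous_dirichlet k : continuous (dirichlet k).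
Proof.
elim: k => [|k IH].
  have -> : dirichlet 0 = fun=> 1 by apply/funext => x; rewrite /dirichlet big_ord0 mulr0 addr0.
  exact: cst_continuous.
have -> : dirichlet k.+1 = fun x => dirichlet k x + 2 * dsin 1 (2 * pi * k.+1%:R * x).
  by apply/funext => x; rewrite dirichletS.
move=> x; apply: cvgD; first exact: IH.
apply: cvgM; first exact: cvg_cst.
exact: (is_derive_continuous (is_derive_dsin_scale 1 _)).
Qed.

Lemma continuous_fejer N : continuous (fejer N).
Proof.
elim: N => [|N IH].
  have -> : fejer 0 = fun=> 0 by apply/funext => x; rewrite /fejer big_ord0.
  exact: cst_continuous.
have -> : fejer N.+1 = fun x => fejer N x + dirichlet N x.
  by apply/funext => x; rewrite /fejer big_ord_recr.
by move=> x; apply: cvgD; [exact: IH|exact: continuous_dirichlet].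
Qed.

(** Term by term integration: every cosine in the kernel has mean zero over a
    period, and [dirichlet_sin] turns the product with [sin (2 pi x)] into a sum
    of sines. *)
Lemma Rintegral_fejer_cell N (a : R) (u v : R) :
  \int[mu]_(x in `[a, a + 1]) ((u + v * sin (2 * pi * x)) * fejer N x) = N%:R * u.
Proof.
pose Q k x := x + 2 * \sum_(n < k) (2 * pi * n.+1%:R)^-1 * sin (2 * pi * n.+1%:R * x).
pose P k x := - (2 * pi * k%:R)^-1 * cos (2 * pi * k%:R * x)
  - (2 * pi * k.+1%:R)^-1 * cos (2 * pi * k.+1%:R * x).
have dQ k x : is_derive x (1 : R) (Q k) (dirichlet k x).
  elim: k => [|k IH].
    have -> : Q 0 = id by apply/funext => z; rewrite /Q big_ord0 mulr0 addr0.
    by rewrite /dirichlet big_ord0 mulr0 addr0; exact: is_derive_id.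
  have -> : Q k.+1 = Q k + (2 \*: (fun x => (2 * pi * k.+1%:R)^-1 * sin (2 * pi * k.+1%:R * x))).
    by apply/funext => z; rewrite /Q big_ord_recr /= mulrDr addrA.
  have H := is_deriveZ 2 (@is_derive_sin_prim k.+1 x (ltn0Sn k)).
  by apply: is_derive_eq; rewrite dirichletS.
have dP k x : is_derive x (1 : R) (P k) (sin (2 * pi * x) * dirichlet k x).
  rewrite dirichlet_sin.
  have H1 := is_derive_cos_prim k x; have H2 := is_derive_cos_prim k.+1 x.
  rewrite /P; under eq_fun do rewrite -[X in _ + X]mulNr.
  by apply: is_derive_eq.
pose G x := \sum_(k < N) (u * Q k x + v * P k x).
have dG x : is_derive x (1 : R) G ((u + v * sin (2 * pi * x)) * fejer N x).
  rewrite /fejer mulr_sumr /G.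
  have H (k : 'I_N) : is_derive x (1 : R) (fun x => u * Q k x + v * P k x) ((u + v * sin (2 * pi * x)) * dirichlet k x).
    have H1 := is_deriveZ u (dQ k x); have H2 := is_deriveZ v (dP k x).
    by apply: is_derive_eq; rewrite /GRing.scale /=; ring.
  have := @is_derive_sum _ _ _ N _ x 1 _ H.
  rewrite (_ : \sum_(i < N) _ = fun x => \sum_(k < N) (u * Q k x + v * P k x))//.
  by apply/funext => z; rewrite fct_sumE.
have cF : continuous (fun x => (u + v * sin (2 * pi * x)) * fejer N x).
  move=> x; apply: cvgM; last exact: continuous_fejer.
  apply: cvgD; first exact: cvg_cst.
  apply: cvgM; first exact: cvg_cst.
  exact: (is_derive_continuous (is_derive_dsin_scale 0 _)).
have cG := is_derive_continuous dG.
rewrite /Rintegral (@continuous_FTC2 _ _ G).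
- rewrite -EFinB /= /G -sumrB.
  rewrite (eq_bigr (fun=> u)).
    by rewrite mulr_natl sumr_const card_ord.
  move=> k _.
  have per (n : nat) : 2 * pi * n%:R * (a + 1) = 2 * pi * n%:R * a + 2 * pi * n%:R :> R.
    by rewrite mulrDr mulr1.
  have -> : P k (a + 1) = P k a by rewrite /P !per !cos_period.
  have -> : Q k (a + 1) = Q k a + 1.
    rewrite /Q; under eq_bigr do rewrite per sin_period.
    by rewrite addrAC.
  by ring.
- by rewrite ltrDl.
- exact: continuous_subspaceT.
- split.
  + by move=> x _; have [] := dG x.
  + by apply: cvg_at_right_filter; exact: cG.
  + by apply: cvg_at_left_filter; exact: cG.
- by move=> x _; rewrite derive1E; apply: derive_val.
Qed.

Definition zsum f (M : nat) : R := f 0 + \sum_(m < M) (f m.+1%:R + f (- m.+1%:R)).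

(** Telescoping: [1 / (n + 1) ^ 2 <= 1 / n - 1 / (n + 1)]. *)
Lemma sum_inv_sqr_le (N : nat) : \sum_(n < N) (n.+1%:R ^+ 2)^-1 <= 2 :> R.
Proof.
case: N => [|N]; first by rewrite big_ord0.
suff H : \sum_(n < N.+1) (n.+1%:R ^+ 2)^-1 + N.+1%:R^-1 <= 2 :> R.
  by apply: le_trans H; rewrite lerDl invr_ge0.
elim: N => [|N IH]; first by rewrite big_ord1 expr1n invr1; lra.
rewrite big_ord_recr /=; apply: le_trans IH; rewrite -addrA lerD2l.
have -> : N.+2%:R = N%:R + 2 :> R by rewrite -natrD addn2.
have -> : N.+1%:R = N%:R + 1 :> R by rewrite natr1.
set x := N%:R; have x0 : 0 <= x :> R by rewrite /x.
have -> : (x + 1)^-1 = (x + 2) ^+ 2 / ((x + 2) ^+ 2 * (x + 1)).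
  by field; rewrite !gt_eqF//; lra.
have -> : ((x + 2) ^+ 2)^-1 + (x + 2)^-1 = (x + 3) * (x + 1) / ((x + 2) ^+ 2 * (x + 1)).
  by field; rewrite !gt_eqF//; lra.
have h0 : 0 < (x + 2) ^+ 2 * (x + 1) by rewrite mulr_gt0 ?exprn_gt0//; lra.
by rewrite ler_pM2r ?invr_gt0//; lra.
Qed.

Lemma cvg_series_inv_sqr (u : nat -> R) C : (forall n, `|u n| <= C / n.+1%:R ^+ 2) ->
  cvgn (fun N => \sum_(n < N) u n).
Proof.
move=> uC.
have C0 : 0 <= C by have := uC 0%N; rewrite expr1n divr1; apply: le_trans.
have -> : (fun N => \sum_(n < N) u n) = series u.
  by apply/funext => N; rewrite /series /= big_mkord.
apply: normed_cvg; apply: nondecreasing_is_cvgn.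
  by apply/nondecreasing_seqP => n; rewrite /= !seriesEnat /= big_nat_recr//= lerDl.
exists (C * 2) => _ [N _ <-]; rewrite /= seriesEnat /= big_mkord.
apply: (@le_trans _ _ (\sum_(n < N) C * (n.+1%:R ^+ 2)^-1)).
  by apply: ler_sum => n _; exact: uC.
by rewrite -mulr_sumr ler_wpM2l// sum_inv_sqr_le.
Qed.

Lemma normr_sum_inv_sqr_le (u : nat -> R) C N : (forall n, `|u n| <= C / n.+1%:R ^+ 2) ->
  `|\sum_(n < N) u n| <= 2 * C.
Proof.
move=> uC.
have C0 : 0 <= C by have := uC 0%N; rewrite expr1n divr1; apply: le_trans.
apply: (le_trans (ler_norm_sum _ _ _)).
apply: (@le_trans _ _ (\sum_(n < N) C * (n.+1%:R ^+ 2)^-1)).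
  by apply: ler_sum => n _; exact: uC.
by rewrite -mulr_sumr mulrC ler_wpM2r// sum_inv_sqr_le.
Qed.

Lemma weight_nat (n : nat) : weight (n%:R) = n.+1%:R :> R.
Proof. by rewrite /weight ger0_norm// addrC natr1. Qed.

Lemma zsum_cvg f : rapid f -> cvgn (zsum f).
Proof.
move=> rf; have [C C0 fC] := rapid_gt0 2 rf.
apply: is_cvgD; first exact: is_cvg_cst.
apply: (@cvg_series_inv_sqr (fun m => f m.+1%:R + f (- m.+1%:R)) (C + C)) => m.
have b y : weight y = m.+2%:R -> `|f y| <= C / m.+1%:R ^+ 2.
  move=> wy; have := fC y; rewrite wy mulrC -ler_pdivlMr ?exprn_gt0 ?ltr0n// => h.
  apply: (le_trans h); rewrite ler_wpM2l ?(ltW C0)// lef_pV2 ?posrE ?exprn_gt0 ?ltr0n//.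
  by rewrite lerXn2r ?nnegrE// ler_nat.
apply: (le_trans (ler_normD _ _)); rewrite mulrDl lerD//; apply: b; rewrite ?weight_nat//.
by rewrite /weight normrN -[1 + _]/(weight m.+1%:R) weight_nat.
Qed.

(** Subtracting [f c + f' c * sin (2 pi x) / (2 pi)], which
    [Rintegral_fejer_cell] integrates exactly, leaves a remainder that is
    quadratic in [x - c]; the kernel is [O (1 / (1 - cos (2 pi x)))] by
    [normr_fejer_le], hence [O ((x - c) ^ - 2)] on the cell, uniformly
    in [N]. *)
Lemma fejer_cell_error N f f' f'' (c D : R) :
  (forall x, is_derive x 1 f (f' x)) -> (forall x, is_derive x 1 f' (f'' x)) ->
  (forall x, sin (2 * pi * (x - c)) = sin (2 * pi * x)) ->
  (forall x, cos (2 * pi * (x - c)) = cos (2 * pi * x)) ->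
  (forall x, `|x - c| <= 1 / 2 -> `|f'' x| + 2 * pi * `|f' c| <= D) ->
  `|\int[mu]_(x in `[c - 1 / 2, c + 1 / 2]) (f x * fejer N x) - N%:R * f c| <= 2 * D.
Proof.
move=> d1 d2 hs hc hD.
have p0 : 0 < 2 * pi :> R by rewrite mulr_gt0 ?pi_gt0.
have pn0 : 2 * pi != 0 :> R by rewrite gt_eqF.
have cf := is_derive_continuous d1.
pose v := f' c / (2 * pi).
pose h x := f c + v * sin (2 * pi * x).
pose g x := f x - h x.
pose g' x := f' x - v * (2 * pi * cos (2 * pi * x)).
pose g'' x := f'' x + v * (2 * pi) * (2 * pi * sin (2 * pi * x)).
have ds x : is_derive x (1 : R) (fun x : R => sin (2 * pi * x)) (2 * pi * cos (2 * pi * x)).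
  exact: (is_derive_dsin_scale 0 (2 * pi) x).
have dc x : is_derive x (1 : R) (fun x : R => cos (2 * pi * x)) (2 * pi * - sin (2 * pi * x)).
  exact: (is_derive_dsin_scale 1 (2 * pi) x).
have dh x : is_derive x (1 : R) h (v * (2 * pi * cos (2 * pi * x))).
  have H := is_deriveZ v (ds x); rewrite /h.
  have H2 := is_derive_cst (f c) x (1 : R).
  have H3 := is_deriveD H2 H.
  by apply: is_derive_eq; rewrite add0r.
have dg x : is_derive x (1 : R) g (g' x).
  by have H := is_deriveB (d1 x) (dh x); apply: is_derive_eq.
have dg' x : is_derive x (1 : R) g' (g'' x).
  have H := is_deriveZ (v * (2 * pi)) (dc x); have H2 := is_deriveB (d2 x) H.
  rewrite /g'; under eq_fun do rewrite mulrA.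
  apply: is_derive_eq; rewrite /g'' /GRing.scale /=.
  by rewrite mulrN mulrN opprK.
have s0 : sin (2 * pi * c) = 0 by rewrite -hs subrr mulr0 sin0.
have c0 : cos (2 * pi * c) = 1 by rewrite -hc subrr mulr0 cos0.
have gc : g c = 0 by rewrite /g /h s0 mulr0 addr0 subrr.
have g'c : g' c = 0 by rewrite /g' c0 mulr1 /v divfK// subrr.
have g2 x : `|x - c| <= 1 / 2 -> `|g'' x| <= D.
  move=> hx; apply: le_trans (hD x hx); apply: (le_trans (ler_normD _ _)); rewrite lerD2l.
  rewrite /v divfK// normrM (normrM (2 * pi)) (gtr0_norm p0) mulrC -[leRHS]mulr1 mulrAC.
  by rewrite ler_pM ?mulr_ge0 ?(ltW p0)// ?ler_norml ?sin_geN1 ?sin_le1 ?pi_ge0.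
have D0 : 0 <= D by apply: le_trans (g2 c _); rewrite ?normr_ge0// subrr normr0; lra.
have g1 x : `|x - c| <= 1 / 2 -> `|g' x| <= D * `|x - c|.
  move=> hx; rewrite -[g' x]subr0 -g'c; apply: (mean_value_le dg') => y yx.
  by apply: g2; exact: le_trans hx.
have g0 x : `|x - c| <= 1 / 2 -> `|g x| <= D * `|x - c| * `|x - c|.
  move=> hx; rewrite -[g x]subr0 -gc; apply: (mean_value_le dg) => y yx.
  apply: (le_trans (g1 y (le_trans yx hx))).
  by rewrite ler_wpM2l.
have cF := @continuous_fejer N.
have cg := is_derive_continuous dg; have ch := is_derive_continuous dh.
have ii k : continuous k -> mu.-integrable `[c - 1 / 2, c + 1 / 2] (EFin \o k).
  move=> ck; apply: continuous_compact_integrable; first exact: segment_compact.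
  exact: continuous_subspaceT.
have cgF : continuous (fun x => g x * fejer N x) by move=> x; apply: cvgM; [exact: cg|exact: cF].
have chF : continuous (fun x => h x * fejer N x) by move=> x; apply: cvgM; [exact: ch|exact: cF].
have -> : \int[mu]_(x in `[c - 1 / 2, c + 1 / 2]) (f x * fejer N x) - N%:R * f c =
   \int[mu]_(x in `[c - 1 / 2, c + 1 / 2]) (g x * fejer N x).
  have := Rintegral_fejer_cell N (c - 1 / 2) (f c) v.
  rewrite (_ : c - 1 / 2 + 1 = c + 1 / 2); last by field.
  move=> <-; rewrite -RintegralB//.
  - by apply: eq_Rintegral => x _; rewrite /g /h mulrBl.
  - by apply: ii => x; apply: cvgM; [exact: cf|exact: cF].
  - exact: ii.
apply: (le_trans (le_normr_Rintegral _ (ii _ cgF))) => //.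
apply: (@le_trans _ _ (\int[mu]_(x in `[c - 1 / 2, c + 1 / 2]) (2 * D))).
  apply: le_Rintegral => //.
  - exact: integrable_norm (ii _ cgF).
  - by apply: ii => x; exact: cvg_cst.
  - move=> x; rewrite /= in_itv /= => /andP[x1 x2].
    have xc : `|x - c| <= 1 / 2 by rewrite ler_norml; apply/andP; split; lra.
    rewrite normrM.
    have h1 : `|x - c| * `|x - c| <= `|1 - cos (2 * pi * x)|.
      rewrite -expr2 real_normK ?num_real//; apply: le_trans (ler_norm _).
      by rewrite -hc; exact: sqr_le_1Bcos.
    have h2 := normr_fejer_le N x; rewrite normrM in h2.
    have h3 := ler_wpM2l D0 h1; rewrite mulrA in h3.
    have h4 := le_trans (g0 x xc) h3.
    have h5 := ler_wpM2r (normr_ge0 (fejer N x)) h4.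
    by apply: (le_trans h5); rewrite -mulrA mulrC ler_wpM2r.
rewrite Rintegral_cst//= lebesgue_measure_itv /= lte_fin ifT; last by lra.
rewrite -EFinB /= (_ : c + 1 / 2 - (c - 1 / 2) = 1); last by field.
by rewrite mulr1.
Qed.

Lemma sin_shift_nat (m : nat) x : sin (2 * pi * (x - m%:R)) = sin (2 * pi * x).
Proof. by rewrite mulrBr -(sin_period m) subrK. Qed.
Lemma cos_shift_nat (m : nat) x : cos (2 * pi * (x - m%:R)) = cos (2 * pi * x).
Proof. by rewrite mulrBr -(cos_period m) subrK. Qed.
Lemma sin_shift_Nnat (m : nat) x : sin (2 * pi * (x - - m%:R)) = sin (2 * pi * x).
Proof. by rewrite opprK mulrDr sin_period. Qed.
Lemma cos_shift_Nnat (m : nat) x : cos (2 * pi * (x - - m%:R)) = cos (2 * pi * x).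
Proof. by rewrite opprK mulrDr cos_period. Qed.

(** Sum of the cell errors of [fejer_cell_error] over the integers; the decay of
    the derivatives makes it converge. *)
Lemma poisson_fejer f f' f'' : rapid f -> rapid f' -> rapid f'' ->
  (forall x, is_derive x 1 f (f' x)) -> (forall x, is_derive x 1 f' (f'' x)) ->
  exists C, forall N, `|\int[mu]_(x in setT) (f x * fejer N x) - N%:R * limn (zsum f)| <= C.
Proof.
move=> rf rf' rf'' d1 d2.
have p0 : 0 <= 2 * pi :> R by rewrite mulr_ge0 ?pi_ge0.
have [B B0 hB] := rapid_gt0 2 rf'.
have [B2 B20 hB2] := rapid_gt0 2 rf''.
pose E := 4 * B2 + 2 * pi * B.
have E0 : 0 <= E by rewrite addr_ge0 ?mulr_ge0// ?(ltW B0) ?(ltW B20)// pi_ge0.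
have hD c x : `|x - c| <= 1 / 2 -> `|f'' x| + 2 * pi * `|f' c| <= E / weight c ^+ 2.
  move=> xc; have w0 : 0 < weight c ^+ 2 by rewrite exprn_gt0// weight_gt0.
  rewrite ler_pdivlMr// mulrDl /E lerD//; last first.
    by rewrite -[leLHS]mulrA ler_wpM2l// mulrC.
  have wx : weight c <= 2 * weight x.
    rewrite /weight; have := ler_normD (c - x) x; rewrite subrK distrC.
    have := normr_ge0 x; lra.
  apply: (@le_trans _ _ (`|f'' x| * (2 * weight x) ^+ 2)).
    by rewrite ler_wpM2l// lerXn2r ?nnegrE ?mulr_ge0 ?weight_ge0.
  by rewrite exprMn mulrCA -natrX ler_wpM2l// mulrC.
pose C := 2 * E + 2 * (2 * E + 2 * E).
exists C => N.
have cF := @continuous_fejer N.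
have rF : slow (fejer N).
  split => //; exists 0%N, (\sum_(k < N) (1 + 2 * k%:R)) => y.
  rewrite expr0 mulr1; apply: (le_trans (ler_norm_sum _ _ _)); apply: ler_sum => k _.
  apply: (le_trans (ler_normD _ _)); rewrite normr1 lerD2l normrM ger0_norm// ler_wpM2l//.
  apply: (le_trans (ler_norm_sum _ _ _)).
  apply: (@le_trans _ _ (\sum_(i < k) 1)); last by rewrite sumr_const card_ord.
  by apply: ler_sum => i _; rewrite ler_norml cos_geN1 cos_le1.
have rfF := rapidM rf rF.
have [cfF hfF] := rfF.
have [G hG] := hfF 2%N.
have cv1 := cvg_Rintegral_itv (1 / 2) cfF hG.
have cv2 : N%:R * zsum f M @[M --> \oo] --> N%:R * limn (zsum f).
  by apply: cvgM; [exact: cvg_cst|exact: zsum_cvg].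
have cv3 : `|\int[mu]_(y in `[- (M%:R + 1 / 2), M%:R + 1 / 2]) (f y * fejer N y) - N%:R * zsum f M| @[M --> \oo]
    --> `|\int[mu]_(x in setT) (f x * fejer N x) - N%:R * limn (zsum f)|.
  by apply: cvg_norm; apply: cvgB; [exact: cv1|exact: cv2].
rewrite -(cvg_lim _ cv3)//; apply: limr_le.
  by apply/cvg_ex; eexists; exact: cv3.
pose e (M : nat) : R := \int[mu]_(x in `[(M%:R + 1 / 2), (M.+1%:R + 1 / 2)]) (f x * fejer N x) - N%:R * f M.+1%:R
  + (\int[mu]_(x in `[- (M.+1%:R + 1 / 2), - (M%:R + 1 / 2)]) (f x * fejer N x) - N%:R * f (- M.+1%:R)).
(* Cut the line at the half-integers. *)
have claim M : \int[mu]_(y in `[(- (M%:R + 1 / 2)), (M%:R + 1 / 2)]) (f y * fejer N y) - N%:R * zsum f M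
  = (\int[mu]_(x in `[0 - 1 / 2, 0 + 1 / 2]) (f x * fejer N x) - N%:R * f 0) + \sum_(m < M) e m.
  elim: M => [|M IH].
    by rewrite /zsum !big_ord0 !addr0 !add0r.
  rewrite big_ord_recr /= addrA -IH /e /zsum big_ord_recr /=.
  have M0 : 0 <= M%:R :> R by [].
  have MM : M.+1%:R = M%:R + 1 :> R by rewrite natr1.
  rewrite (@Rintegral_itv_split _ (- (M.+1%:R + 1 / 2)) (- (M%:R + 1 / 2)))//; [|rewrite ?MM; lra..].
  rewrite (@Rintegral_itv_split _ (- (M%:R + 1 / 2)) (M%:R + 1 / 2))//; [|rewrite ?MM; lra..].
  by rewrite !mulrDr; ring.
near=> M; rewrite claim /C; apply: (le_trans (ler_normD _ _)); rewrite lerD//.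
  apply: (fejer_cell_error N d1 d2).
  - by move=> x; rewrite subr0.
  - by move=> x; rewrite subr0.
  - by move=> x hx; apply: (le_trans (hD _ _ hx)); rewrite /weight normr0 addr0 expr1n divr1.
apply: normr_sum_inv_sqr_le => m.
have wm : weight (m.+1%:R) ^+ 2 >= m.+1%:R ^+ 2 :> R.
  by rewrite weight_nat lerXn2r ?nnegrE// ler_nat.
have mm : m.+1%:R = m%:R + 1 :> R by rewrite natr1.
have hE (c : R) x : weight c = weight m.+1%:R :> R -> `|x - c| <= 1 / 2 -> `|f'' x| + 2 * pi * `|f' c| <= E / m.+1%:R ^+ 2.
  move=> wc hx; apply: (le_trans (hD _ _ hx)); rewrite wc ler_wpM2l//.
  by rewrite lef_pV2 ?posrE ?exprn_gt0 ?ltr0n// weight_nat.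
rewrite mulrDl -!mulrA; apply: (le_trans (ler_normD _ _)); rewrite lerD//.
  have -> : m%:R + 1 / 2 = m.+1%:R - 1 / 2 :> R by rewrite mm; field.
  apply: (fejer_cell_error N d1 d2).
  - exact: sin_shift_nat.
  - exact: cos_shift_nat.
  - by move=> x; exact: hE.
have -> : - (m%:R + 1 / 2) = - m.+1%:R + 1 / 2 :> R by rewrite mm; field.
have -> : - (m.+1%:R + 1 / 2) = - m.+1%:R - 1 / 2 :> R by field.
apply: (fejer_cell_error N d1 d2).
- exact: sin_shift_Nnat.
- exact: cos_shift_Nnat.
- by move=> x; apply: hE; rewrite /weight normrN.
Unshelve. all: by end_near.
Qed.

Lemma is_derive_ogauss t x : is_derive x 1 (ogauss t) (gauss t x - 2 * pi * t * (x ^+ 2 * gauss t x)).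
Proof.
have H := is_deriveM (is_derive_id x 1) (is_derive_gauss t x).
by apply: is_derive_eq; rewrite /GRing.scale /= mulr1; move: (2 * pi : R) => P; ring.
Qed.

(** Integrating [gauss t] against the Dirichlet kernels gives, by [sintr_gauss],
    the partial sums of the dual series.  Hence [poisson_fejer] says that the
    Cesaro means of these partial sums tend to the left side, and they also tend
    to the sum of the dual series. *)
Lemma theta_functional_equation t : 0 < t ->
  limn (zsum (gauss t)) = (Num.sqrt t)^-1 * limn (zsum (gauss t^-1)).
Proof.
move=> t0.
have rg := rapid_gauss t0; have ro := rapid_ogauss t0.
have tV0 : 0 < t^-1 by rewrite invr_gt0.
have rf'' : rapid (fun x => - (2 * pi * t) * (gauss t x - 2 * pi * t * (x ^+ 2 * gauss t x))).
  apply: rapidZ; apply: rapidB => //; apply: rapidZ.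
  by apply: rapidMl; [exact: slow_exp|].
have [C hC] := poisson_fejer rg (rapidZ (- (2 * pi * t)) ro) rf'' (is_derive_gauss t)
  (fun x => is_deriveZ (- (2 * pi * t)) (is_derive_ogauss t x)).
have cvb := zsum_cvg (rapid_gauss tV0).
set b := limn (zsum (gauss t^-1)) in cvb *.
have ik k (u v : R) : mu.-integrable setT (EFin \o (fun x => gauss t x * (u + v * dsin 1 (2 * pi * k * x)))).
  apply: rapid_integrable; apply: rapidM => //.
  by apply: slowD; [exact: slow_cst|apply: slowM; [exact: slow_cst|exact: slow_dsin]].
have sd k : slow (dirichlet k).
  elim: k => [|k IH].
    have -> : dirichlet 0 = fun=> 1 by apply/funext => x; rewrite /dirichlet big_ord0 mulr0 addr0.
    exact: slow_cst.
  have -> : dirichlet k.+1 = fun x => dirichlet k x + 2 * dsin 1 (2 * pi * k.+1%:R * x).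
    by apply/funext => x; rewrite dirichletS.
  by apply: slowD => //; apply: slowM; [exact: slow_cst|exact: slow_dsin].
have Id k : \int[mu]_(x in setT) (gauss t x * dirichlet k x) = (Num.sqrt t)^-1 * zsum (gauss t^-1) k.
  elim: k => [|k IH].
    rewrite /zsum big_ord0 addr0 gauss0 mulr1 -Rintegral_gauss//.
    by apply: eq_Rintegral => x _; rewrite /dirichlet big_ord0 mulr0 addr0 mulr1.
  have -> : zsum (gauss t^-1) k.+1 = zsum (gauss t^-1) k + 2 * gauss t^-1 k.+1%:R.
    by rewrite /zsum big_ord_recr /= addrA gaussN -mulr2n mulr_natl.
  rewrite mulrDr -IH mulrCA -sintr_gauss//.
  rewrite -RintegralZl//; last by apply: rapid_integrable; apply: rapidM => //; exact: slow_dsin.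
  rewrite -RintegralD//.
  - by apply: eq_Rintegral => x _; rewrite dirichletS mulrDr mulrCA.
  - by apply: rapid_integrable; exact: rapidM.
  - by apply: rapid_integrable; apply: rapidZ; apply: rapidM => //; exact: slow_dsin.
have sF N : slow (fejer N).
  elim: N => [|N IH].
    have -> : fejer 0 = fun=> 0 by apply/funext => x; rewrite /fejer big_ord0.
    exact: slow_cst.
  have -> : fejer N.+1 = fun x => fejer N x + dirichlet N x.
    by apply/funext => x; rewrite /fejer big_ord_recr.
  exact: slowD.
have IF N : \int[mu]_(x in setT) (gauss t x * fejer N x) = (Num.sqrt t)^-1 * \sum_(k < N) zsum (gauss t^-1) k.
  elim: N => [|N IH].
    rewrite big_ord0 mulr0 (@eq_Rintegral _ _ _ mu setT (fun=> 0)).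
      by rewrite Rintegral_cst//= mul0r.
    by move=> x _; rewrite /fejer big_ord0 mulr0.
  rewrite big_ord_recr /= mulrDr -IH -Id -RintegralD//.
  - by apply: eq_Rintegral => x _; rewrite /fejer big_ord_recr /= mulrDr.
  - by apply: rapid_integrable; exact: rapidM.
  - by apply: rapid_integrable; exact: rapidM.
have mean : (Num.sqrt t)^-1 * arithmetic_mean (zsum (gauss t^-1)) n @[n --> \oo]
    --> (Num.sqrt t)^-1 * b.
  by apply: cvgM; [exact: cvg_cst|exact: cesaro].
suff L : (Num.sqrt t)^-1 * arithmetic_mean (zsum (gauss t^-1)) n @[n --> \oo] --> limn (zsum (gauss t)).
  by rewrite -(cvg_lim _ L)//; exact: cvg_lim.
apply/cvgrPdist_le => e e0; near=> n.
have n0 : 0 < n.+1%:R :> R by rewrite ltr0n.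
rewrite distrC /arithmetic_mean /= /series /= big_mkord.
have := hC n.+1; rewrite IF => h.
have -> : (Num.sqrt t)^-1 * (n.+1%:R^-1 * \sum_(i < n.+1) zsum (gauss t^-1) i) - limn (zsum (gauss t))
  = n.+1%:R^-1 * ((Num.sqrt t)^-1 * \sum_(i < n.+1) zsum (gauss t^-1) i - n.+1%:R * limn (zsum (gauss t))).
  by rewrite mulrBr mulKf ?gt_eqF// mulrCA.
rewrite normrM gtr0_norm ?invr_gt0// ler_pdivrMl//.
apply: (le_trans h); rewrite -ler_pdivrMr//.
apply: (@le_trans _ _ n%:R); last by rewrite ler_nat.
by near: n; exact: nbhs_infty_ger.
Unshelve. all: by end_near.
Qed.

End Fejer.

(** * Sums of squares and powers of theta *)

Section Squares.
Context {R : realType}.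

Section Box.
Variables (k M : nat).
Local Notation box := {ffun 'I_k -> 'I_(M + M).+1}.
Implicit Types g : box.

(** Lattice points of the cube [[- M, M] ^ k], indexed by a finite type so that
    the power of a finite sum distributes over it. *)
Definition box_vec g : 'rV[int]_k := \row_i ((g i : nat)%:Z - M%:Z).
Definition box_nrm g : nat := (\sum_(i < k) `|(g i : nat)%:Z - M%:Z| ^ 2)%N.

Lemma box_vec_inj : injective box_vec.
Proof.
move=> g h /rowP gh; apply/ffunP => i; apply: val_inj => /=.
have := gh i; rewrite !mxE => /addIr; by case.
Qed.

Lemma box_vec_reps g n : squares_reps k n (box_vec g) <-> box_nrm g = n.
Proof.
rewrite /squares_reps /=.
have -> : (\sum_(i < k) box_vec g 0 i ^+ 2)%R = (box_nrm g)%:Z.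
  rewrite /box_nrm (big_morph Posz PoszD (erefl _)); apply: eq_bigr => i _.
  by rewrite mxE -abszX gez0_abs ?sqr_ge0.
by split => [[]|->].
Qed.

Lemma card_box_le n : (#|[pred g : box | box_nrm g == n]| <= nb_squares_reps k n)%N.
Proof.
rewrite cardE -(size_map box_vec) /nb_squares_reps.
apply: uniq_leq_size; first by rewrite (map_inj_uniq box_vec_inj) enum_uniq.
move=> v /mapP[g]; rewrite mem_enum inE => /eqP gn ->.
rewrite in_fset_set; last exact: finite_squares_reps.
by apply: mem_set; apply/box_vec_reps.
Qed.

Lemma card_box n : (n <= M)%N -> #|[pred g : box | box_nrm g == n]| = nb_squares_reps k n.
Proof.
move=> nM; apply/eqP; rewrite eqn_leq card_box_le /=.
rewrite cardE -(size_map box_vec) /nb_squares_reps.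
apply: uniq_leq_size; first exact: fset_uniq.
move=> m; rewrite in_fset_set; last exact: finite_squares_reps.
move/set_mem => hm.
have hle i : (m 0 i ^+ 2 <= n%:Z)%R.
  rewrite -hm (bigD1 i) //= lerDl; apply: sumr_ge0 => j _; exact: sqr_ge0.
have hb i : (`|m 0 i| <= M%:Z)%R.
  apply: (@le_trans _ _ n%:Z); last by rewrite lez_nat.
  case: (leP `|m 0 i| n%:Z) => // hlt.
  have := hle i; rewrite -real_normK ?num_real // leNgt => /negP []; rewrite expr2.
  have h1 : (1 <= `|m 0 i|)%R by rewrite -gtz0_ge1; apply: le_lt_trans hlt.
  by apply: (lt_le_trans hlt); rewrite ler_peMr.
pose g : box := [ffun i => inord `|(m 0 i + M%:Z)%R|%N].
have gm : box_vec g = m.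
  apply/rowP => i; rewrite !mxE ffunE inordK.
    by rewrite gez0_abs ?addrK //; have := hb i; rewrite ler_norml -lerBlDr sub0r => /andP[].
  have := hb i; rewrite ler_norml => /andP[h1 h2].
  rewrite ltnS -lez_nat gez0_abs; first by rewrite PoszD lerD2r.
  by rewrite -lerBlDr sub0r.
apply/mapP; exists g => //; rewrite mem_enum inE; apply/eqP/box_vec_reps.
by rewrite gm.
Qed.

Lemma box_nrm_le g : (box_nrm g <= k * M ^ 2)%N.
Proof.
rewrite /box_nrm.
have -> : (k * M ^ 2 = \sum_(i < k) M ^ 2)%N by rewrite sum_nat_const card_ord.
apply: leq_sum => i _.
rewrite leq_sqr; have := ltn_ord (g i); lia.
Qed.

Lemma zsum_ord (f : R -> R) : zsum f M = \sum_(j < (M + M).+1) f (j%:R - M%:R).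
Proof.
rewrite /zsum; elim: M => [|M' IH]; first by rewrite big_ord0 addr0 big_ord1 subrr.
rewrite big_ord_recr /= addrA IH.
have -> : \sum_(j < (M'.+1 + M'.+1).+1) f (j%:R - M'.+1%:R) =
  f (- M'.+1%:R) + (\sum_(j < (M' + M').+1) f (j%:R - M'%:R) + f (M'.+1%:R)).
  rewrite addSn addnS big_ord_recl sub0r; congr (_ + _).
  rewrite big_ord_recr /=; congr (_ + f _).
    by apply: eq_bigr => i _; rewrite /bump /= add1n -(natr1 i) -(natr1 M') opprD addrACA subrr addr0.
  by rewrite /bump /= add1n -natrB; [congr _%:R; lia|lia].
by rewrite [RHS]addrC addrA.
Qed.

Lemma zsum_gaussX (t : R) : zsum (gauss t) M ^+ k =
  \sum_(g : box) expR (- (pi * t) * (box_nrm g)%:R).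
Proof.
rewrite zsum_ord -[in LHS](card_ord k) -prodr_const.
rewrite (bigA_distr_bigA (fun (i : 'I_k) (j : 'I_(M + M).+1) => gauss t (j%:R - M%:R))).
apply: eq_bigr => g _; rewrite /box_nrm natr_sum mulr_sumr expR_sum.
apply: eq_bigr => i _; rewrite /gauss; congr (expR (_ * _)).
have -> : (g i)%:R - M%:R = ((g i : nat)%:Z - M%:Z)%:~R :> R by rewrite rmorphB.
rewrite -rmorphXn /= -[in LHS](gez0_abs (sqr_ge0 _)) abszX.
by [].
Qed.

End Box.

Lemma nb_squares_reps_le k n : (nb_squares_reps k n <= (n + n).+1 ^ k)%N.
Proof.
rewrite -(card_box k (leqnn n)); apply: leq_trans (max_card _) _.
by rewrite card_ffun !card_ord.
Qed.

Lemma nb_squares_reps0 k : nb_squares_reps k 0 = 1%N.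
Proof.
apply/eqP; rewrite eqn_leq; apply/andP; split.
  by have := nb_squares_reps_le k 0; rewrite exp1n.
rewrite -(card_box k (leqnn 0)); apply/card_gt0P.
exists [ffun=> ord0]; rewrite inE /box_nrm; apply/eqP.
by rewrite big1// => i _; rewrite ffunE.
Qed.

(** The [k]-th power of a symmetric partial sum of theta runs over a cube of
    [Z ^ k]; cubes and balls are cofinal in one another and all terms are
    nonnegative, so that the partial sums over balls are squeezed. *)
Lemma theta_power k (t : R) : 0 < t ->
  \sum_(n < N) (nb_squares_reps k n)%:R * expR (- (pi * t) * n%:R) @[N --> \oo]
  --> limn (zsum (gauss t)) ^+ k.
Proof.
move=> t0.
have cvz := zsum_cvg (rapid_gauss t0).
set th := limn (zsum (gauss t)) in cvz *.
pose S N : R := \sum_(n < N) (nb_squares_reps k n)%:R * expR (- (pi * t) * n%:R).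
have Sle N N' : (N <= N')%N -> S N <= S N'.
  move=> NN; rewrite /S -!(big_mkord predT (fun n => (nb_squares_reps k n)%:R * expR (- (pi * t) * n%:R))).
  rewrite (big_cat_nat (leq0n _) NN)//= lerDl sumr_ge0//.
have z0 M : 0 <= zsum (gauss t) M.
  by rewrite addr_ge0 ?gauss_ge0// sumr_ge0// => m _; rewrite addr_ge0 ?gauss_ge0.
have zle M : zsum (gauss t) M <= th.
  apply: nondecreasing_cvgn_le => //.
  apply/nondecreasing_seqP => n; rewrite /zsum lerD2l big_ord_recr /= lerDl.
  by rewrite addr_ge0 ?gauss_ge0.
(* Group the lattice points of a cube by their norm. *)
have grp M (B : nat) : (forall g, box_nrm (k := k) (M := M) g < B)%N ->
   zsum (gauss t) M ^+ k = \sum_(n < B) #|[pred g : {ffun 'I_k -> 'I_(M + M).+1} | box_nrm g == n]|%:R * expR (- (pi * t) * n%:R).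
  move=> hB; rewrite zsum_gaussX.
  rewrite (partition_big (fun g => Ordinal (hB g)) predT)//=.
  apply: eq_bigr => n _.
  rewrite (eq_bigr (fun=> expR (- (pi * t) * n%:R))); last by move=> g /eqP <-.
  rewrite sumr_const mulr_natl; congr (_ *+ _).
(* Large enough to contain the norms in the cube, and at least [M]. *)
have hbB M g : (box_nrm (k := k) (M := M) g < (k * M ^ 2).+1 + M)%N.
  by apply: (@leq_ltn_trans (k * M ^ 2)); [exact: box_nrm_le|lia].
have up N : S N <= th ^+ k.
  apply: (@le_trans _ _ (zsum (gauss t) N ^+ k)); last first.
    by rewrite lerXn2r ?nnegrE// (le_trans (z0 0%N)).
  rewrite (grp N _ (hbB N)).
  rewrite -(big_mkord predT (fun n => #|[pred g : {ffun 'I_k -> 'I_(N + N).+1} | box_nrm g == n]|%:R * expR (- (pi * t) * n%:R))).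
  have NB : (N <= (k * N ^ 2).+1 + N)%N by rewrite leq_addl.
  rewrite (big_cat_nat (leq0n _) NB)//= big_mkord ler_wpDr//.
    by rewrite sumr_ge0// => n _; rewrite mulr_ge0 ?expR_ge0.
  by apply: ler_sum => n _; rewrite card_box// ltnW.
have low M : zsum (gauss t) M ^+ k <= S ((k * M ^ 2).+1 + M)%N.
  rewrite (grp M _ (hbB M)); apply: ler_sum => n _.
  by rewrite ler_wpM2r ?expR_ge0// ler_nat card_box_le.
have cvk : zsum (gauss t) M ^+ k @[M --> \oo] --> th ^+ k.
  suff cvX m : zsum (gauss t) M ^+ m @[M --> \oo] --> th ^+ m by exact: cvX.
  elim: m => [|m IH]; first by under eq_fun do rewrite expr0; exact: cvg_cst.
  by under eq_fun do rewrite exprS; rewrite exprS; apply: cvgM.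
apply/cvgrPdist_le => e e0.
have /cvgrPdist_le /(_ e e0) [M _ hM] := cvk.
have := hM M (leqnn M); rewrite /= ger0_norm; last first.
  by rewrite subr_ge0 lerXn2r ?nnegrE// (le_trans (z0 0%N)).
move=> hMM; exists ((k * M ^ 2).+1 + M)%N => // N /= hN.
rewrite ger0_norm ?subr_ge0; last exact: up.
have := Sle _ _ hN; have := low M; rewrite /S => *; lra.
Qed.

End Squares.

(** * The regularised formula and its limit *)

Section Defect.
Context {R : realType}.
Variable K : nat.
Implicit Types (f g h phi : R -> R) (a c t s x y xi C : R).
Local Notation k := (2 * K + 3)%N.

Definition reps (n : nat) : R := (nb_squares_reps k n)%:R.

Lemma reps_ge0 n : 0 <= reps n. Proof. by []. Qed.

(** The crude polynomial bound on the number of representations, stated with the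
    weight at [sqrt n] because [reps n] always multiplies a quantity estimated
    there. *)
Lemma reps_weight n : n.+1%:R ^+ 2 * reps n <= 2 ^+ k * weight (Num.sqrt n%:R) ^+ (2 * k + 4).
Proof.
set w := weight _.
have w2 : n.+1%:R <= w ^+ 2.
  rewrite /w /weight ger0_norm ?sqrtr_ge0// sqrrD sqr_sqrtr// expr1n mul1r.
  by have := sqrtr_ge0 (n%:R : R); rewrite -natr1; lra.
have r1 : reps n <= 2 ^+ k * n.+1%:R ^+ k.
  rewrite /reps -exprMn -natrM -natrX ler_nat.
  by apply: leq_trans (nb_squares_reps_le _ _) _; rewrite leq_exp2r; lia.
apply: (@le_trans _ _ (n.+1%:R ^+ 2 * (2 ^+ k * n.+1%:R ^+ k))).
  by rewrite ler_wpM2l// exprn_ge0.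
rewrite mulrCA ler_wpM2l ?exprn_ge0// -exprD.
have -> : (2 * k + 4 = 2 * (2 + k))%N by lia.
by rewrite exprM lerXn2r ?nnegrE// exprn_ge0// weight_ge0.
Qed.

Lemma reps_decay n (X C : R) : weight (Num.sqrt n%:R) ^+ (2 * k + 4) * `|X| <= C ->
  `|reps n * X| <= 2 ^+ k * C / n.+1%:R ^+ 2.
Proof.
move=> hX; have n0 : 0 < n.+1%:R ^+ 2 :> R by rewrite exprn_gt0// ltr0n.
rewrite ler_pdivlMr// mulrC normrM (ger0_norm (reps_ge0 n)) mulrA.
apply: (le_trans (ler_wpM2r (normr_ge0 X) (reps_weight n))).
by rewrite -mulrA ler_wpM2l// exprn_ge0.
Qed.

Lemma sqrt_nat_ge1 n : (0 < n)%N -> 1 <= Num.sqrt n%:R :> R.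
Proof. by move=> n0; rewrite -[leLHS]sqrtr1 ler_sqrt// ler1n. Qed.

(** The regularised dual side, up to the factor [gauss (s ^ 2)]: mollification
    multiplies the sine transform by this Gaussian [G], the operator
    [D = - (2 pi xi)^-1 * d / d xi] maps [G] to [s ^ 2 * G], and the Leibniz rule
    for the [K]-th power of [D] gives the binomial sum. *)
Definition radial_reg s phi xi : R :=
  \sum_(i < K.+1) 'C(K, i)%:R * (s ^+ 2) ^+ i * radial (K - i) phi xi.

Definition radial0_reg s phi : R :=
  \sum_(i < K.+1) 'C(K, i)%:R * (s ^+ 2) ^+ i * radial0 (K - i) phi.

(** The [n]-th term of the regularised formula, primal minus dual side; index
    [0] collects the terms at the origin. *)
Definition defect s phi (n : nat) : R :=
  if n == 0%N then mollify0 s phi - radial0_reg s phi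
  else reps n * (mollify s phi (Num.sqrt n%:R) / Num.sqrt n%:R
                 - gauss (s ^+ 2) (Num.sqrt n%:R) * radial_reg s phi (Num.sqrt n%:R)).

Lemma defect_lin s f g c n : rapid f -> rapid g ->
  defect s (fun y => f y + c * g y) n = defect s f n + c * defect s g n.
Proof.
move=> rf rg; rewrite /defect; case: ifP => _.
  rewrite mollify0_lin//.
  have -> : radial0_reg s (fun y => f y + c * g y) = radial0_reg s f + c * radial0_reg s g.
    rewrite /radial0_reg mulr_sumr -big_split /=; apply: eq_bigr => i _.
    by rewrite radial0_lin//; ring.
  by ring.
rewrite mollify_lin//.
have -> : radial_reg s (fun y => f y + c * g y) (Num.sqrt n%:R) =
    radial_reg s f (Num.sqrt n%:R) + c * radial_reg s g (Num.sqrt n%:R).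
  rewrite /radial_reg mulr_sumr -big_split /=; apply: eq_bigr => i _.
  by rewrite radial_lin//; ring.
by ring.
Qed.

Lemma gauss_sqrt_nat t n : gauss t (Num.sqrt n%:R) = expR (- (pi * t) * n%:R) :> R.
Proof. by rewrite /gauss sqr_sqrtr. Qed.

Lemma gaussD a t x : gauss a x * gauss t x = gauss (a + t) x.
Proof. by rewrite /gauss -expRD; congr expR; ring. Qed.

(** With [tau = 1 / t + s ^ 2] the binomial sums collapse to [tau ^ K], and the
    two sides are multiples of the generating functions of [reps] at [1 / tau]
    and at [tau].  The functional equation of theta makes them agree. *)
Lemma defect_ogauss s t : 0 < s -> 0 < t ->
  \sum_(n < N) defect s (ogauss t) n @[N --> \oo] --> 0.
Proof.
move=> s0 t0; pose a := 1 + t * s ^+ 2; pose tau := t^-1 + s ^+ 2.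
have s20 : 0 < s ^+ 2 by rewrite exprn_gt0.
have a0 : 0 < a by rewrite addr_gt0// mulr_gt0.
have tau0 : 0 < tau by rewrite addr_gt0// invr_gt0.
have tauV0 : 0 < tau^-1 by rewrite invr_gt0.
have atau : a = t * tau by rewrite /a /tau mulrDr mulfV ?gt_eqF.
have taE : t / a = tau^-1 by rewrite atau invfM mulrA mulfV ?mul1r ?gt_eqF.
have binom : \sum_(i < K.+1) 'C(K, i)%:R * (s ^+ 2) ^+ i * (t * Num.sqrt t * t ^+ (K - i))^-1 =
    (t * Num.sqrt t)^-1 * tau ^+ K.
  rewrite /tau exprDn mulr_sumr; apply: eq_bigr => i _.
  by rewrite invfM -mulr_natl exprVn; ring.
pose E u (n : nat) : R := reps n * expR (- (pi * u) * n%:R).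
have dE n : defect s (ogauss t) n =
   (a * Num.sqrt a)^-1 * E tau^-1 n - (t * Num.sqrt t)^-1 * tau ^+ K * E tau n.
  rewrite /defect; case: eqP => [->|/eqP n0].
    rewrite mollify0_ogauss// /radial0_reg.
    under eq_bigr do rewrite radial0_ogauss//.
    by rewrite -/a binom /E /reps nb_squares_reps0 !mulr0n !mulr0 expR0 !mulr1.
  have sn0 : 0 < Num.sqrt n%:R :> R by rewrite sqrtr_gt0 ltr0n lt0n.
  rewrite mollify_ogauss// -/a taE /ogauss.
  have -> : radial_reg s (ogauss t) (Num.sqrt n%:R) =
     (t * Num.sqrt t)^-1 * tau ^+ K * gauss t^-1 (Num.sqrt n%:R).
    rewrite /radial_reg -binom mulr_suml; apply: eq_bigr => i _.
    by rewrite radial_ogauss// mulrA.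
  have -> : gauss (s ^+ 2) (Num.sqrt n%:R) * ((t * Num.sqrt t)^-1 * tau ^+ K * gauss t^-1 (Num.sqrt n%:R))
     = (t * Num.sqrt t)^-1 * tau ^+ K * expR (- (pi * tau) * n%:R).
    by rewrite mulrCA gaussD gauss_sqrt_nat addrC.
  rewrite gauss_sqrt_nat /E.
  have -> : (a * Num.sqrt a)^-1 * (Num.sqrt n%:R * expR (- (pi / tau) * n%:R)) / Num.sqrt n%:R
    = (a * Num.sqrt a)^-1 * expR (- (pi / tau) * n%:R).
    by rewrite mulrCA mulrAC mulfV ?mul1r// gt_eqF.
  by ring.
have -> : (fun N : nat => \sum_(n < N) defect s (ogauss t) n) = (fun N =>
    (a * Num.sqrt a)^-1 * (\sum_(n < N) E tau^-1 n) - (t * Num.sqrt t)^-1 * tau ^+ K * (\sum_(n < N) E tau n)).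
  by apply/funext => N; rewrite !mulr_sumr -sumrB; apply: eq_bigr => n _; exact: dE.
have c1 := @theta_power R k _ tauV0; have c2 := @theta_power R k _ tau0.
rewrite (theta_functional_equation tau0) in c2.
set Z := limn (zsum (gauss tau^-1)) in c1 c2.
have lim0 : (a * Num.sqrt a)^-1 * Z ^+ k
    - (t * Num.sqrt t)^-1 * tau ^+ K * ((Num.sqrt tau)^-1 * Z) ^+ k = 0.
  have q0 : Num.sqrt tau != 0 by rewrite gt_eqF// sqrtr_gt0.
  have sa : Num.sqrt a = Num.sqrt t * Num.sqrt tau by rewrite atau sqrtrM// ltW.
  have tauq : tau = Num.sqrt tau ^+ 2 by rewrite sqr_sqrtr// ltW.
  have p0 : Num.sqrt t != 0 by rewrite gt_eqF// sqrtr_gt0.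
  have tn0 : t != 0 by rewrite gt_eqF.
  rewrite sa atau (_ : tau ^+ K = Num.sqrt tau ^+ (2 * K)); last by rewrite exprM -tauq.
  rewrite (_ : t * tau = t * Num.sqrt tau ^+ 2); last by rewrite -tauq.
  move: (Num.sqrt tau) q0 => q q0.
  rewrite exprMn exprVn (exprD q (2 * K) 3); move: (q ^+ (2 * K)) (expf_neq0 (2 * K) q0) => Q Q0.
  by move: (Num.sqrt t) p0 => r r0; field; rewrite q0 Q0 r0 tn0.
suff : (a * Num.sqrt a)^-1 * (\sum_(n < N) E tau^-1 n) -
    (t * Num.sqrt t)^-1 * tau ^+ K * (\sum_(n < N) E tau n) @[N --> \oo] -->
    (a * Num.sqrt a)^-1 * Z ^+ k
    - (t * Num.sqrt t)^-1 * tau ^+ K * ((Num.sqrt tau)^-1 * Z) ^+ k by rewrite lim0.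
by apply: cvgB; (apply: cvgM; [exact: cvg_cst|]); [exact: c1|exact: c2].
Qed.

(** The factor [gauss (s ^ 2)] makes the dual side summable using nothing but the
    size of [phi]; the constant blows up as [s] tends to [0]. *)
Lemma defect_le s : 0 < s <= 1 -> exists2 D, 0 <= D & forall phi C, rapid phi ->
  (forall y, weight y ^+ (2 * k + 4) * `|phi y| <= C) ->
  forall n, `|defect s phi n| <= D * C / n.+1%:R ^+ 2.
Proof.
have le3 i : (2 * (K - i) + 3 <= 2 * k + 4)%N by lia.
have le2 i : (K - i + 2 <= 2 * k + 4)%N by lia.
move=> /andP[s0 s1]; have s01 : 0 <= s <= 1 by rewrite ltW.
have p0 : 0 <= 2 * pi :> R by rewrite mulr_ge0 ?pi_ge0.
have [G G0 hG] := rapid_gt0 (2 * k + 4) (rapid_gauss (exprn_gt0 2 s0)).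
have /choice[D0 hD0] : forall i : nat, exists D : R, 0 <= D /\ forall phi C, rapid phi ->
   (forall y, weight y ^+ (2 * i + 3) * `|phi y| <= C) -> `|radial0 i phi| <= D * C.
  by move=> i; have [D D0 hD] := @normr_radial0_le R i; exists D.
have /choice[D1 hD1] : forall i : nat, exists D : R, 0 <= D /\ forall phi C xi, rapid phi ->
   (forall y, weight y ^+ (i + 2) * `|phi y| <= C) -> 1 <= xi -> `|radial i phi xi| <= D * C.
  by move=> i; have [D D0' hD] := @normr_radial_le R i; exists D.
have cf i : 0 <= 'C(K, i)%:R * (s ^+ 2) ^+ i by rewrite mulr_ge0// exprn_ge0// sqr_ge0.
pose B0 := \sum_(i < K.+1) 'C(K, i)%:R * (s ^+ 2) ^+ i * D0 (K - i)%N.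
pose B1 := \sum_(i < K.+1) 'C(K, i)%:R * (s ^+ 2) ^+ i * D1 (K - i)%N.
have B0_ge0 : 0 <= B0.
  by apply: sumr_ge0 => i _; exact: mulr_ge0 (cf i) (hD0 _).1.
have B1_ge0 : 0 <= B1.
  by apply: sumr_ge0 => i _; exact: mulr_ge0 (cf i) (hD1 _).1.
pose M0 := s^-1 * (2 * pi) * gauss_moment 1.
have M0_ge0 : 0 <= M0 by rewrite !mulr_ge0 ?gauss_moment_ge0 ?invr_ge0 ?(ltW s0) ?pi_ge0.
pose M1 := 2 ^+ k * (gauss_moment (2 * k + 4) + G * B1).
have M1_ge0 : 0 <= M1.
  by rewrite mulr_ge0 ?exprn_ge0// addr_ge0 ?gauss_moment_ge0 ?mulr_ge0 ?(ltW G0).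
exists (M0 + B0 + M1); first by rewrite !addr_ge0.
move=> phi C rphi hC n.
have C0 : 0 <= C by apply: le_trans (hC 0); rewrite mulr_ge0 ?exprn_ge0 ?weight_ge0.
have hle (A : nat) : (A <= 2 * k + 4)%N -> forall y, weight y ^+ A * `|phi y| <= C.
  by move=> hA y; apply: le_trans (hC y); rewrite ler_wpM2r// weight_expr_le.
rewrite /defect; case: eqP => [->|/eqP n0].
  rewrite expr1n divr1.
  have h1 : `|mollify0 s phi| <= C * M0.
    by apply: mollify0_le => // y; have := hle 0%N isT y; rewrite expr0 mul1r.
  have h2 : `|radial0_reg s phi| <= B0 * C.
    rewrite /B0 mulr_suml; apply: (le_trans (ler_norm_sum _ _ _)); apply: ler_sum => i _.
    rewrite normrM (ger0_norm (cf i)) -[leRHS]mulrA.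
    rewrite ler_wpM2l//.
    by apply: (hD0 _).2 => //; exact: hle (le3 i).
  apply: (le_trans (ler_normB _ _)); rewrite [leRHS]mulrDl [(M0 + B0) * C]mulrDl.
  have := mulr_ge0 M1_ge0 C0; rewrite (mulrC M0); lra.
have n1 := sqrt_nat_ge1 (n := n); rewrite lt0n in n1; have {}n1 := n1 n0.
set xi := Num.sqrt n%:R in n1 *.
have xi0 : 0 < xi by rewrite (lt_le_trans ltr01).
apply: (@le_trans _ _ (2 ^+ k * (C * gauss_moment (2 * k + 4) + G * (B1 * C)) / n.+1%:R ^+ 2)).
  apply: reps_decay.
  have W0 : 0 <= weight xi ^+ (2 * k + 4) by rewrite exprn_ge0 ?weight_ge0.
  apply: (le_trans (ler_wpM2l W0 (ler_normB _ _))); rewrite mulrDr lerD//.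
    apply: le_trans (mollify_le xi s01 rphi hC); rewrite ler_wpM2l//.
    rewrite normf_div ler_pdivrMr ?normr_gt0 ?gt_eqF// ler_peMr//.
    by apply: le_trans n1 (ler_norm _).
  rewrite normrM mulrA; apply: ler_pM => //; first by rewrite mulr_ge0.
  rewrite /B1 mulr_suml; apply: (le_trans (ler_norm_sum _ _ _)); apply: ler_sum => i _.
  rewrite normrM (ger0_norm (cf i)) -[leRHS]mulrA.
  rewrite ler_wpM2l//.
  by apply: (hD1 _).2 => //; exact: hle (le2 i).
rewrite ler_wpM2r ?invr_ge0 ?exprn_ge0//.
rewrite [leRHS]mulrDl (_ : 2 ^+ k * _ = M1 * C); last by rewrite /M1; ring.
by rewrite lerDr mulr_ge0// addr_ge0.
Qed.

(** By [defect_le] the total defect is continuous for a weighted supremum norm,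
    and it vanishes on the odd Gaussians, which are dense by
    [odd_gauss_approx]. *)
Lemma defect_sum s phi : 0 < s <= 1 -> rapid phi -> (forall y, phi (- y) = - phi y) ->
  \sum_(n < N) defect s phi n @[N --> \oo] --> 0.
Proof.
move=> s01 rphi ophi; have /andP[s0 s1] := s01.
have [D D0 hD] := defect_le s01.
apply/cvgrPdist_le => e e0.
pose d := e / 2 / (2 * D + 1).
have D1 : 0 < 2 * D + 1 by lra.
have d0 : 0 < d by rewrite !divr_gt0.
have [p hp] := odd_gauss_approx (2 * k + 4) rphi ophi d0.
(* [gauss 1 y * gauss 1 y ^ j = gauss j.+1 y], so the approximant is a
   combination of odd Gaussians. *)
pose q (m : nat) y := \sum_(j < m) p`_j * ogauss j.+1%:R y.
have rq m : rapid (q m).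
  apply: (@rapid_sum R m (fun j y => p`_j * ogauss j.+1%:R y)) => j.
  by apply: rapidZ; apply: rapid_ogauss; rewrite ltr0n.
have cq m : \sum_(n < N) defect s (q m) n @[N --> \oo] --> 0.
  elim: m => [|m IH].
    have z n : defect s (q 0%N) n = 0.
      have := hD (q 0%N) 0 (rq 0%N) _ n; rewrite mulr0 mul0r normr_le0 => H.
      by apply/eqP/H => y; rewrite /q big_ord0 normr0 mulr0.
    under eq_fun do rewrite big1 ?z//.
    exact: cvg_cst.
  have -> : q m.+1 = fun y => q m y + p`_m * ogauss m.+1%:R y.
    by apply/funext => y; rewrite /q big_ord_recr.
  have m0 : 0 < m.+1%:R :> R by rewrite ltr0n.
  have -> : (fun N : nat => \sum_(n < N) defect s (fun y => q m y + p`_m * ogauss m.+1%:R y) n) =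
    (fun N => \sum_(n < N) defect s (q m) n + p`_m * \sum_(n < N) defect s (ogauss m.+1%:R) n).
    apply/funext => N; rewrite mulr_sumr -big_split /=; apply: eq_bigr => n _.
    by apply: defect_lin => //; exact: rapid_ogauss.
  have c1 : p`_m * \sum_(n < N) defect s (ogauss m.+1%:R) n @[N --> \oo] --> p`_m * 0.
    by apply: cvgM; [exact: cvg_cst|exact: defect_ogauss].
  suff : \sum_(n < N) defect s (q m) n + p`_m * \sum_(n < N) defect s (ogauss m.+1%:R) n
      @[N --> \oo] --> 0 + p`_m * 0 by rewrite mulr0 addr0.
  by apply: cvgD; [exact: IH|exact: c1].
have qE y : q (size p) y = y * gauss 1 y * p.[gauss 1 y].
  rewrite horner_coef mulr_sumr /q; apply: eq_bigr => j _.
  have gE : gauss j.+1%:R y = gauss 1 y * gauss 1 y ^+ j.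
    by rewrite -exprS /gauss -expRM_natr; congr expR; ring.
  by rewrite /ogauss gE; ring.
have e20 : 0 < e / 2 by rewrite divr_gt0.
have /cvgrPdist_le /(_ _ e20) [N0 _ hN0] := cq (size p).
exists N0 => // N /= hN; have := hN0 N hN; rewrite /= !sub0r !normrN => h1.
pose r y := phi y + (-1) * q (size p) y.
have rr : rapid r by apply: rapidD => //; exact: rapidZ.
have h2 : `|\sum_(n < N) defect s r n| <= 2 * (D * d).
  apply: normr_sum_inv_sqr_le => n; apply: hD => // y.
  by rewrite /r mulN1r qE.
have -> : \sum_(n < N) defect s phi n = \sum_(n < N) defect s r n + \sum_(n < N) defect s (q (size p)) n.
  rewrite -big_split /=; apply: eq_bigr => n _.
  by rewrite /r defect_lin//; ring.
apply: (le_trans (ler_normD _ _)).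
have : 2 * (D * d) <= e / 2.
  have -> : 2 * (D * d) = e / 2 * (2 * D / (2 * D + 1)) by rewrite /d; field; rewrite gt_eqF.
  rewrite ler_piMr ?(ltW e20)// ler_pdivrMr//; lra.
lra.
Qed.

(** The formal limit of [defect s phi n] as [s] tends to [0]. *)
Definition limit_defect phi phi' (n : nat) : R :=
  if n == 0%N then phi' 0 - radial0 K phi
  else reps n * (phi (Num.sqrt n%:R) / Num.sqrt n%:R - radial K phi (Num.sqrt n%:R)).

End Defect.

Section SmoothRapid.
Context {R : realType}.
Implicit Types (f g h phi : R -> R) (a c t s x y xi C : R).

(** A real Schwartz function, given with the sequence of its derivatives. *)
Definition smooth_rapid f := exists2 F : nat -> R -> R, F 0%N = f &
  forall n, rapid (F n) /\ forall x, is_derive x 1 (F n) (F n.+1 x).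

Lemma smooth_rapid_rapid f : smooth_rapid f -> rapid f.
Proof. by move=> [F <- hF]; have [] := hF 0%N. Qed.

Lemma smooth_rapid_derive f : smooth_rapid f ->
  exists2 f', smooth_rapid f' & forall x, is_derive x 1 f (f' x).
Proof.
move=> [F <- hF]; exists (F 1%N); last by have [] := hF 0%N.
by exists (fun n => F n.+1) => // n; exact: hF.
Qed.

Lemma smooth_rapidM f c : smooth_rapid f -> smooth_rapid (fun y => f y * (c * y)).
Proof.
move=> [F F0 hF]; exists (fun n y => F n y * (c * y) + n%:R * c * F n.-1 y).
  by apply/funext => y; rewrite F0 !mul0r addr0.
move=> n; split.
  apply: rapidD; last by apply: rapidZ; have [] := hF n.-1.
  by apply: rapidM; [have [] := hF n|apply: slowM; [exact: slow_cst|exact: slow_id]].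
move=> x.
have d1 := is_derive_mull c x.
have d2 := is_deriveM ((hF n).2 x) d1.
have d3 := is_deriveZ (n%:R * c) ((hF n.-1).2 x).
apply: is_derive_eq; rewrite /GRing.scale /=.
case: n {d1 d2 d3} => [|n] /=; first by rewrite !mul0r addr0 mul1r; ring.
by rewrite -(natr1 n.+1); ring.
Qed.

Lemma smooth_rapid_exp f c j : smooth_rapid f -> smooth_rapid (fun y => f y * (c * y) ^+ j).
Proof.
move=> sf; elim: j => [|j IH].
  by under eq_fun do rewrite expr0 mulr1.
by under eq_fun do rewrite exprSr mulrA; exact: smooth_rapidM.
Qed.

(** Each integration by parts gains a factor [(2 pi xi)^-1]. *)
Lemma sintr_decay M : forall g, smooth_rapid g -> forall j, exists C, forall xi, 1 <= xi ->
  weight xi ^+ M * `|sintr g j xi| <= C.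
Proof.
elim: M => [|M IH] g sg j.
  have [cg hg] := smooth_rapid_rapid sg.
  have [C hC] := hg 2%N.
  exists (C * 1 * lorentz_mass) => xi _; rewrite expr0 mul1r.
  apply: (Rintegral_weight_le (A := 0%N)) => //.
  - exact: slow_dsin.
  - by move=> y; rewrite expr0 mulr1 normr_dsin.
have [g' sg' dg] := smooth_rapid_derive sg.
have [C hC] := IH g' sg' j.+1.
exists C => xi xi1; have := hC xi xi1.
rewrite -(sintr_by_parts j xi (smooth_rapid_rapid sg) (smooth_rapid_rapid sg') dg).
apply: le_trans; rewrite exprSr -mulrA ler_wpM2l ?exprn_ge0 ?weight_ge0//.
rewrite normrM ler_wpM2r//.
have xi0 : 0 <= xi by lra.
rewrite ger0_norm ?mulr_ge0 ?pi_ge0// /weight ger0_norm//.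
have := pi_ge2 R; nra.
Qed.

Lemma dsintr_decay phi j M : smooth_rapid phi -> exists C, forall xi, 1 <= xi ->
  weight xi ^+ M * `|dsintr phi j xi| <= C.
Proof. by move=> sphi; apply: sintr_decay; exact: smooth_rapid_exp. Qed.

Lemma radial_decay phi i M : smooth_rapid phi -> exists C, forall xi, 1 <= xi ->
  weight xi ^+ M * `|radial i phi xi| <= C.
Proof.
move=> sphi.
have /choice[C hC] : forall j, exists C, forall xi, 1 <= xi -> weight xi ^+ M * `|dsintr phi j xi| <= C.
  by move=> j; exact: dsintr_decay.
have p0 : 0 <= (2 * pi) ^- i :> R by rewrite invr_ge0 exprn_ge0// mulr_ge0// pi_ge0.
exists ((2 * pi) ^- i * \sum_(j < i.+1) `|bcoef i j| * C j) => xi xi1.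
rewrite /radial normrM (ger0_norm p0) mulrCA ler_wpM2l//.
have w0 : 0 <= weight xi ^+ M by rewrite exprn_ge0// weight_ge0.
apply: (le_trans (ler_wpM2l w0 (ler_norm_sum _ _ _))); rewrite mulr_sumr.
apply: ler_sum => j _; rewrite !normrM -mulrA mulrCA ler_wpM2l//.
apply: le_trans (hC j xi xi1); rewrite ler_wpM2l// ler_piMl//.
have xi0 : 0 < xi by rewrite (lt_le_trans ltr01).
by rewrite ger0_norm ?exprn_ge0 ?invr_ge0 ?(ltW xi0)// exprn_ile1 ?invr_ge0 ?(ltW xi0)// invf_le1.
Qed.

Variable K : nat.
Local Notation k := (2 * K + 3)%N.

Lemma direct_term_decay phi : smooth_rapid phi -> exists C, forall n, (0 < n)%N ->
  `|reps K n * (phi (Num.sqrt n%:R) / Num.sqrt n%:R)| <= C / n.+1%:R ^+ 2.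
Proof.
move=> sphi; have [C hC] := (smooth_rapid_rapid sphi).2 (2 * k + 4)%N.
exists (2 ^+ k * C) => n n0; apply: reps_decay.
apply: le_trans (hC (Num.sqrt n%:R)); rewrite ler_wpM2l ?exprn_ge0 ?weight_ge0//.
have n1 := @sqrt_nat_ge1 R n n0.
rewrite normf_div ler_pdivrMr ?normr_gt0 ?gt_eqF ?(lt_le_trans ltr01 n1)// ler_peMr//.
by apply: le_trans n1 (ler_norm _).
Qed.

Lemma dual_term_decay phi i : smooth_rapid phi -> exists C, forall n, (0 < n)%N ->
  `|reps K n * radial i phi (Num.sqrt n%:R)| <= C / n.+1%:R ^+ 2.
Proof.
move=> sphi; have [C hC] := radial_decay i (2 * k + 4) sphi.
exists (2 ^+ k * C) => n n0; apply: reps_decay; apply: hC.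
exact: sqrt_nat_ge1.
Qed.

(** Mollification converges at rate [s], the binomial terms of positive index
    carry a power of [s ^ 2], and [1 - gauss (s ^ 2) xi <= pi * s ^ 2 * xi ^ 2];
    the powers of [xi] are absorbed by the decay of the radial
    transforms of a Schwartz function. *)
Lemma defect_rate phi phi' : smooth_rapid phi -> phi 0 = 0 ->
  (forall x, is_derive x 1 phi (phi' x)) -> exists D, forall s n, 0 < s <= 1 ->
  `|defect K s phi n - limit_defect K phi phi' n| <= s * D / n.+1%:R ^+ 2.
Proof.
move=> sphi phi0 dphi.
have rphi := smooth_rapid_rapid sphi.
have [f1 sf1 df1] := smooth_rapid_derive sphi.
have f1E : f1 = phi'.
  by apply/funext => x; rewrite -(@derive_val _ _ _ _ _ _ _ (df1 x)) (@derive_val _ _ _ _ _ _ _ (dphi x)).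
rewrite {f1 df1}f1E in sf1.
have [phi'' sf2 dphi'] := smooth_rapid_derive sf1.
have [C2 hC2] := (smooth_rapid_rapid sf2).2 0%N.
have [C1 C10 hC1] := rapid_gt0 (2 * k + 4) (smooth_rapid_rapid sf1).
have /choice[E hE] : forall i, exists C, forall xi : R, 1 <= xi ->
    weight xi ^+ (2 * k + 6) * `|radial i phi xi| <= C.
  by move=> i; exact: radial_decay.
have p0 : 0 <= 2 * pi :> R by rewrite mulr_ge0 ?pi_ge0.
have e6 : (2 * k + 6 = (2 * k + 4) + 2)%N by rewrite -addnA.
pose D0 := `|C2 * (2 * pi) * gauss_moment 3| + \sum_(i < K) `|'C(K, i.+1)%:R * radial0 (K - i.+1) phi|.
pose D1 := 2 ^+ k * (C1 * gauss_moment (2 * k + 4).+1 + (pi * E K + \sum_(i < K) 'C(K, i.+1)%:R * E (K - i.+1)%N)).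
exists (`|D0| + `|D1|) => s n /andP[s0 s1].
have s01 : 0 <= s <= 1 by rewrite ltW.
have spow i : (s ^+ 2) ^+ i.+1 <= s.
  rewrite -exprM mulnS exprD -[leRHS]mulr1 ler_pM ?exprn_ge0 ?(ltW s0)//.
    by rewrite expr2 ler_piMr// ltW.
  by rewrite exprn_ile1// ltW.
have spow0 i : 0 <= (s ^+ 2) ^+ i.+1 by rewrite exprn_ge0// exprn_ge0// ltW.
rewrite /defect /limit_defect; case: eqP => [->|/eqP n0].
  rewrite expr1n divr1.
  have -> : radial0_reg K s phi = radial0 K phi + \sum_(i < K) 'C(K, i.+1)%:R * (s ^+ 2) ^+ i.+1 * radial0 (K - i.+1) phi.
    by rewrite /radial0_reg big_ord_recl /= bin0 expr0 !mul1r subn0.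
  rewrite opprD addrA [X in `|X|](_ : _ = (mollify0 s phi - phi' 0) - \sum_(i < K) 'C(K, i.+1)%:R * (s ^+ 2) ^+ i.+1 * radial0 (K - i.+1) phi); last by ring.
  have h1 : `|mollify0 s phi - phi' 0| <= s * `|C2 * (2 * pi) * gauss_moment 3|.
    apply: le_trans (@mollify0_rate _ s phi phi' phi'' C2 _ rphi phi0 dphi dphi' _) _.
    - by rewrite s0.
    - by move=> y; have := hC2 y; rewrite expr0 mul1r.
    - by rewrite ler_wpM2l ?(ltW s0)// ler_norm.
  have h2 : `|\sum_(i < K) 'C(K, i.+1)%:R * (s ^+ 2) ^+ i.+1 * radial0 (K - i.+1) phi| <=
     s * \sum_(i < K) `|'C(K, i.+1)%:R * radial0 (K - i.+1) phi|.
    apply: (le_trans (ler_norm_sum _ _ _)); rewrite mulr_sumr; apply: ler_sum => i _.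
    by rewrite mulrAC mulrC normrM (ger0_norm (spow0 i)) ler_wpM2r.
  apply: (le_trans (ler_normB _ _)); rewrite mulrDr.
  have h3 : s * D0 <= s * `|D0| by rewrite ler_wpM2l ?(ltW s0)// ler_norm.
  have h4 : 0 <= s * `|D1| by rewrite mulr_ge0// ltW.
  by rewrite /D0 mulrDr in h3; lra.
have n1 := @sqrt_nat_ge1 R n; rewrite lt0n in n1; have {}n1 := n1 n0.
set xi := Num.sqrt n%:R in n1 *.
have xi0 : 0 < xi by rewrite (lt_le_trans ltr01).
have wW A : 0 <= weight xi ^+ A by rewrite exprn_ge0 ?weight_ge0.
have -> : radial_reg K s phi xi = radial K phi xi + \sum_(i < K) 'C(K, i.+1)%:R * (s ^+ 2) ^+ i.+1 * radial (K - i.+1) phi xi.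
  by rewrite /radial_reg big_ord_recl /= bin0 expr0 !mul1r subn0.
set B := \sum_(i < K) _; set G := gauss (s ^+ 2) xi.
rewrite -mulrBr [X in reps K n * X](_ : _ = (mollify s phi xi - phi xi) / xi + ((1 - G) * radial K phi xi - G * B)); last by ring.
have G1 : 0 <= 1 - G by rewrite subr_ge0 gauss_le1// exprn_ge0// ltW.
have Gle : 1 - G <= s * pi * weight xi ^+ 2.
  have h : 1 + (- (pi * s ^+ 2) * xi ^+ 2) <= G by exact: expR_ge1Dx.
  have h2 : pi * s ^+ 2 * xi ^+ 2 <= s * pi * weight xi ^+ 2.
    have pi0 := pi_ge0 R.
    have q1 : s ^+ 2 * pi <= s * pi by rewrite ler_wpM2r// expr2 ler_piMr// ltW.
    have q2 : xi ^+ 2 <= weight xi ^+ 2.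
      rewrite lerXn2r ?nnegrE ?weight_ge0 ?(ltW xi0)//.
      by rewrite /weight ger0_norm ?(ltW xi0)// lerDr.
    by rewrite (mulrC pi); apply: ler_pM => //; [rewrite mulr_ge0// sqr_ge0|exact: sqr_ge0].
  lra.
have E1 i : weight xi ^+ (2 * k + 4) * `|radial i phi xi| <= E i.
  apply: le_trans (hE i xi n1); rewrite ler_wpM2r// weight_expr_le//.
  by rewrite leq_add2l.
have t1 : weight xi ^+ (2 * k + 4) * `|(mollify s phi xi - phi xi) / xi| <= s * C1 * gauss_moment (2 * k + 4).+1.
  apply: le_trans (mollify_rate xi s01 rphi dphi hC1); rewrite ler_wpM2l//.
  rewrite normf_div ler_pdivrMr ?normr_gt0 ?gt_eqF// ler_peMr//.
  by apply: le_trans n1 (ler_norm _).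
have t2 : weight xi ^+ (2 * k + 4) * `|(1 - G) * radial K phi xi| <= s * (pi * E K).
  rewrite normrM (ger0_norm G1).
  apply: (@le_trans _ _ (weight xi ^+ (2 * k + 4) * (s * pi * weight xi ^+ 2 * `|radial K phi xi|))).
    by rewrite ler_wpM2l// ler_wpM2r.
  rewrite mulrA [leRHS]mulrA.
  have -> : weight xi ^+ (2 * k + 4) * (s * pi * weight xi ^+ 2) * `|radial K phi xi| =
     s * pi * (weight xi ^+ (2 * k + 6) * `|radial K phi xi|).
    by rewrite e6 (exprD _ (2 * k + 4) 2); ring.
  by rewrite ler_wpM2l ?mulr_ge0 ?(ltW s0) ?pi_ge0// hE.
have t3 : weight xi ^+ (2 * k + 4) * `|G * B| <= s * \sum_(i < K) 'C(K, i.+1)%:R * E (K - i.+1)%N.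
  apply: (@le_trans _ _ (weight xi ^+ (2 * k + 4) * `|B|)).
    by rewrite ler_wpM2l// normrM ler_piMl// ger0_norm ?gauss_ge0// gauss_le1// exprn_ge0// ltW.
  apply: (le_trans (ler_wpM2l (wW _) (ler_norm_sum _ _ _))); rewrite !mulr_sumr.
  apply: ler_sum => i _; rewrite normrM (ger0_norm (mulr_ge0 _ (spow0 i)))//.
  have -> : weight xi ^+ (2 * k + 4) * ('C(K, i.+1)%:R * s ^+ 2 ^+ i.+1 * `|radial (K - i.+1) phi xi|)
    = s ^+ 2 ^+ i.+1 * ('C(K, i.+1)%:R * (weight xi ^+ (2 * k + 4) * `|radial (K - i.+1) phi xi|)) by ring.
  by rewrite ler_pM ?mulr_ge0// ler_wpM2l.
have tot : weight xi ^+ (2 * k + 4) * `|(mollify s phi xi - phi xi) / xi + ((1 - G) * radial K phi xi - G * B)|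
   <= s * (C1 * gauss_moment (2 * k + 4).+1 + (pi * E K + \sum_(i < K) 'C(K, i.+1)%:R * E (K - i.+1)%N)).
  apply: (le_trans (ler_wpM2l (wW _) (ler_normD _ _))).
  have h := ler_wpM2l (wW (2 * k + 4)%N) (ler_normB ((1 - G) * radial K phi xi) (G * B)).
  by rewrite !mulrDr in h *; lra.
apply: (le_trans (reps_decay tot)).
rewrite ler_wpM2r ?invr_ge0 ?exprn_ge0// mulrCA -/D1 ler_wpM2l ?(ltW s0)//.
by apply: le_trans (ler_norm _) _; rewrite lerDr.
Qed.

(** The bound of [defect_rate] is summable in [n] and uniform, so that a partial
    sum is within [2 s D] of the corresponding regularised one. *)
Lemma limit_defect_sum phi phi' : smooth_rapid phi -> (forall y, phi (- y) = - phi y) ->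
  (forall x, is_derive x 1 phi (phi' x)) ->
  \sum_(n < N) limit_defect K phi phi' n @[N --> \oo] --> 0.
Proof.
move=> sphi ophi dphi.
have phi0 : phi 0 = 0.
  by have := ophi 0; rewrite oppr0 => /eqP; rewrite -addr_eq0 -mulr2n mulrn_eq0/= => /eqP.
have [D hD] := defect_rate sphi phi0 dphi.
apply/cvgrPdist_le => e e0.
(* [s] makes the total error below [e / 2]; the [+ 1] keeps the quotient
   defined when [D = 0]. *)
pose s := Num.min 1 (e / 2 / (2 * `|D| + 1)).
have D1 : 0 < 2 * `|D| + 1 by rewrite ltr_wpDl ?mulr_ge0.
have s0 : 0 < s by rewrite lt_min ltr01 !divr_gt0.
have s01 : 0 < s <= 1 by rewrite s0 ge_min lexx.
have sD : 2 * (s * D) <= e / 2.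
  apply: (@le_trans _ _ (s * (2 * `|D| + 1))).
    by rewrite mulrCA ler_wpM2l ?(ltW s0)//; have := ler_norm D; lra.
  by rewrite -ler_pdivlMr// ge_min lexx orbT.
have e20 : 0 < e / 2 by rewrite divr_gt0.
have /cvgrPdist_le /(_ _ e20) [N0 _ hN0] := defect_sum K s01 (smooth_rapid_rapid sphi) ophi.
exists N0 => // N /= hN; have := hN0 N hN; rewrite /= !sub0r !normrN => h1.
have := normr_sum_inv_sqr_le N (fun n => hD s n s01).
rewrite sumrB => h2.
have := ler_normB (\sum_(n < N) defect K s phi n) (\sum_(n < N) defect K s phi n - \sum_(n < N) limit_defect K phi phi' n).
rewrite opprB addrC subrK; lra.
Qed.

End SmoothRapid.

(** * From real to complex functions *)

Section RealFormula.
Context {R : realType}.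
Variable K : nat.
Implicit Types (f g h phi : R -> R) (a c t s x y xi C : R).

Definition direct_term phi (n : nat) : R := reps K n * (phi (Num.sqrt n%:R) / Num.sqrt n%:R).
Definition dual_term phi (n : nat) : R := reps K n * radial K phi (Num.sqrt n%:R).

(** [cvg_series_inv_sqr] for series that start at [1]. *)
Lemma cvg_series1_inv_sqr (u : nat -> R) C :
  (forall n, (0 < n)%N -> `|u n| <= C / n.+1%:R ^+ 2) ->
  cvgn (fun N => \sum_(1 <= n < N) u n).
Proof.
move=> hC; have [v vE] : exists v : nat -> R, forall n, v n = if n == 0%N then 0 else u n by exists (fun n => if n == 0%N then 0 else u n).
have : cvgn (fun N => \sum_(n < N) v n).
  apply: (@cvg_series_inv_sqr R v `|C|) => n; rewrite vE; case: eqP => [->|/eqP n0].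
    by rewrite normr0 expr1n divr1.
  apply: (le_trans (hC n _)); first by rewrite lt0n.
  by rewrite ler_wpM2r ?invr_ge0 ?exprn_ge0// ler_norm.
have -> // : (fun N => \sum_(1 <= n < N) u n) = (fun N => \sum_(n < N) v n).
apply/funext => -[|N]; first by rewrite big_ord0 big_geq.
rewrite -(big_mkord predT v) [RHS]big_ltn// vE eqxx add0r; apply: eq_big_nat => n /andP[n0 _].
by rewrite vE gtn_eqF.
Qed.

(** [limit_defect_sum] with its two sides separated, each converging by
    itself. *)
Lemma real_formula phi phi' : smooth_rapid phi -> (forall y, phi (- y) = - phi y) ->
  (forall x, is_derive x 1 phi (phi' x)) ->
  exists A B, [/\ \sum_(1 <= n < N) direct_term phi n @[N --> \oo] --> A,
    \sum_(1 <= n < N) dual_term phi n @[N --> \oo] --> B &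
    phi' 0 + A = radial0 K phi + B].
Proof.
move=> sphi ophi dphi.
have [CA hA] := direct_term_decay K sphi.
have [CB hB] := dual_term_decay K K sphi.
have cA := cvg_series1_inv_sqr hA; have cB := cvg_series1_inv_sqr hB.
exists (limn (fun N => \sum_(1 <= n < N) direct_term phi n)),
       (limn (fun N => \sum_(1 <= n < N) dual_term phi n)); split => //.
set A := limn _; set B := limn _.
have := limit_defect_sum K sphi ophi dphi.
rewrite -(cvg_shiftS).
have -> : (fun N : nat => \sum_(n < N.+1) limit_defect K phi phi' n) = (fun N =>
   (phi' 0 - radial0 K phi) + (\sum_(1 <= n < N.+1) direct_term phi n - \sum_(1 <= n < N.+1) dual_term phi n)).
  apply/funext => N; rewrite -(big_mkord predT (limit_defect K phi phi')) big_ltn//.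
  congr (_ + _); rewrite -sumrB; apply: eq_big_nat => n /andP[n0 _].
  by rewrite /limit_defect gtn_eqF// mulrBr.
have cc : (phi' 0 - radial0 K phi) + (\sum_(1 <= n < N.+1) direct_term phi n - \sum_(1 <= n < N.+1) dual_term phi n) @[N --> \oo]
   --> (phi' 0 - radial0 K phi) + (A - B).
  apply: cvgD; first exact: cvg_cst.
  by apply: cvgB; rewrite (cvg_shiftS (fun N => \sum_(1 <= n < N) _)); [exact: cA|exact: cB].
move=> c0; have E : (phi' 0 - radial0 K phi) + (A - B) = 0.
  by rewrite -(cvg_lim _ cc)// (cvg_lim _ c0).
by move: E {cc c0}; clearbody A B; move: (phi' 0) (radial0 K phi) => p r; lra.
Qed.

End RealFormula.

Section RealParts.
Context {R : realType}.
Local Open Scope complex_scope.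
Implicit Types (f : R -> R).
Notation mu := (@lebesgue_measure R).

(** Passes through symmetric intervals, where the substitution
    [y |-> - y] applies. *)
Lemma Rintegral_odd f : rapid f -> (forall y, f (- y) = - f y) -> \int[mu]_(y in setT) f y = 0.
Proof.
move=> [cf /(_ 2%N)[C fC]] of_.
have cv := cvg_Rintegral_itv 0 cf fC.
have z (n : nat) : \int[mu]_(y in `[- (n%:R + 0), n%:R + 0]) f y = 0.
  have n0 : 0 <= n%:R :> R by [].
  have := @integration_by_substitution_oppr R f (- (n%:R + 0)) (n%:R + 0).
  rewrite opprK => /(_ _ (continuous_subspaceT cf)) H.
  have {}H : \int[mu]_(y in `[- (n%:R + 0), n%:R + 0]) f y = \int[mu]_(y in `[- (n%:R + 0), n%:R + 0]) (- f y).
    rewrite /Rintegral H; last by lra.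
    by congr fine; apply: eq_integral => x _ /=; rewrite of_.
  have fi : mu.-integrable `[- (n%:R + 0), n%:R + 0] (EFin \o f).
    apply: continuous_compact_integrable; first exact: segment_compact.
    exact: continuous_subspaceT.
  have HN : \int[mu]_(y in `[- (n%:R + 0), n%:R + 0]) (- f y) = - \int[mu]_(y in `[- (n%:R + 0), n%:R + 0]) f y.
    by rewrite -[RHS]mulN1r -RintegralZl//; apply: eq_Rintegral => y _; rewrite mulN1r.
  move: H; rewrite HN => /eqP; rewrite -addr_eq0 -mulr2n mulrn_eq0 /=.
  by move=> /eqP.
have c0 : (0 : R) @[n --> \oo] --> (0 : R) by exact: cvg_cst.
rewrite -(cvg_lim _ cv)//.
under eq_fun do rewrite z.
exact: cvg_lim.
Qed.

Lemma derive1n_family f (F : nat -> R -> R) : F 0%N = f ->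
  (forall n (x : R), is_derive x (1 : R) (F n) (F n.+1 x)) -> forall n, derive1n n f = F n.
Proof.
move=> F0 hF; elim => [|n IH]; first by rewrite -F0.
apply/funext => x; rewrite derive1nS IH derive1E.
by rewrite (@derive_val _ _ _ _ _ _ _ (hF n x)).
Qed.

Lemma derive1n_dsintr f n : rapid f -> derive1n n (dsintr f 0) = dsintr f n.
Proof. by move=> rf; apply: (@derive1n_family _ (dsintr f)) => // m x; exact: is_derive_dsintr. Qed.

Lemma derive1n_oppr_dsintr f n : rapid f ->
  derive1n n (fun x => - dsintr f 0 x) = (fun x => - dsintr f n x).
Proof.
move=> rf; apply: (@derive1n_family _ (fun n x => - dsintr f n x)) => // m x.
by have H := is_derive_dsintr m x rf; exact: is_deriveN.
Qed.

(** Turns the bounds on [|x| ^ m * |f x|] that define the Schwartz class into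
    weighted norms. *)
Lemma weight_expr_le_sum (m : nat) (x : R) : weight x ^+ m <= 2 ^+ m * (1 + `|x| ^+ m).
Proof.
rewrite /weight; have [h|h] := leP `|x| 1.
  apply: (@le_trans _ _ (2 ^+ m)); first by rewrite lerXn2r ?nnegrE ?addr_ge0//; lra.
  by rewrite ler_peMr ?exprn_ge0// lerDl exprn_ge0.
apply: (@le_trans _ _ ((2 * `|x|) ^+ m)); first by rewrite lerXn2r ?nnegrE ?addr_ge0 ?mulr_ge0//; lra.
by rewrite exprMn ler_wpM2l ?exprn_ge0// lerDr.
Qed.

(** Stated for an arbitrary [part] so that it serves for both [Re] and [Im]. *)
Lemma smooth_rapid_part (phi : R -> R[i]) (part : R[i] -> R) :
  (forall z, `|part z|%:C <= `|z|) ->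
  (forall n (x : R), derivable (derive1n n (part \o phi)) x 1) ->
  (forall n (x : R), part (cderiven n phi x) = derive1n n (part \o phi) x) ->
  (forall m n : nat, exists C : R, forall x : R, `|x%:C ^+ m * cderiven n phi x| <= C%:C) ->
  smooth_rapid (part \o phi).
Proof.
move=> hpart hder hE hdec; exists (fun n => derive1n n (part \o phi)) => //.
have dn n (x : R) : is_derive x (1 : R) (derive1n n (part \o phi)) (derive1n n.+1 (part \o phi) x).
  by rewrite derive1nS derive1E; apply: DeriveDef.
have bd m n : exists C : R, forall x : R, `|x| ^+ m * `|derive1n n (part \o phi) x| <= C.
  have [C hC] := hdec m n; exists C => x; rewrite -lecR.
  apply: le_trans (hC x); rewrite normrM normrX rmorphM rmorphXn /= -hE.
  rewrite -(_ : `|x%:C| = `|x|%:C); last by rewrite normc_def /= expr0n addr0 sqrtr_sqr.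
  by rewrite ler_wpM2l// exprn_ge0.
move=> n; split => //; split; first by apply: is_derive_continuous => x; exact: dn.
move=> A; have [C0 hC0] := bd 0%N n; have [C hC] := bd A n.
exists (2 ^+ A * (C0 + C)) => x; have := hC0 x; have := hC x; rewrite expr0 mul1r => h1 h0.
apply: (le_trans (ler_wpM2r (normr_ge0 _) (weight_expr_le_sum A x))).
by rewrite -mulrA ler_wpM2l ?exprn_ge0// mulrDl mul1r lerD.
Qed.

Lemma normc_ge_Im (z : R[i]) : `|complex.Im z|%:C <= `|z|.
Proof.
by case: z => a b; rewrite normc_def lecR /= -sqrtr_sqr ler_sqrt ?addr_ge0 ?sqr_ge0// lerDr sqr_ge0.
Qed.

Lemma schwartz_smooth_rapid (phi : R -> R[i]) : schwartz phi ->
  smooth_rapid (fun y => complex.Re (phi y)) /\ smooth_rapid (fun y => complex.Im (phi y)).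
Proof.
move=> [hs hd]; split.
  apply: (@smooth_rapid_part phi (@complex.Re R)) => //; first exact: normc_ge_Re.
  by move=> n x; have [] := hs n x.
apply: (@smooth_rapid_part phi (@complex.Im R)) => //; first exact: normc_ge_Im.
by move=> n x; have [] := hs n x.
Qed.

Lemma cexp_oppi (c : R) : cexp (- (c%:C * 'i%C)) = cos c +i* (- sin c).
Proof.
have -> : - (c%:C * 'i%C) = 0 +i* (- c) :> R[i].
  by apply/eqP; rewrite eq_complex /=; apply/andP; split; apply/eqP; ring.
by rewrite /cexp /= expR0 mul1r cosN sinN.
Qed.

(** The cosine integrals of the odd functions [Re phi] and [Im phi] vanish. *)
Lemma fourier_odd (phi : R -> R[i]) (t : R) : schwartz phi -> (forall x, phi (- x) = - phi x) ->
  fourier phi t = dsintr (fun y => complex.Im (phi y)) 0 t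
     +i* (- dsintr (fun y => complex.Re (phi y)) 0 t).
Proof.
move=> /schwartz_smooth_rapid[/smooth_rapid_rapid ra /smooth_rapid_rapid rb] ophi.
have oa y : complex.Re (phi (- y)) = - complex.Re (phi y) by rewrite ophi; case: (phi y).
have ob y : complex.Im (phi (- y)) = - complex.Im (phi y) by rewrite ophi; case: (phi y).
set a := fun y => complex.Re (phi y) in ra oa *; set b := fun y => complex.Im (phi y) in rb ob *.
have sc j : slow (fun y => dsin j (2 * pi * t * y)) by exact: slow_dsin.
have rM f j : rapid f -> rapid (fun y => f y * dsin j (2 * pi * t * y)) by move=> rf; exact: rapidM.
have cos0 f : rapid f -> (forall y, f (- y) = - f y) ->
    \int[mu]_(y in setT) (f y * dsin 1 (2 * pi * t * y)) = 0.
  by move=> rf of_; apply: Rintegral_odd => [|y]; [exact: rM|rewrite /= mulrN cosN of_ mulNr].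
have dsE f : rapid f -> dsintr f 0 t = \int[mu]_(y in setT) (f y * dsin 0 (2 * pi * t * y)).
  move=> rf; rewrite dsintrE; apply: eq_Rintegral => y _.
  by rewrite expr0; congr (_ * _); rewrite ?mul1r ?mulr1.
rewrite /fourier /cintegral !dsE//.
under eq_Rintegral => y _.
  rewrite (_ : complex.Re _ = a y * dsin 1 (2 * pi * t * y) + b y * dsin 0 (2 * pi * t * y)); last first.
    by rewrite /a /b cexp_oppi; case: (phi y) => u v /=; ring.
  over.
under [X in _ +i* X]eq_Rintegral => y _.
  rewrite (_ : complex.Im _ = b y * dsin 1 (2 * pi * t * y) - a y * dsin 0 (2 * pi * t * y)); last first.
    by rewrite /a /b cexp_oppi; case: (phi y) => u v /=; ring.
  over.
rewrite RintegralD//; [|exact: rapid_integrable (rM _ 1%N ra)|exact: rapid_integrable (rM _ 0%N rb)].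
rewrite RintegralB//; [|exact: rapid_integrable (rM _ 1%N rb)|exact: rapid_integrable (rM _ 0%N ra)].
by rewrite !cos0// sub0r add0r.
Qed.

Lemma cderiven_fourier (phi : R -> R[i]) (j : nat) (t : R) : schwartz phi -> (forall x, phi (- x) = - phi x) ->
  cderiven j (fourier phi) t = dsintr (fun y => complex.Im (phi y)) j t
     +i* (- dsintr (fun y => complex.Re (phi y)) j t).
Proof.
move=> sphi ophi; have [/smooth_rapid_rapid ra /smooth_rapid_rapid rb] := schwartz_smooth_rapid sphi.
rewrite /cderiven.
under eq_fun do rewrite fourier_odd//=.
under [in X in _ +i* X]eq_fun do rewrite fourier_odd//=.
by rewrite derive1n_dsintr// derive1n_oppr_dsintr.
Qed.

Lemma complex_cvg (u : nat -> R[i]) (a b : R) :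
  complex.Re (u n) @[n --> \oo] --> a -> complex.Im (u n) @[n --> \oo] --> b ->
  (u n : (R[i])^o) @[n --> \oo] --> (a +i* b : (R[i])^o).
Proof.
move=> ca cb; apply/cvgrPdist_le => e e0.
move: e0; rewrite ltcE /= => /andP[/eqP ei e0].
have r0 : 0 < complex.Re e / 2 by rewrite divr_gt0.
move/cvgrPdist_le : ca => /(_ _ r0); move/cvgrPdist_le : cb => /(_ _ r0).
apply: filterS2 => n /= hb ha.
have -> : e = (complex.Re e)%:C by move: ei; case: (e) => x y /= ->.
rewrite normc_def lecR /=; case: (u n) ha hb => x y /= ha hb.
apply: (@le_trans _ _ (`|a - x| + `|b - y|)); last by lra.
rewrite -[leRHS]ger0_norm ?addr_ge0// -sqrtr_sqr ler_sqrt ?sqr_ge0// [leRHS]sqrrD.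
rewrite !real_normK ?num_real// lerD2r lerDl.
by rewrite mulrn_wge0// mulr_ge0.
Qed.

End RealParts.

(** * The coefficients, and the theorem *)

Section Assembly.
Context {R : realType}.
Local Open Scope complex_scope.

Lemma powR_half (n j : nat) : n%:R `^ (j%:R / 2) = Num.sqrt n%:R ^+ j :> R.
Proof. by rewrite mulrC powRrM powR12_sqrt// powR_mulrn// sqrtr_ge0. Qed.

Lemma alphaE K : alpha R (2 * K + 3) = (-1) ^+ K / (dfact (2 * K + 1))%:R * (2 * pi) ^- K.
Proof.
rewrite /alpha; have -> : (2 * K + 3 - 2 = 2 * K + 1)%N by lia.
have -> : ((2 * K + 3 - 3)./2 = K)%N by lia.
by rewrite div1r exprVn.
Qed.

Lemma betaE K j : (j <= K)%N -> beta R j (2 * K + 3) = bcoef K j * (2 * pi) ^- K.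
Proof.
move=> jK; rewrite /beta bcoefE//.
have -> : (2 * K + 3 - j - 3 = 2 * K - j)%N by lia.
have -> : (2 * K + 3 - 2 * j - 3 = 2 * K - 2 * j)%N by lia.
have -> : ((2 * K + 3 - 3)./2 = K)%N by lia.
by rewrite div1r exprVn.
Qed.

(** The coefficient [n ^ - (k - 2) / 2 * n ^ (j / 2)] of the [j]-th derivative is
    [xi ^ - (2 K + 1 - j)] at [xi = sqrt n]. *)
Lemma radial_sqrt_nat K (f : R -> R) n : (0 < n)%N ->
  (n%:R `^ ((2 * K + 1)%:R / 2))^-1 *
  \sum_(0 <= j < K.+1) beta R j (2 * K + 3) * (n%:R `^ (j%:R / 2)) * dsintr f j (Num.sqrt n%:R) =
  radial K f (Num.sqrt n%:R).
Proof.
move=> n0; have x0 : Num.sqrt n%:R != 0 :> R by rewrite gt_eqF// sqrtr_gt0 ltr0n.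
rewrite powR_half big_mkord /radial !mulr_sumr; apply: eq_bigr => j _.
rewrite (betaE (ltn_ord j : (j <= K)%N)) powR_half; have jK := ltn_ord j.
have -> : (2 * K + 1 = (2 * K + 1 - j) + j)%N by move: (nat_of_ord j) jK => i; lia.
rewrite addnK exprD invfM exprVn; move: (Num.sqrt n%:R ^+ j) (expf_neq0 j x0) => z z0.
rewrite [LHS](_ : _ = bcoef K j * (2 * pi) ^- K * (Num.sqrt n%:R ^- (2 * K + 1 - j)) * dsintr f j (Num.sqrt n%:R) * (z / z)); last by ring.
by rewrite divff// mulr1; ring.
Qed.

Lemma scale_complex (c a b : R) : c%:C * (a +i* b) = (c * a) +i* (c * b).
Proof. by apply/eqP; rewrite eq_complex /= !mul0r subr0 addr0 !eqxx. Qed.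

Lemma add_complex (a b c d : R) : (a +i* b) + (c +i* d) = (a + c) +i* (b + d).
Proof. by []. Qed.

Lemma sum_complex (r : seq nat) (F G : nat -> R) :
  \sum_(i <- r) (F i +i* G i) = (\sum_(i <- r) F i) +i* (\sum_(i <- r) G i).
Proof. by elim: r => [|x r IH]; rewrite ?big_nil// !big_cons IH add_complex. Qed.

End Assembly.

Local Open Scope complex_scope.

Theorem theorem2p2 (R : realType) (phi : R -> R[i])
  (phi_odd : forall x : R, phi (- x) = - phi x) (phi_schwartz : schwartz phi)
  (k : nat) (k_odd : odd k) (k_ge3 : (3 <= k)%N) :
  let psi := fourier phi in
  let lhs_term (n : nat) : (R[i])^o :=
    ((nb_squares_reps k n)%:R / Num.sqrt n%:R)%:C * phi (Num.sqrt n%:R) in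
  let rhs_term (n : nat) : (R[i])^o :=
    ((nb_squares_reps k n)%:R / (n%:R `^ ((k - 2)%:R / 2)))%:C *
    \sum_(0 <= j < ((k - 3)./2).+1)
      (beta R j k * (n%:R `^ (j%:R / 2)))%:C * cderiven j psi (Num.sqrt n%:R) in
  [/\ cvgn (fun N : nat => \sum_(1 <= n < N) lhs_term n),
      cvgn (fun N : nat => \sum_(1 <= n < N) rhs_term n) &
      cderiven 1 phi 0 + \big[+%R/0]_(1 <= n <oo) lhs_term n =
      'i%C * (alpha R k)%:C * cderiven (k - 2) psi 0
      + 'i%C * \big[+%R/0]_(1 <= n <oo) rhs_term n].
Proof.
move=> psi lhs_term rhs_term.
have [K kE] : exists K, k = (2 * K + 3)%N by exists (k - 3)./2; have := odd_double_half k; rewrite k_odd; lia.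
have [sa sb] := schwartz_smooth_rapid phi_schwartz.
set a := fun y => complex.Re (phi y) in sa *; set b := fun y => complex.Im (phi y) in sb *.
have oa y : a (- y) = - a y by rewrite /a phi_odd; case: (phi y).
have ob y : b (- y) = - b y by rewrite /b phi_odd; case: (phi y).
have psiE j t : cderiven j psi t = dsintr b j t +i* (- dsintr a j t) by exact: cderiven_fourier.
have da (x : R) : is_derive x (1 : R) a (derive1 a x).
  by have [f' _ /(_ x) H] := smooth_rapid_derive sa; rewrite derive1E; apply: DeriveDef.
have db (x : R) : is_derive x (1 : R) b (derive1 b x).
  by have [f' _ /(_ x) H] := smooth_rapid_derive sb; rewrite derive1E; apply: DeriveDef.
have [Aa [Ba [cAa cBa Ea]]] := real_formula K sa oa da.
have [Ab [Bb [cAb cBb Eb]]] := real_formula K sb ob db.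
have lE N : \sum_(1 <= n < N) lhs_term n =
    (\sum_(1 <= n < N) direct_term K a n) +i* (\sum_(1 <= n < N) direct_term K b n).
  rewrite -sum_complex; apply: eq_bigr => n _.
  rewrite /lhs_term /direct_term /reps -kE /a /b; case: (phi _) => x y /=.
  by rewrite scale_complex; congr (_ +i* _); ring.
have rE N : \sum_(1 <= n < N) rhs_term n =
    (\sum_(1 <= n < N) dual_term K b n) +i* (- \sum_(1 <= n < N) dual_term K a n).
  rewrite -sumrN -sum_complex; apply: eq_big_nat => n /andP[n0 _].
  rewrite /rhs_term /dual_term /reps -kE -!radial_sqrt_nat// -kE.
  have -> : ((k - 3)./2 = K)%N by rewrite kE; lia.
  have -> : (k - 2 = 2 * K + 1)%N by rewrite kE; lia.
  under eq_bigr do rewrite psiE scale_complex mulrN.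
  by rewrite sum_complex scale_complex sumrN mulrN; congr (_ +i* - _); rewrite mulrA.
have cl : (\sum_(1 <= n < N) lhs_term n) @[N --> \oo] --> (Aa +i* Ab : (R[i])^o).
  under eq_fun do rewrite lE.
  by apply: complex_cvg.
have cr : (\sum_(1 <= n < N) rhs_term n) @[N --> \oo] --> (Bb +i* (- Ba) : (R[i])^o).
  under eq_fun do rewrite rE.
  by apply: complex_cvg => //=; exact: cvgN.
split; [by apply/cvg_ex; eexists; exact: cl|by apply/cvg_ex; eexists; exact: cr|].
rewrite (cvg_lim _ cl); last exact: norm_hausdorff.
rewrite (cvg_lim _ cr); last exact: norm_hausdorff.
rewrite psiE {1}/cderiven derive1n1 derive1n1 kE alphaE.
have -> : (2 * K + 3 - 2 = 2 * K + 1)%N by lia.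
rewrite -mulrA scale_complex add_complex.
move: Ea Eb; rewrite /radial0 => Ea Eb.
apply/eqP; rewrite eq_complex /= !(mul0r, mul1r) !(add0r, sub0r, addr0, subr0) mulrN !opprK.
by rewrite Ea Eb !eqxx.
Qed.
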